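(* Let $f:G\to\mathbb C$ be a smooth zonal spherical function for $(G,H)$ (i.e. $f(hgh')=f(g)$ for all $g\in G$, $h,h'\in H$), as is the case for conformal blocks of two scalar $p$-dimensional defects in $d$-dimensional Euclidean spacetime. Then on every standard Cartan subset $C'$ the quadratic Casimir element acts by the operator $L(k)$: $$(\Omega_{\mathfrak g}\cdot f)|_{C'\cap G_{rs}}=(f\cdot\Omega_{\mathfrak g})|_{C'\cap G_{rs}}=L(k)\,(f|_{C'\cap G_{rs}}),$$ for a root system $R=2\Sigma(\mathfrak g:\mathfrak c')$ of type $B_N$ (or $D_N$ in case $2p=d-2$), where $N=\min(p+2,d-p)$, with multiplicities $$k_{\mathrm{short}}=\frac{|d-2-2p|}{2},\qquad k_{\mathrm{long}}=\frac12.$$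
   Context: Let $d>2$ and $0\le p\le d-1$ be integers, $\eta=\operatorname{diag}(1,\dots,1,-1)$ on $\mathbb R^{d+2}$ with basis $e_0,\dots,e_{d+1}$, $G=SO(d+1,1)_0$, $H=SO(d-p)\times SO(p+1,1)_0$ (block diagonal, the first block acting on $e_0,\dots,e_{d-p-1}$), $\sigma$ = conjugation by $\operatorname{diag}(1_{d-p},-1_{p+2})$, $B(X,Y)=\operatorname{tr}(XY)$ on $\mathfrak g=\mathfrak{so}(d+1,1)$, and $\Omega_{\mathfrak g}$ the quadratic Casimir element with respect to $B$. $F_{\mu\nu}\in\mathfrak g$ is given by $F_{\mu\nu}e_\rho=\eta_{\nu\rho}e_\mu-\eta_{\mu\rho}e_\nu$. $\Omega_{\mathfrak g}$ acts on functions via $(X\cdot f)(g)=\frac{d}{ds}f(g\exp(sX))|_{s=0}$ and $(f\cdot X)(g)=\frac d{ds}f(\exp(sX)g)|_{s=0}$. The standard Cartan subsets $C'=\exp(\mathfrak c')t$ are: if $2p<d-1$, only $C=\exp(\mathfrak c)$ with $\mathfrak c=\operatorname{span}\{F_{i+1,d-i}:0\le i\le p\}\oplus\mathbb RF_{0,d+1}$, $t=1$; if $2p\ge d-1$, $C=\exp(\mathfrak c)$ with $\mathfrak c=\operatorname{span}\{F_{i,d-i}:0\le i\le d-p-1\}$, $t=1$, and, for $0\le i\le d-p-1$, $C_i=\exp(\mathfrak c_i)$ ($t=1$) and $C_i'=\exp(\mathfrak c_i)t$ with $t=\exp(\pi F_{i,d-i})$, where $\mathfrak c_i=\operatorname{span}\{F_{j,d-j}:0\le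 j\le d-p-1,\ j\ne i\}\oplus\mathbb RF_{i,d+1}$. $G_{rs}$ is the set of $g\in G$ such that $\sigma\circ\operatorname{Ad}(g)\circ\sigma\circ\operatorname{Ad}(g)^{-1}$ is a semisimple automorphism of $\mathfrak g$ and $\mathfrak g^{-\sigma}\cap\operatorname{Ad}(g)(\mathfrak g^{-\sigma})$ is commutative, where $\mathfrak g^{-\sigma}$ is the $-1$-eigenspace of $\sigma$. $\Sigma(\mathfrak g:\mathfrak c')\subset(\mathfrak c'_{\mathbb C})^*$ is the set of nonzero weights of $\operatorname{ad}(\mathfrak c'_{\mathbb C})$ on $\mathfrak g_{\mathbb C}$, and $R=2\Sigma(\mathfrak g:\mathfrak c')$. For $\lambda\in(\mathfrak c'_{\mathbb C})^*$ let $C_\lambda\in\mathfrak c'_{\mathbb C}$ be defined by $\lambda(Y)=B(C_\lambda,Y)$ for $Y\in\mathfrak c'_{\mathbb C}$; $\partial_\lambda$ is the derivative $(\partial_\lambda F)(x)=\frac{d}{ds}F(\exp(sC_\lambda)x)|_{s=0}$ on functions on $C'$ (extended complex-linearly in $\lambda$), and $e^\lambda(\exp(X)t)=\exp(\lambda(X))$ for $X\in\mathfrak c'$, $\lambda\in\pm R$. For a choice $R^+$ of positive roots and a basis $\xi_1,\dots,\xi_N$ of $(\mathfrak c'_{\mathbb C})^*$ orthonormal for the form dual to $B$, $$L(k)=\sum_{i=1}^N\partial_{\xi_i}^2+\sum_{\alpha\in R^+}k_\alpha\frac{1+e^{-\alpha}}{1-e^{-\alpha}}\partial_\alpha.$$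 *)

(* Defs.v *)
From HB Require Import structures.
From mathcomp Require Import all_boot all_order all_algebra.
From mathcomp Require Import complex.
From mathcomp Require Import all_classical all_reals all_analysis.

Import Order.TTheory GRing.Theory Num.Theory.
Import numFieldNormedType.Exports.

Local Open Scope classical_set_scope.
Local Open Scope ring_scope.
Local Open Scope complex_scope.

(* Functions on a matrix group G are total functions 'M[R]_n -> R[i]; every
   notion below only looks at their values on G. *)

Section Calculus.
Context {R : realType}.

Definition cexp (z : R[i]) : R[i] :=
  (expR (complex.Re z) * cos (complex.Im z)) +i*
  (expR (complex.Re z) * sin (complex.Im z)).

(* R[i] carries no normed R-module structure in the library, hence the
   componentwise derivative. *)
Definition cderiv0 (h : R -> R[i]) : R[i] :=
  derive1 (fun s => complex.Re (h s)) 0 +i*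
  derive1 (fun s => complex.Im (h s)) 0.

Fixpoint Ck {V : normedModType R} (k : nat) (U : set V) (F : V -> R) : Prop :=
  match k with
  | 0 => forall x, U x -> {for x, continuous F}
  | k'.+1 => (forall x, U x -> differentiable F x) /\
             (forall v : V, Ck k' U (fun x => 'D_v F x))
  end.

(* Smoothness on a subset A: near each point of A, f is the restriction of a
   C^oo function on an open set; for an embedded submanifold A this is
   smoothness in the sense of manifolds. *)
Definition smooth_on {V : normedModType R} (A : set V) (f : V -> R[i]) : Prop :=
  forall x, A x -> exists (U : set V) (F1 F2 : V -> R),
    [/\ open U, U x,
        forall k, Ck k U F1 /\ Ck k U F2 &
        forall y, A y -> U y -> f y = F1 y +i* F2 y].

Definition expmx {n : nat} (X : 'M[R]_n.+1) : 'M[R]_n.+1 :=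
  limn (series (fun k => (k`!%:R)^-1 *: X ^+ k)).

Definition mxC {m n : nat} (X : 'M[R]_(m, n)) : 'M[R[i]]_(m, n) :=
  map_mx (real_complex R) X.

Definition mxRe {m n : nat} (X : 'M[R[i]]_(m, n)) : 'M[R]_(m, n) :=
  map_mx (@complex.Re R) X.

Definition mxIm {m n : nat} (X : 'M[R[i]]_(m, n)) : 'M[R]_(m, n) :=
  map_mx (@complex.Im R) X.

Definition complexify {n : nat} (W : {vspace 'M[R]_n}) : {vspace 'M[R[i]]_n} :=
  <<[seq mxC v | v <- vbasis W]>>%VS.

(* (X . f)(g) and (f . X)(g) *)
Definition actl {n : nat} (X : 'M[R]_n.+1) (f : 'M[R]_n.+1 -> R[i]) :
    'M[R]_n.+1 -> R[i] :=
  fun g => cderiv0 (fun s => f (g *m expmx (s *: X))).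

Definition actr {n : nat} (f : 'M[R]_n.+1 -> R[i]) (X : 'M[R]_n.+1) :
    'M[R]_n.+1 -> R[i] :=
  fun g => cderiv0 (fun s => f (expmx (s *: X) *m g)).

End Calculus.

Definition Bform {K : comNzRingType} {n : nat} (X Y : 'M[K]_n) : K :=
  \tr (X *m Y).

Section Groups.
Context {R : realType}.

Definition eta (n : nat) : 'M[R]_n.+1 :=
  diag_mx (\row_i (if i == ord_max then -1 else 1)).

Definition SO_of {n : nat} (J : 'M[R]_n) : set 'M[R]_n :=
  [set g | g^T *m J *m g = J /\ \det g = 1].

(* SO(m+1,1)_0 *)
Definition SO0 (m : nat) : set 'M[R]_m.+2 :=
  connected_component (SO_of (eta m.+1)) 1%:M.

(* SO(d-p) x SO(p+1,1)_0; conform_mx only transports along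
   (d - p) + p.+2 = d.+2, which holds for p <= d. *)
Definition defect_subgroup (d p : nat) : set 'M[R]_d.+2 :=
  [set h | exists (A : 'M[R]_(d - p)) (B : 'M[R]_p.+2),
     [/\ SO_of 1%:M A, SO0 p B &
         h = conform_mx (0 : 'M[R]_d.+2) (block_mx A 0 0 B)]].

Definition zonal {d : nat} (p : nat) (f : 'M[R]_d.+2 -> R[i]) : Prop :=
  forall g h h', SO0 d g -> defect_subgroup d p h -> defect_subgroup d p h' ->
    f (h *m g *m h') = f g.

Definition so_defect {n : nat} (J X : 'M[R]_n) : 'M[R]_n := X^T *m J + J *m X.

Fact so_defect_is_linear {n : nat} (J : 'M[R]_n) : linear (so_defect J).
Proof.
move=> a X Y; rewrite /so_defect linearP /= mulmxDl mulmxDr -scalemxAl -scalemxAr.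
by rewrite scalerDr addrACA.
Qed.

HB.instance Definition _ (n : nat) (J : 'M[R]_n) :=
  GRing.isLinear.Build R 'M[R]_n 'M[R]_n *:%R (so_defect J)
    (so_defect_is_linear J).

Definition so_alg {n : nat} (J : 'M[R]_n) : {vspace 'M[R]_n} :=
  lker (linfun (so_defect J)).

Lemma mem_so_alg {n : nat} (J X : 'M[R]_n) :
  (X \in so_alg J) = (X^T *m J + J *m X == 0).
Proof. by rewrite memv_ker lfunE. Qed.

(* so(d+1,1) *)
Definition so_conf (d : nat) : {vspace 'M[R]_d.+2} := so_alg (eta d.+1).

Definition Fmx {d : nat} (mu nu : 'I_d.+2) : 'M[R]_d.+2 :=
  \matrix_(i, rho) (eta d.+1 nu rho *+ (i == mu) - eta d.+1 mu rho *+ (i == nu)).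

Definition Smx (d p : nat) : 'M[R]_d.+2 :=
  diag_mx (\row_i (if (i < d - p)%N then 1 else -1)).

(* Smx is an involution *)
Definition sigma {d : nat} (p : nat) (X : 'M[R]_d.+2) : 'M[R]_d.+2 :=
  Smx d p *m X *m Smx d p.

Definition Ad {n : nat} (g X : 'M[R]_n) : 'M[R]_n := g *m X *m invmx g.

Definition sigma_minus (d p : nat) : set 'M[R]_d.+2 :=
  [set X | X \in so_conf d /\ sigma p X = - X].

Definition semisimple_on {V : vectType R} (W : {vspace V}) (phi : V -> V) :
    Prop :=
  forall U : {vspace V}, (U <= W)%VS -> (forall u, u \in U -> phi u \in U) ->
  exists U' : {vspace V}, [/\ (U' <= W)%VS, forall u, u \in U' -> phi u \in U',
    (U + U')%VS = W & (U :&: U')%VS = 0%VS].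

Definition Grs (d p : nat) : set 'M[R]_d.+2 :=
  [set g | [/\ SO0 d g,
     semisimple_on (so_conf d)
       (fun X => sigma p (Ad g (sigma p (Ad (invmx g) X)))) &
     forall X Y, (sigma_minus d p `&` (Ad g @` sigma_minus d p)) X ->
                 (sigma_minus d p `&` (Ad g @` sigma_minus d p)) Y ->
                 X *m Y = Y *m X]].

(* X and Y are bases of g dual to each other for B, so that the quadratic
   Casimir element is \sum_i X_i Y_i. *)
Definition dual_bases {d : nat} (X Y : (\dim (so_conf d)).-tuple 'M[R]_d.+2) :
    Prop :=
  [/\ basis_of (so_conf d) X, basis_of (so_conf d) Y &
      forall i j, Bform (tnth X i) (tnth Y j) = (i == j)%:R].

Definition casimirl {d m : nat} (X Y : m.-tuple 'M[R]_d.+2)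
    (f : 'M[R]_d.+2 -> R[i]) : 'M[R]_d.+2 -> R[i] :=
  fun g => \sum_(i < m) actl (tnth X i) (actl (tnth Y i) f) g.

Definition casimirr {d m : nat} (f : 'M[R]_d.+2 -> R[i])
    (X Y : m.-tuple 'M[R]_d.+2) : 'M[R]_d.+2 -> R[i] :=
  fun g => \sum_(i < m) actr (actr f (tnth X i)) (tnth Y i) g.

(* standard_cartan d p c t: exp(c) t is one of the standard Cartan subsets *)
Inductive standard_cartan {d : nat} (p : nat) :
    {vspace 'M[R]_d.+2} -> 'M[R]_d.+2 -> Prop :=
| Cartan_low of (2 * p < d - 1)%N :
    standard_cartan p
      <<rcons [seq Fmx (inord i.+1) (inord (d - i)) | i <- iota 0 p.+1]
              (Fmx ord0 ord_max)>>%VS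
      1%:M
| Cartan_compact of (d - 1 <= 2 * p)%N :
    standard_cartan p
      <<[seq Fmx (inord i) (inord (d - i)) | i <- iota 0 (d - p)]>>%VS
      1%:M
| Cartan_i (i : nat) of (d - 1 <= 2 * p)%N & (i < d - p)%N :
    standard_cartan p
      <<rcons [seq Fmx (inord j) (inord (d - j)) | j <- iota 0 (d - p) & j != i]
              (Fmx (inord i) ord_max)>>%VS
      1%:M
| Cartan_i' (i : nat) of (d - 1 <= 2 * p)%N & (i < d - p)%N :
    standard_cartan p
      <<rcons [seq Fmx (inord j) (inord (d - j)) | j <- iota 0 (d - p) & j != i]
              (Fmx (inord i) ord_max)>>%VS
      (expmx (pi *: Fmx (inord i) (inord (d - i)))).

End Groups.

Notation dualC W := 'Hom(subvs_of (complexify W), (complex _)^o).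

Section RadialPart.
Context {R : realType} {d : nat}.
Variable c : {vspace 'M[R]_d.+2}.

Definition weights : set (dualC c) :=
  [set l | l != 0 /\ exists E : 'M[R[i]]_d.+2,
     [/\ E \in complexify (so_conf d), E != 0 &
         forall Y : subvs_of (complexify c),
           vsval Y *m E - E *m vsval Y = (l Y : R[i]) *: E]].

Definition root_system : set (dualC c) :=
  [set a | exists2 l, weights l & a = 2 *: l].

Definition coroot (l : dualC c) : subvs_of (complexify c) :=
  xget 0 [set C | forall Y, (l Y : R[i]) = Bform (vsval C) (vsval Y)].

Definition dual_form (l m : dualC c) : R[i] :=
  Bform (vsval (coroot l)) (vsval (coroot m)).

Definition partial (l : dualC c) (F : 'M[R]_d.+2 -> R[i]) : 'M[R]_d.+2 -> R[i] :=
  fun x => actr F (mxRe (vsval (coroot l))) x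
           + (0 +i* 1) * actr F (mxIm (vsval (coroot l))) x.

(* e^l at the point exp(X) t *)
Definition exp_weight (l : dualC c) (X : 'M[R]_d.+2) : R[i] :=
  cexp (l (vsproj (complexify c) (mxC X))).

Definition positive_system (P : seq (dualC c)) : Prop :=
  [/\ uniq P,
      forall a, root_system a <-> (a \in P \/ - a \in P),
      forall a, a \in P -> - a \notin P &
      forall a b, a \in P -> b \in P -> root_system (a + b) -> a + b \in P].

Definition orthonormal_basis {N : nat} (xi : N.-tuple (dualC c)) : Prop :=
  basis_of fullv xi /\
  forall i j, dual_form (tnth xi i) (tnth xi j) = (i == j)%:R.

(* L(k) F at the point exp(X) t *)
Definition Lop {N : nat} (xi : N.-tuple (dualC c)) (P : seq (dualC c))
    (k : (dualC c) -> R[i]) (t : 'M[R]_d.+2) (F : 'M[R]_d.+2 -> R[i])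
    (X : 'M[R]_d.+2) : R[i] :=
  let x := expmx X *m t in
  \sum_(i < N) partial (tnth xi i) (partial (tnth xi i) F) x
  + \sum_(a <- P) k a * ((1 + exp_weight (- a) X) / (1 - exp_weight (- a) X))
                  * partial a F x.

Definition short_roots {N : nat} (eps : N.-tuple (dualC c)) : set (dualC c) :=
  [set a | exists i, a = tnth eps i \/ a = - tnth eps i].

Definition long_roots {N : nat} (eps : N.-tuple (dualC c)) : set (dualC c) :=
  [set a | exists (i j : 'I_N) (s s' : bool), i != j /\
     a = (-1) ^+ s *: tnth eps i + (-1) ^+ s' *: tnth eps j].

Definition orthogonal_frame {N : nat} (eps : N.-tuple (dualC c)) : Prop :=
  basis_of fullv eps /\
  exists r : R, 0 < r /\
    forall i j, dual_form (tnth eps i) (tnth eps j) = (r *+ (i == j))%:C.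

Definition typeB {N : nat} (eps : N.-tuple (dualC c)) : Prop :=
  orthogonal_frame eps /\ root_system = short_roots eps `|` long_roots eps.

Definition typeD {N : nat} (eps : N.-tuple (dualC c)) : Prop :=
  orthogonal_frame eps /\ root_system = long_roots eps.

Definition multiplicity (p : nat) {N : nat} (eps : N.-tuple (dualC c)) (a : dualC c) :
    R[i] :=
  (if `[< short_roots eps a >] then `|d%:R - 2 - 2 * p%:R| / 2 else 1 / 2 : R)%:C.

End RadialPart.

(* Main.v *)
(* The Casimir element is the sum over pairs of vectors of a basis of C^(d+2)
   of the products of the corresponding bivectors. Take for this basis the
   eigenvectors r_k of the Cartan subspace, so that the bivectors r_k /\ r_l
   are its root vectors, and x = exp(Z). For a root vector E with
   Ad(x) E = q E one has Ad(x) (sigma E) = q^-1 sigma E, while U = E + sigma E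
   lies in the complexified Lie algebra of H. Bi-invariance under H makes the
   second derivative of f along (E*, U) the first derivative along [E*, U] and
   the one along (E*, Ad(x) U) zero; these two linear equations determine the
   second derivative along (E*, E) as (1 - q^2)^-1 times the first derivative
   along [E*, E], and opposite roots add up to a hyperbolic cotangent. Basis
   vectors killed by the Cartan subspace pair up to elements of the Lie algebra
   of H, which contribute nothing, and each short root is met once for each of
   these vectors, whence its multiplicity. Regularity of x t amounts to
   q^2 <> 1. The factor t is absorbed by the translated function g |-> f(g t),
   again zonal because sigma fixes t, and the two actions of the Casimir element
   are exchanged by g |-> g^-1. *)

Require Import Defs.
From HB Require Import structures.
From mathcomp Require Import all_boot all_order all_algebra.
From mathcomp Require Import complex.
From mathcomp Require Import all_classical all_reals all_analysis.
From mathcomp Require Import ring lra zify.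

Set Implicit Arguments.
Unset Strict Implicit.
Unset Printing Implicit Defensive.

Import Order.TTheory GRing.Theory Num.Theory.
Import numFieldNormedType.Exports.

Local Open Scope classical_set_scope.
Local Open Scope ring_scope.
Local Open Scope complex_scope.
Local Notation eta := Defs.eta.

(** * The matrix exponential *)

(** The root vectors are complex, whereas f lives on real matrices and is constrained only on the
    group. At each point the first and second derivatives of a local extension of f are therefore
    packaged as a complex-linear form [delta] and a complex-bilinear form [beta] on complex
    matrices. Bi-invariance becomes the three identities of [casimir_axioms], and the Casimir sum is
    then pure algebra of bivectors. The two linear equations for a root vector E close up because
    the dual root vector and sigma E are multiples of one bivector, hence commute. Regularity gives
    q^2 <> 1 for the following reason: otherwise E - sigma E would lie in the commutative
    intersection, which contains the Cartan subspace, although the latter acts on E by a nonzero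
    weight. Constants: B(F_st, F_st) = -2 eta_s eta_t, and ordered pairs (s, t) count each generator
    twice, whence the prefactor -1/4 of the Casimir tensor. A long root occurs in both orders
    together with its opposite, which leaves 1/2. The basis vectors killed by the Cartan subspace
    number M = d + 2 - 2N = |d - 2 - 2p|, and M/2 is the short multiplicity. The doubling in R = 2
    Sigma is the square in q^2. *)

Section MatrixLimits.
Context {R : realType} {m n : nat}.

Lemma cvg_mx (T : Type) (F : set_system T) {FF : Filter F}
    (u : T -> 'M[R]_(m, n)) (M : 'M[R]_(m, n)) :
  (forall i j, u x i j @[x --> F] --> M i j) -> u x @[x --> F] --> M.
Proof.
move=> uM; apply/cvgrPdist_le => /= e e0.
near=> x.
rewrite /Num.Def.normr/= mx_normrE (bigmax_le _ (ltW e0))//= => -[i j] _.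
rewrite !mxE/=.
suff : forall ij : 'I_m * 'I_n, `|M ij.1 ij.2 - u x ij.1 ij.2| <= e.
  by move/(_ (i, j)).
near: x; apply: filter_forall => /= ij.
exact: ((cvgrPdist_le _ _).1 (uM _ _)).
Unshelve. all: by end_near. Qed.

Lemma is_derive_mx (V : normedModType R) (M : V -> 'M[R]_(m, n)) t v
    (D : 'M[R]_(m, n)) :
  (forall i j, is_derive t v (fun x => M x i j) (D i j)) -> is_derive t v M D.
Proof.
move=> H; have dM : derivable M t v.
  by apply/derivable_mxP => i j; case: (H i j).
apply: DeriveDef => //; rewrite derive_mx//; apply/matrixP => i j; rewrite mxE.
by case: (H i j).
Qed.

Lemma is_derive_mx_coord (V : normedModType R) (M : V -> 'M[R]_(m, n)) t v
    (D : 'M[R]_(m, n)) i j :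
  is_derive t v M D -> is_derive t v (fun x => M x i j) (D i j).
Proof.
case=> dM <-; rewrite derive_mx// mxE; apply/derivableP.
by move/derivable_mxP : dM.
Qed.

Lemma cvg_mx_coord (T : Type) (F : set_system T) {FF : Filter F}
    (u : T -> 'M[R]_(m, n)) (M : 'M[R]_(m, n)) i j :
  u x @[x --> F] --> M -> u x i j @[x --> F] --> M i j.
Proof.
by move=> uM; apply: (cvg_comp u (fun N : 'M[R]_(m, n) => N i j) uM);
  exact: coord_continuous.
Qed.

End MatrixLimits.

Lemma is_derive_mulmx (R : realType) m n p (V : normedModType R)
    (A : V -> 'M[R]_(m, n)) (B : V -> 'M[R]_(n, p)) t v A' B' :
  is_derive t v A A' -> is_derive t v B B' ->
  is_derive t v (fun x => A x *m B x) (A' *m B t + A t *m B').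
Proof.
move=> dA dB; apply: is_derive_mx => i j.
under eq_fun do rewrite mxE.
have -> : (fun x => \sum_k A x i k * B x k j) =
   \sum_k ((fun x => A x i k) * (fun x => B x k j)).
  by apply/funext => x; rewrite fct_sumE.
rewrite !mxE -big_split/=.
have H k : is_derive t v ((fun x => A x i k) * (fun x => B x k j))
    (A t i k *: B' k j + B t k j *: A' i k).
  have dAk := is_derive_mx_coord i k dA; have dBk := is_derive_mx_coord k j dB.
  exact: is_deriveM.
have H2 := @is_derive_sum _ _ _ _ _ t v _ H; apply: is_derive_eq.
apply: eq_bigr => k _; rewrite [LHS]addrC; congr (_ + _); exact: mulrC.
Qed.

Section MatrixExponential.
Context {R : realType} {n : nat}.
Implicit Types X Y A B : 'M[R]_n.+1.

Definition exp_series X : ('M[R]_n.+1)^nat := series (fun k => (k`!%:R)^-1 *: X ^+ k).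

(** Entrywise, s |-> exp(sX) is a scalar power series in s, so that convergence and termwise
    differentiation come from the real theory. *)
Definition exp_coef X i j : R^nat := fun k => (k`!%:R)^-1 * (X ^+ k) i j.

Lemma exp_seriesE X i j (s : R) N :
  exp_series (s *: X) N i j = \sum_(0 <= k < N) exp_coef X i j k * s ^+ k.
Proof.
rewrite /exp_series /series/= summxE.
apply: eq_bigr => k _.
by rewrite exprZn !mxE /exp_coef mulrCA mulrC.
Qed.

Lemma mx_entry_expr X : exists2 K : R, 0 <= K & forall k i j, `|(X ^+ k) i j| <= K ^+ k.
Proof.
pose K0 : R := \sum_i \sum_j `|X i j|.
have K0ge i j : `|X i j| <= K0.
  rewrite /K0 (bigD1 i)//= (bigD1 j)//= -addrA lerDl addr_ge0//.
    by apply: sumr_ge0.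
  by apply: sumr_ge0 => *; apply: sumr_ge0.
have K00 : 0 <= K0 by apply: sumr_ge0 => *; apply: sumr_ge0.
(* The factor [n.+1] pays for the sum over the inner index of a matrix product. The bound K^k lets
   the series of exp(K|s|) dominate. *)
exists (n.+1%:R * K0); first by rewrite mulr_ge0.
elim=> [|k IH] i j; first by rewrite !expr0 mxE; case: eqP => _; rewrite ?normr1 ?normr0.
rewrite exprS mxE (le_trans (ler_norm_sum _ _ _))//.
have -> : (n.+1%:R * K0) ^+ k.+1 = \sum_(l < n.+1) K0 * (n.+1%:R * K0) ^+ k.
  by rewrite sumr_const card_ord exprS -mulrA mulr_natl.
by apply: ler_sum => l _; rewrite normrM ler_pM.
Qed.

Lemma is_cvg_exp_coef X i j s : cvgn (pseries (exp_coef X i j) s).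
Proof.
have [K K0 HK] := mx_entry_expr X.
apply: normed_cvg.
apply: (@series_le_cvg _ _ (exp_coeff (K * `|s|))) => [k|k|k|].
- exact: normr_ge0.
- by rewrite exp_coeff_ge0// mulr_ge0.
- rewrite /exp_coef /exp_coeff/= !normrM normfV normr_nat normrX exprMn.
  have -> : K ^+ k * `|s| ^+ k / k`!%:R = `|s| ^+ k / k`!%:R * K ^+ k by ring.
  by rewrite mulrC mulrA; apply: ler_wpM2l; rewrite ?divr_ge0 ?exprn_ge0.
- exact: is_cvg_series_exp_coeff.
Qed.

Lemma exp_series_cvg X : exp_series X @ \oo --> expmx X.
Proof.
have : exp_series X @ \oo --> (\matrix_(i, j) limn (pseries (exp_coef X i j) 1)).
  apply: cvg_mx => i j; rewrite mxE.
  rewrite (_ : (fun N => _) = pseries (exp_coef X i j) 1); last first.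
    by apply/funext => N; rewrite /pseries/series/= -exp_seriesE scale1r.
  exact: is_cvg_exp_coef.
by move=> H; rewrite /expmx -/(exp_series X) (cvg_lim _ H)//.
Qed.

Lemma expmxE X i j s : expmx (s *: X) i j = limn (pseries (exp_coef X i j) s).
Proof.
rewrite (_ : pseries _ _ = (fun N => exp_series (s *: X) N i j)); last first.
  by apply/funext => N; rewrite exp_seriesE.
apply/esym/cvg_lim => //; apply: cvg_mx_coord; exact: exp_series_cvg.
Qed.

Lemma exp_coef_diffs X i j : pseries_diffs (exp_coef X i j) =
  (fun k => (k`!%:R)^-1 * (X ^+ k.+1) i j).
Proof.
apply/funext => k; rewrite /pseries_diffs /exp_coef factS natrM invfM mulrA mulrA.
by rewrite divff ?mul1r// pnatr_eq0.
Qed.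

(** The left factor [Y] covers the derived series of the exponential ([Y] equal to X and X^2) as
    well as products with a fixed matrix. *)
Lemma is_cvg_exp_coef_diffs X Y i j s :
  cvgn (pseries (fun k => (k`!%:R)^-1 * (Y *m X ^+ k) i j) s) /\
  limn (pseries (fun k => (k`!%:R)^-1 * (Y *m X ^+ k) i j) s) = (Y *m expmx (s *: X)) i j.
Proof.
have H : pseries (fun k => (k`!%:R)^-1 * (Y *m X ^+ k) i j) s @ \oo --> (Y *m expmx (s *: X)) i j.
  have -> : pseries (fun k => (k`!%:R)^-1 * (Y *m X ^+ k) i j) s =
      (fun N => \sum_l Y i l * exp_series (s *: X) N l j).
    apply/funext => N; rewrite /pseries/series/=.
    under [RHS]eq_bigr => l _.
      rewrite exp_seriesE mulr_sumr; over.
    rewrite exchange_big/=; apply: eq_bigr => k _.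
    rewrite mxE mulr_sumr mulr_suml; apply: eq_bigr => l _.
    by rewrite /exp_coef; ring.
  rewrite mxE; apply: cvg_big => [|l _]; [exact: add_continuous|apply: cvgMl_tmp].
  apply: cvg_mx_coord; exact: exp_series_cvg.
by split; [apply/cvg_ex; eexists; exact: H|exact: cvg_lim].
Qed.

Lemma is_derive_expmx X (s : R) :
  is_derive s (1 : R) (fun s : R => expmx (s *: X)) (X *m expmx (s *: X)).
Proof.
apply: is_derive_mx => i j.
under eq_fun do rewrite expmxE.
have [_ <-] := is_cvg_exp_coef_diffs X X i j s.
under [X in limn (pseries X _)]eq_fun do rewrite -[_ *m _]exprS.
rewrite -exp_coef_diffs.
(* Any radius beyond |s| will do. *)
apply: (@pseries_snd_diffs _ _ (`|s| + 1)).
- exact: is_cvg_exp_coef.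
- rewrite exp_coef_diffs.
  under [X in pseries X _]eq_fun do rewrite exprS.
  by have [] := is_cvg_exp_coef_diffs X X i j (`|s| + 1).
- have -> : pseries_diffs (pseries_diffs (exp_coef X i j)) =
      (fun k => (k`!%:R)^-1 * ((X ^+ 2) *m X ^+ k) i j).
    apply/funext => k; rewrite exp_coef_diffs /pseries_diffs factS natrM invfM mulrA mulrA.
    rewrite divff ?mul1r ?pnatr_eq0//; congr (_ * _).
    by rewrite [_ *m _](_ : _ = X ^+ 2 * X ^+ k)// -exprD.
  by have [] := is_cvg_exp_coef_diffs X (X ^+ 2) i j (`|s| + 1).
- by rewrite [ltRHS]ger0_norm ?ltrDl// addr_ge0.
Qed.

Lemma expmx0 : expmx (0 : 'M[R]_n.+1) = 1%:M.
Proof.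
apply: cvg_lim => //; apply: (@cvg_trans _ ((fun=> 1%:M : 'M[R]_n.+1) @ \oo)).
  apply: near_eq_cvg; near=> N.
  have -> : N = N.-1.+1 by rewrite prednK//; near: N; exists 1%N.
  rewrite /series/= big_nat_recl//= big1 ?addr0 ?expr0 ?fact0 ?invr1 ?scale1r//.
  by move=> k _; rewrite expr0n/= scaler0.
exact: cvg_cst.
Unshelve. all: by end_near. Qed.

(** Intertwining passes from the powers to the exponential by continuity of multiplication.
    Conjugation, commutation and the isometry property are instances. *)
Lemma mulmx_limit_comm A B X Y : (forall k, A *m X ^+ k = Y ^+ k *m B) ->
  A *m expmx X = expmx Y *m B.
Proof.
move=> H.
apply/matrixP => i j; rewrite -[X]scale1r -[Y]scale1r.
have [_ <-] := is_cvg_exp_coef_diffs X A i j 1.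
rewrite scale1r; apply: cvg_lim => //.
have -> : pseries (fun k => (k`!%:R)^-1 * (A *m X ^+ k) i j) 1 =
      (fun N => \sum_l exp_series (1 *: Y) N i l * B l j).
  apply/funext => N; rewrite /pseries/series/=.
  under [RHS]eq_bigr => l _.
    rewrite exp_seriesE mulr_suml; over.
  rewrite exchange_big/=; apply: eq_bigr => k _.
  rewrite H mxE mulr_sumr mulr_suml; apply: eq_bigr => l _.
  by rewrite /exp_coef; ring.
rewrite mxE; apply: cvg_big => [|l _]; [exact: add_continuous|apply: cvgMr_tmp].
rewrite scale1r; apply: cvg_mx_coord; exact: exp_series_cvg.
Qed.

Lemma expmx_conj A B X : A *m B = 1%:M -> A *m expmx X *m B = expmx (A *m X *m B).
Proof.
move=> AB; have BA := mulmx1C AB.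
have H : forall k, A *m X ^+ k = (A *m X *m B) ^+ k *m A.
  elim=> [|k IH]; first by rewrite !expr0 mulmx1 mul1mx.
  by rewrite !exprSr -!mulmxE mulmxA IH -!mulmxA BA mulmx1.
by rewrite (mulmx_limit_comm H) -mulmxA AB mulmx1.
Qed.

Lemma expmx_comm A X : A *m X = X *m A -> A *m expmx X = expmx X *m A.
Proof.
move=> H; apply: mulmx_limit_comm; elim=> [|k IH]; first by rewrite !expr0 mulmx1 mul1mx.
rewrite exprSr -[X ^+ k * X]/(X ^+ k *m X) mulmxA IH -!mulmxA H.
by rewrite !mulmxA.
Qed.

Lemma expmx_tr X : (expmx X)^T = expmx X^T.
Proof.
apply/matrixP => i j; rewrite mxE -[X in LHS]scale1r -[X^T]scale1r !expmxE.
congr (limn (pseries _ _)); apply/funext => k; rewrite /exp_coef; congr (_ * _).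
have -> : X^T ^+ k = (X ^+ k)^T by elim: k => [|k IH]; rewrite ?expr0 ?trmx1// exprS exprSr IH trmx_mul.
by rewrite mxE.
Qed.

Lemma is_derive0_mx_cst m p (M : R -> 'M[R]_(m, p)) :
  (forall s, is_derive s (1 : R) M 0) -> forall s, M s = M 0.
Proof.
move=> H s; apply/matrixP => i j.
apply: (@is_derive_0_is_cst _ (fun s => M s i j)) => u.
by have := is_derive_mx_coord i j (H u); rewrite mxE.
Qed.

Lemma is_derive_expmxN X (s : R) :
  is_derive s (1 : R) (fun s : R => expmx (s *: - X)) (- (X *m expmx (s *: - X))).
Proof. by rewrite -mulNmx; exact: is_derive_expmx. Qed.

Lemma comm_expmx X (s : R) : X *m expmx (s *: X) = expmx (s *: X) *m X.
Proof. by apply: expmx_comm; rewrite -scalemxAr -scalemxAl. Qed.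

Lemma expmxN X : expmx X *m expmx (- X) = 1%:M.
Proof.
pose M s := expmx (s *: X) *m expmx (s *: - X).
have H s : is_derive s (1 : R) M 0.
  apply: is_derive_eq.
    by apply: is_derive_mulmx; [exact: is_derive_expmx|exact: is_derive_expmxN].
  by rewrite mulmxN mulmxA -comm_expmx subrr.
have := is_derive0_mx_cst H 1; rewrite /M !scale1r !scale0r expmx0 => ->.
by rewrite mul1mx.
Qed.

Lemma expNmx X : expmx (- X) *m expmx X = 1%:M.
Proof. by rewrite -{2}(opprK X) expmxN. Qed.

Lemma invmx_expmx X : invmx (expmx X) = expmx (- X).
Proof.
have U : expmx X \in unitmx by case: (mulmx1_unit (expmxN X)).
by rewrite -[LHS]mulmx1 -(expmxN X) mulmxA mulVmx// mul1mx.
Qed.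

(** Exhibits every exponential as a square, which is what makes determinants 1 rather than -1
    further on. *)
Lemma expmx_double X : expmx (2 *: X) = expmx X *m expmx X.
Proof.
pose M s := expmx (s *: X + X) *m expmx (s *: - X).
have H s : is_derive s (1 : R) M 0.
  have D : is_derive s (1 : R) (fun s : R => expmx (s *: X + X)) (X *m expmx (s *: X + X)).
    have -> : (fun s : R => expmx (s *: X + X)) = (fun s : R => expmx (s *: X)) \o (fun s => s + 1).
      by apply/funext => u /=; rewrite scalerDl scale1r.
    apply: is_derive_mx => i j.
    have := is_derive_mx_coord i j (is_derive_expmx X (s + 1)) => D.
    have D2 : is_derive s (1 : R) (fun s : R => s + 1) 1.
      by apply: is_derive_eq; rewrite addr0.
    have := @is_derive1_comp _ (fun s => expmx (s *: X) i j) (fun s => s + 1) s _ _ D D2.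
    by rewrite mulr1 scalerDl scale1r.
  apply: is_derive_eq.
    exact: (is_derive_mulmx D (is_derive_expmxN X s)).
  rewrite mulmxN mulmxA; apply/eqP; rewrite subr_eq0; apply/eqP; congr (_ *m _).
  by apply: expmx_comm; rewrite mulmxDl mulmxDr -scalemxAl -scalemxAr.
have := is_derive0_mx_cst H 1; rewrite /M !scale1r !scale0r expmx0 add0r mulmx1.
move=> /(congr1 (mulmx^~ (expmx X))); rewrite -mulmxA expNmx mulmx1 => <-.
by rewrite scalerDl scale1r.
Qed.

(** Uniqueness for y' = X y, since exp(-sX) y(s) is constant. An explicit solution thus evaluates an
    exponential on a vector without summing a series. *)
Lemma expmx_ode p (y : R -> 'M[R]_(n.+1, p)) X :
  (forall s, is_derive s (1 : R) y (X *m y s)) -> expmx X *m y 0 = y 1.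
Proof.
move=> dy; pose M s := expmx (s *: - X) *m y s.
have H s : is_derive s (1 : R) M 0.
  apply: is_derive_eq; first exact: (is_derive_mulmx (is_derive_expmxN X s) (dy s)).
  have /(congr1 -%R) := comm_expmx (- X) s; rewrite mulNmx mulmxN !opprK => ->.
  by rewrite mulNmx -mulmxA addNr.
have := is_derive0_mx_cst H 1; rewrite /M scale1r scale0r expmx0 mul1mx => <-.
by rewrite mulmxA expmxN mul1mx.
Qed.

Lemma is_derive_scalemx m p (M : 'M[R]_(m, p)) (a : R -> R) (s a' : R) :
  is_derive s (1 : R) a a' -> is_derive s (1 : R) (fun s => a s *: M) (a' *: M).
Proof.
move=> da; apply: is_derive_mx => i j.
under eq_fun do rewrite mxE mulrC.
rewrite mxE mulrC; exact: is_deriveZ.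
Qed.

Lemma is_derive_scale_arg (f : R -> R) (k s f' : R) :
  is_derive (s * k) (1 : R) f f' -> is_derive s (1 : R) (fun s => f (s * k)) (f' * k).
Proof.
move=> df.
have dk : is_derive s (1 : R) (fun s : R => s * k) k.
  have -> : (fun s : R => s * k) = k *: (id : R -> R).
    by apply/funext => u /=; rewrite mulrC.
  by apply: is_derive_eq; rewrite /GRing.scale/= mulr1.
exact: (@is_derive1_comp _ f (fun s : R => s * k) s _ _ df dk).
Qed.

Lemma expmx_eigenvector p X (u : 'M[R]_(n.+1, p)) (l : R) :
  X *m u = l *: u -> expmx X *m u = expR l *: u.
Proof.
move=> Xu; pose y s := expR (s * l) *: u.
have := @expmx_ode _ y X; rewrite /y mul0r mul1r expR0 scale1r; apply => s.
apply: is_derive_eq.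
  by apply: is_derive_scalemx; apply: is_derive_scale_arg; exact: is_derive_expR.
by rewrite !scaler0 !add0r ![_%:A]mulr1 -scalemxAr Xu scalerA.
Qed.

Lemma expmx_rotation p X (u w : 'M[R]_(n.+1, p)) (l : R) :
  X *m u = l *: w -> X *m w = - l *: u ->
  expmx X *m u = cos l *: u + sin l *: w.
Proof.
move=> Xu Xw; pose y s := cos (s * l) *: u + sin (s * l) *: w.
have := @expmx_ode _ y X.
rewrite /y !mul0r !mul1r cos0 sin0 scale1r scale0r addr0; apply => s.
apply: is_derive_eq.
  apply: is_deriveD.
    by apply: is_derive_scalemx; apply: is_derive_scale_arg; exact: is_derive_cos.
  by apply: is_derive_scalemx; apply: is_derive_scale_arg; exact: is_derive_sin.
by rewrite !scaler0 !add0r ![_%:A]mulr1 mulmxDr -!scalemxAr Xu Xw !scalerA mulrN mulNr addrC.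
Qed.

End MatrixExponential.

(** * The groups SO(d+1,1)_0 and H *)

Lemma linear_mx_continuous (R : realType) m n (V : normedModType R)
    (f : {linear 'M[R]_(m, n) -> V}) : continuous f.
Proof.
move=> M.
have fE (N : 'M[R]_(m, n)) : f N = \sum_i \sum_j N i j *: f (delta_mx i j).
  rewrite {1}(matrix_sum_delta N) linear_sum; apply: eq_bigr => i _.
  by rewrite linear_sum; apply: eq_bigr => j _; rewrite linearZ.
have key (F : set_system 'M[R]_(m, n)) : Filter F -> N @[N --> F] --> M ->
    f N @[N --> F] --> f M.
  move=> FF NM; rewrite fE; under eq_cvg do rewrite fE.
  apply: cvg_big => [|i _]; first exact: add_continuous.
  apply: cvg_big => [|j _]; first exact: add_continuous.
  by apply: cvgZr_tmp; exact: cvg_mx_coord.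
exact: (key (nbhs M) (nbhs_filter M) (@cvg_id _ (nbhs M))).
Qed.

Section SpecialOrthogonal.
Context {R : realType}.

Definition SOc {n} (J : 'M[R]_n) := connected_component (SO_of J) 1%:M.

Lemma SO_of_mul n (J : 'M[R]_n) a b : SO_of J a -> SO_of J b -> SO_of J (a *m b).
Proof.
move=> [aJ a1] [bJ b1]; split; last by rewrite det_mulmx a1 b1 mul1r.
by rewrite trmx_mul -!mulmxA (mulmxA a^T) (mulmxA _ a) aJ mulmxA bJ.
Qed.

Lemma SO_of1 n (J : 'M[R]_n) : SO_of J 1%:M.
Proof. by split; rewrite ?det1// trmx1 mul1mx mulmx1. Qed.

Lemma SOc_sub n (J : 'M[R]_n) g : SOc J g -> SO_of J g.
Proof. exact: connected_component_sub. Qed.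

Lemma SOc_path n (J : 'M[R]_n) (y : R -> 'M[R]_n) :
  continuous y -> (forall s, SO_of J (y s)) -> SOc J (y 0) -> SOc J (y 1).
Proof.
move=> cy yJ y0.
have : connected_component (SO_of J) (y 0) (y 1).
  exists (y @` [set` `[0, 1]]); last by exists 1 => //=; rewrite in_itv/= ler01 lexx.
  split; first by exists 0 => //=; rewrite in_itv/= ler01 lexx.
    by move=> _ [s _ <-].
  apply: connected_continuous_connected; first exact: segment_connected.
  exact: continuous_subspaceT.
by apply: connected_component_trans.
Qed.

(** The image of the identity component is connected and meets the identity component of the target.
    Closure under products, conjugation and inversion all come from this. *)
Lemma SOc_image n m (J : 'M[R]_n) (J' : 'M[R]_m) (phi : 'M[R]_n -> 'M[R]_m) :
  continuous phi -> (forall g, SO_of J g -> SO_of J' (phi g)) ->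
  SOc J' (phi 1%:M) -> forall g, SOc J g -> SOc J' (phi g).
Proof.
move=> cphi phiJ phi1 g gJ.
have : connected_component (SO_of J') (phi 1%:M) (phi g).
  exists (phi @` SOc J); last by exists g.
  split; first by exists 1%:M => //; apply: connected_component_refl; exact: SO_of1.
    by move=> _ [s sJ <-]; apply: phiJ; exact: SOc_sub.
  apply: connected_continuous_connected; first exact: component_connected.
  exact: continuous_subspaceT.
by apply: connected_component_trans.
Qed.

Lemma SOc1 n (J : 'M[R]_n) : SOc J 1%:M.
Proof. by apply: connected_component_refl; exact: SO_of1. Qed.

Lemma mulmx_continuous n (a : 'M[R]_n) : continuous (@mulmx R n n n a).
Proof. exact: (@linear_mx_continuous _ _ _ _ (@mulmx R n n n a)). Qed.

Lemma SOc_mul n (J : 'M[R]_n) a b : SOc J a -> SOc J b -> SOc J (a *m b).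
Proof.
move=> aJ bJ; apply: (@SOc_image _ _ J J (mulmx a)) => //.
- exact: mulmx_continuous.
- by move=> g; apply: SO_of_mul; exact: SOc_sub.
- by rewrite mulmx1.
Qed.

Lemma trmx_continuous n : continuous (@trmx R n n).
Proof. exact: (@linear_mx_continuous _ _ _ _ (@trmx R n n)). Qed.

Lemma conj_continuous n (a b : 'M[R]_n) : continuous (fun g => a *m g *m b).
Proof.
exact: (@linear_mx_continuous _ _ _ _ (mulmxr b \o mulmx a : {linear _ -> _})).
Qed.

Lemma expmx_continuous n (X : 'M[R]_n.+1) : continuous (fun s : R => expmx (s *: X)).
Proof.
move=> s; apply/differentiable_continuous/derivable1_diffP.
by case: (is_derive_expmx X s).
Qed.

Lemma expmx_isometry n (J X : 'M[R]_n.+1) : X^T *m J + J *m X = 0 ->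
  (expmx X)^T *m J *m expmx X = J.
Proof.
move=> XJ; rewrite expmx_tr -(@mulmx_limit_comm _ _ J J (- X)) => [|k].
  by rewrite -mulmxA expNmx mulmx1.
have H : J *m - X = X^T *m J by rewrite mulmxN; apply/eqP; rewrite eq_sym -addr_eq0 XJ.
elim: k => [|k IH]; first by rewrite !expr0 mul1mx mulmx1.
by rewrite !exprSr -!mulmxE mulmxA IH -mulmxA H mulmxA.
Qed.

(** An isometry has a determinant of square 1, and exp(X) is the square of the isometry exp(X/2). *)
Lemma expmx_SO n (J X : 'M[R]_n.+1) : J \in unitmx -> X^T *m J + J *m X = 0 ->
  SO_of J (expmx X).
Proof.
move=> Ju XJ; split; first exact: expmx_isometry.
have XE : X = 2 *: (2^-1 *: X) by rewrite scalerA divff ?scale1r// pnatr_eq0.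
rewrite XE expmx_double det_mulmx.
have : (2^-1 *: X)^T *m J + J *m (2^-1 *: X) = 0.
  by rewrite linearZ/= -scalemxAl -scalemxAr -scalerDr XJ scaler0.
move=> /expmx_isometry/(congr1 determinant); rewrite !det_mulmx det_tr => H.
have J0 : \det J != 0 by rewrite -unitfE -unitmxE.
by apply: (mulIf J0); rewrite mul1r -{2}H; ring.
Qed.

Lemma expmx_SOc n (J X : 'M[R]_n.+1) : J \in unitmx -> X^T *m J + J *m X = 0 ->
  SOc J (expmx X).
Proof.
move=> Ju XJ; rewrite -[X]scale1r.
apply: (SOc_path (y := fun s => expmx (s *: X))) => [|s|].
- exact: expmx_continuous.
-
  by apply: expmx_SO => //; rewrite linearZ/= -scalemxAl -scalemxAr -scalerDr XJ scaler0.
- by rewrite scale0r expmx0; exact: SOc1.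
Qed.

End SpecialOrthogonal.

(** * Block-diagonal subgroups *)

Section BlockSubgroup.
Context {R : realType}.

(** The equation [e] is kept as a variable, so that destructing it reduces every identity to plain
    block matrices. *)
Definition bd (q r n : nat) (e : (q + r)%N = n) (A : 'M[R]_q) (B : 'M[R]_r) : 'M[R]_n :=
  castmx (e, e) (block_mx A 0 0 B).

Lemma bd_mul q r n (e : (q + r)%N = n) A B A' B' :
  bd e A B *m bd e A' B' = bd e (A *m A') (B *m B').
Proof.
by case: n / e; rewrite /bd !castmx_id mulmx_block !(mulmx0, mul0mx, addr0, add0r).
Qed.

Lemma bd_tr q r n (e : (q + r)%N = n) A B : (bd e A B)^T = bd e A^T B^T.
Proof. by case: n / e; rewrite /bd !castmx_id tr_block_mx !trmx0. Qed.

Lemma bd_inj q r n (e : (q + r)%N = n) A B A' B' :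
  bd e A B = bd e A' B' -> A = A' /\ B = B'.
Proof. by case: n / e; rewrite /bd !castmx_id => /eq_block_mx[]. Qed.

(** Commuting with diag(1, -1) makes each off-diagonal block equal to its own negative. *)
Lemma bd_sign_comm q r n (e : (q + r)%N = n) g :
  g *m bd e 1%:M (- 1%:M) = bd e 1%:M (- 1%:M) *m g -> exists A B, g = bd e A B.
Proof.
case: n / e g => g; rewrite /bd !castmx_id -{1 2}(submxK g) !mulmx_block.
rewrite !(mulmx0, mul0mx, addr0, add0r, mulmx1, mul1mx, mulmxN, mulNmx).
move=> /eq_block_mx[_ H1 H2 _]; exists (ulsubmx g), (drsubmx g).
rewrite castmx_id -{1}(submxK g).
have aux (m k : nat) (M : 'M[R]_(m, k)) : M = - M -> M = 0.
  move=> /eqP; rewrite -addr_eq0 -mulr2n -scaler_nat scaler_eq0 pnatr_eq0/=.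
  by move/eqP.
by rewrite (aux _ _ _ (esym H1)) (aux _ _ _ H2).
Qed.

Definition drpart (q r n : nat) (e : (q + r)%N = n) (g : 'M[R]_n) : 'M[R]_r :=
  drsubmx (castmx (esym e, esym e) g).

Lemma drpart_bd q r n (e : (q + r)%N = n) A B : drpart e (bd e A B) = B.
Proof. by case: n / e; rewrite /drpart /bd !castmx_id block_mxKdr. Qed.

Lemma bd1 q r n (e : (q + r)%N = n) : bd e 1%:M 1%:M = 1%:M.
Proof. by case: n / e; rewrite /bd castmx_id -scalar_mx_block. Qed.

Lemma drpart_continuous q r n (e : (q + r)%N = n) : continuous (drpart e).
Proof.
case: n / e; have lin : linear (drpart (erefl (q + r)%N)).
  by move=> a u v; rewrite /drpart !castmx_id; apply/matrixP => i j; rewrite !mxE.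
pose f := GRing.isLinear.Build R _ _ _ _ lin.
pose g : {linear 'M[R]_(q + r) -> 'M[R]_r} := HB.pack (drpart (erefl (q + r)%N)) f.
exact: (linear_mx_continuous (f := g)).
Qed.

Definition block_group (q r n : nat) (e : (q + r)%N = n) (J : 'M[R]_r) : set 'M[R]_n :=
  [set g | exists A B, [/\ SO_of 1%:M A, SOc J B & g = bd e A B]].

(** exp(sX) commutes with the sign matrix and is therefore block diagonal for all s; its lower block
    traces a path from 1, which puts it in the identity component. *)
Lemma block_group_exp q r n (e : (q + r)%N = n.+1) (J : 'M[R]_r) (X : 'M[R]_n.+1) :
  J \in unitmx ->
  X^T *m bd e 1%:M J + bd e 1%:M J *m X = 0 ->
  X *m bd e 1%:M (- 1%:M) = bd e 1%:M (- 1%:M) *m X ->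
  block_group e J (expmx X).
Proof.
move=> Ju XJ XS.
have sXJ s : (s *: X)^T *m bd e 1%:M J + bd e 1%:M J *m (s *: X) = 0.
  by rewrite linearZ/= -scalemxAl -scalemxAr -scalerDr XJ scaler0.
have ex s : exists A B, expmx (s *: X) = bd e A B.
  apply: bd_sign_comm; apply/esym/expmx_comm.
  by rewrite -scalemxAr -scalemxAl XS.
have iso s A B : expmx (s *: X) = bd e A B -> A^T *m 1%:M *m A = 1%:M /\ B^T *m J *m B = J.
  move=> sE; have := expmx_isometry (sXJ s); rewrite sE bd_tr !bd_mul.
  by move=> /bd_inj.
(* The blocks at s are the squares of the blocks at s/2, so their determinants are 1. *)
have SOs s A B : expmx (s *: X) = bd e A B -> SO_of 1%:M A /\ SO_of J B.
  move=> sE; have [A1 B1] := iso _ _ _ sE.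
  have [A' [B' sE']] := ex (s / 2); have [A1' B1'] := iso _ _ _ sE'.
  have := sE; rewrite (_ : s *: X = 2 *: ((s / 2) *: X)); last first.
    by rewrite scalerA mulrC divfK// pnatr_eq0.
  rewrite expmx_double sE' bd_mul => /bd_inj[AA BB].
  have aux m (M K : 'M[R]_m) : K \in unitmx -> M^T *m K *m M = K -> \det (M *m M) = 1.
    move=> Ku /(congr1 determinant); rewrite !det_mulmx det_tr => H.
    have K0 : \det K != 0 by rewrite -unitfE -unitmxE.
    by apply: (mulIf K0); rewrite mul1r -{2}H; ring.
  split; split => //; first by rewrite -AA; exact: (aux _ _ _ (unitmx1 _ _) A1').
  by rewrite -BB; exact: (aux _ _ _ Ju B1').
have [A [B XE]] := ex 1; exists A, B; split.
- by have [] := SOs _ _ _ XE.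
- have : SOc J (drpart e (expmx (1 *: X))).
    apply: (SOc_path (y := fun s => drpart e (expmx (s *: X)))) => [s|s|].
    + apply: continuous_comp; first exact: expmx_continuous.
      exact: drpart_continuous.
    + have [A' [B' sE]] := ex s; rewrite sE drpart_bd.
      by have [] := SOs _ _ _ sE.
    + by rewrite scale0r expmx0 -(bd1 e) drpart_bd; exact: SOc1.
  by rewrite XE drpart_bd.
- by rewrite -XE scale1r.
Qed.

(** The blocks of [t] may have determinant -1, as happens for the twists by pi, so [t] itself can
    lie outside the group. Conjugation by its blocks still preserves SO and the identity
    component. *)
Lemma block_group_conj q r n (e : (q + r)%N = n) (J : 'M[R]_r) t h :
  J \in unitmx -> J *m J = 1%:M ->
  t^T *m bd e 1%:M J *m t = bd e 1%:M J ->
  t *m bd e 1%:M (- 1%:M) = bd e 1%:M (- 1%:M) *m t ->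
  block_group e J h -> block_group e J (t *m h *m invmx t).
Proof.
move=> Ju JJ tJ /bd_sign_comm[T1 [T2 tE]] [A [B [HA HB hE]]].
move: tJ; rewrite tE bd_tr !bd_mul => /bd_inj[T1J T2J].
have T1u : T1^T *m T1 = 1%:M by rewrite mulmx1 in T1J.
have T1u' := mulmx1C T1u.
have T2u : J *m T2^T *m J *m T2 = 1%:M by rewrite -!mulmxA (mulmxA T2^T) T2J.
have T2u' := mulmx1C T2u.
have tI : invmx (bd e T1 T2) = bd e T1^T (J *m T2^T *m J).
  have H : bd e T1 T2 *m bd e T1^T (J *m T2^T *m J) = 1%:M.
    by rewrite bd_mul T1u' T2u' bd1.
  have [U _] := mulmx1_unit H.
  by rewrite -[LHS]mulmx1 -H mulmxA mulVmx// mul1mx.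
exists (T1 *m A *m T1^T), (T2 *m B *m (J *m T2^T *m J)); split.
- case: HA => HA A1; split.
    move: HA; rewrite !mulmx1 !trmx_mul trmxK => HA.
    by rewrite -!mulmxA (mulmxA T1^T T1) T1u mul1mx (mulmxA A^T) HA mul1mx.
  by rewrite !det_mulmx mulrAC -det_mulmx T1u' det1 mul1r.
- apply: (SOc_image (phi := fun B => T2 *m B *m (J *m T2^T *m J)) _ _ _ HB).
  + exact: conj_continuous.
  + move=> g [gJ g1]; split; last first.
      by rewrite det_mulmx det_mulmx mulrAC -det_mulmx T2u' det1 mul1r.
    set K := J *m T2^T *m J in T2u T2u' *.
    have KJ : K^T *m J *m K = J.
      have : (T2 *m K)^T *m J *m (T2 *m K) = J by rewrite T2u' trmx1 mul1mx mulmx1.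
      by rewrite trmx_mul -!mulmxA (mulmxA T2^T) (mulmxA _ T2) T2J.
    clearbody K; rewrite !trmx_mul -!mulmxA (mulmxA T2^T) (mulmxA _ T2) T2J.
    by rewrite (mulmxA g^T) (mulmxA _ g) gJ mulmxA.
  + by rewrite mulmx1 T2u'; exact: SOc1.
- by rewrite hE tI !bd_mul.
Qed.

(** J h^T J is the inverse of the isometry h, in a form linear in h. *)
Lemma block_group_adj q r n (e : (q + r)%N = n) (J : 'M[R]_r) h :
  J^T = J -> J *m J = 1%:M ->
  block_group e J h -> block_group e J (bd e 1%:M J *m h^T *m bd e 1%:M J).
Proof.
move=> Jt JJ [A [B [HA HB hE]]].
exists A^T, (J *m B^T *m J); split.
- case: HA => + A1; rewrite mulmx1 => HA; split; last by rewrite det_tr.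
  by rewrite trmxK mulmx1; apply: mulmx1C.
- apply: (SOc_image (phi := fun B => J *m B^T *m J) _ _ _ HB).
  + move=> g; apply: (@continuous_comp _ _ _ (@trmx R r r) (fun g => J *m g *m J)).
      exact: trmx_continuous.
    exact: conj_continuous.
  + move=> g [gJ g1]; split.
      rewrite !trmx_mul trmxK Jt.
      have gg : g *m (J *m g^T *m J) = 1%:M.
        by apply: mulmx1C; rewrite -!mulmxA (mulmxA g^T) gJ.
      have -> : J *m (g *m J) *m J *m (J *m g^T *m J) = J *m (g *m (J *m J *m J *m g^T *m J)).
        by rewrite !mulmxA.
      by rewrite JJ mul1mx gg mulmx1.
    rewrite !det_mulmx det_tr g1 mulr1 -det_mulmx JJ det1//.
  + by rewrite trmx1 mulmx1 JJ; exact: SOc1.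
- by rewrite hE bd_tr !bd_mul mulmx1 mul1mx.
Qed.

End BlockSubgroup.

(** * Second-order jets of complex-valued functions *)

Section ComplexParts.
Context {R : realType}.
Implicit Types x y : R[i].

Lemma cReD x y : complex.Re (x + y) = complex.Re x + complex.Re y.
Proof. by case: x y => [? ?] [? ?]. Qed.

Lemma cImD x y : complex.Im (x + y) = complex.Im x + complex.Im y.
Proof. by case: x y => [? ?] [? ?]. Qed.

Lemma cReN x : complex.Re (- x) = - complex.Re x.
Proof. by case: x => [? ?]. Qed.

Lemma cImN x : complex.Im (- x) = - complex.Im x.
Proof. by case: x => [? ?]. Qed.

Lemma cReM x y : complex.Re (x * y) =
  complex.Re x * complex.Re y - complex.Im x * complex.Im y.
Proof. by case: x y => [? ?] [? ?]. Qed.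

Lemma cImM x y : complex.Im (x * y) =
  complex.Re x * complex.Im y + complex.Im x * complex.Re y.
Proof. by case: x y => [? ?] [? ?]. Qed.

Lemma Re_sum I (r : seq I) P (F : I -> R[i]) :
  complex.Re (\sum_(i <- r | P i) F i) = \sum_(i <- r | P i) complex.Re (F i).
Proof. exact: (big_morph _ cReD). Qed.

Lemma Im_sum I (r : seq I) P (F : I -> R[i]) :
  complex.Im (\sum_(i <- r | P i) F i) = \sum_(i <- r | P i) complex.Im (F i).
Proof. exact: (big_morph _ cImD). Qed.

Lemma complex_ext x y :
  complex.Re x = complex.Re y -> complex.Im x = complex.Im y -> x = y.
Proof. by case: x y => [? ?] [? ?] /= -> ->. Qed.

End ComplexParts.

Section ComplexDerivative.
Context {R : realType}.

Definition is_cderive (h : R -> R[i]) (l : R[i]) : Prop :=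
  is_derive (0 : R) (1 : R) (fun s => complex.Re (h s)) (complex.Re l) /\
  is_derive (0 : R) (1 : R) (fun s => complex.Im (h s)) (complex.Im l).

Lemma is_cderiveE h l : is_cderive h l -> cderiv0 h = l.
Proof.
by case: l => a b [h1 h2]; rewrite /cderiv0 !derive1E; case: h1 => _ ->; case: h2 => _ ->.
Qed.

Lemma near_is_cderive h k l :
  (\forall s \near (0 : R), h s = k s) -> is_cderive h l -> is_cderive k l.
Proof.
move=> hk [h1 h2]; split.
  by apply: near_eq_is_derive h1; near=> s; congr complex.Re; near: s.
by apply: near_eq_is_derive h2; near=> s; congr complex.Im; near: s.
Unshelve. all: by end_near. Qed.

Lemma is_cderiveD h k l m :
  is_cderive h l -> is_cderive k m -> is_cderive (fun s => h s + k s) (l + m).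
Proof.
move=> [h1 h2] [k1 k2]; split.
  by rewrite cReD; under eq_fun do rewrite cReD; exact: is_deriveD.
by rewrite cImD; under eq_fun do rewrite cImD; exact: is_deriveD.
Qed.

Lemma is_cderiveZ h l c : is_cderive h l -> is_cderive (fun s => c * h s) (c * l).
Proof.
move=> [h1 h2]; split.
  rewrite cReM; under eq_fun do rewrite cReM.
  by apply: is_deriveB; exact: is_deriveZ.
rewrite cImM; under eq_fun do rewrite cImM.
by apply: is_deriveD; exact: is_deriveZ.
Qed.

Lemma is_cderive_cst c : is_cderive (fun=> c) 0.
Proof. by split; exact: is_derive_cst. Qed.

Lemma is_cderive_sum I (r : seq I) (h : I -> R -> R[i]) (l : I -> R[i]) :
  (forall i, is_cderive (h i) (l i)) ->
  is_cderive (fun s => \sum_(i <- r) h i s) (\sum_(i <- r) l i).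
Proof.
move=> hl; elim: r => [|i r IH].
  by rewrite big_nil; under eq_fun do rewrite big_nil; exact: is_cderive_cst.
by rewrite big_cons; under eq_fun do rewrite big_cons; exact: is_cderiveD.
Qed.

Lemma cderiv0_cst c : cderiv0 (fun=> c : R[i]) = 0.
Proof. by apply: is_cderiveE; exact: is_cderive_cst. Qed.

End ComplexDerivative.

(** * Complexification of real-linear derivatives *)

Section ComplexExtension.
Context {R : realType} {m n : nat}.
Local Notation M := 'M[R]_(m, n).
Local Notation MC := 'M[R[i]]_(m, n).
Local Notation C := (R[i]^o).

Let lin_ext (c : 'I_m -> 'I_n -> R[i]) (W : MC) : C := \sum_i \sum_j W i j * c i j.

Let lin_ext_linear c : linear (lin_ext c).
Proof.
move=> a u v; rewrite /lin_ext scaler_sumr -big_split/=; apply: eq_bigr => i _.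
rewrite scaler_sumr -big_split/=; apply: eq_bigr => j _.
by rewrite !mxE mulrDl -mulrA.
Qed.

HB.instance Definition _ c := GRing.isLinear.Build R[i] MC C _ (lin_ext c) (lin_ext_linear c).

Lemma linear_coordE (V : lmodType R) (l : {linear M -> V}) X :
  l X = \sum_i \sum_j X i j *: l (delta_mx i j).
Proof.
rewrite {1}(matrix_sum_delta X) linear_sum; apply: eq_bigr => i _.
by rewrite linear_sum; apply: eq_bigr => j _; rewrite linearZ.
Qed.

(** Derivatives are taken along real matrices; extending them complex-linearly gives them values on
    root vectors. *)
Lemma complex_linear_ext (l1 l2 : {linear M -> R^o}) :
  exists delta : 'Hom(MC, C), forall X, delta (mxC X) = l1 X +i* l2 X.
Proof.
exists (linfun (lin_ext (fun i j => l1 (delta_mx i j) +i* l2 (delta_mx i j)))) => X.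
rewrite lfunE/= /lin_ext (linear_coordE l1) (linear_coordE l2).
apply: complex_ext => /=.
  rewrite Re_sum; apply: eq_bigr => i _; rewrite Re_sum; apply: eq_bigr => j _.
  by rewrite mxE cReM/= mul0r subr0.
rewrite Im_sum; apply: eq_bigr => i _; rewrite Im_sum; apply: eq_bigr => j _.
by rewrite mxE cImM/= mul0r addr0.
Qed.

Let bil_ext (d : 'I_m -> 'I_n -> 'Hom(MC, C)) (W : MC) : 'Hom(MC, C) :=
  \sum_i \sum_j W i j *: d i j.

Let bil_ext_linear d : linear (bil_ext d).
Proof.
move=> a u v; rewrite /bil_ext scaler_sumr -big_split/=; apply: eq_bigr => i _.
rewrite scaler_sumr -big_split/=; apply: eq_bigr => j _.
by rewrite !mxE scalerDl scalerA.
Qed.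

HB.instance Definition _ d :=
  GRing.isLinear.Build R[i] MC 'Hom(MC, C) _ (bil_ext d) (bil_ext_linear d).

Lemma complex_bilinear_ext (b1 b2 : M -> M -> R) :
  (forall X, linear (b1 X : M -> R^o)) -> (forall X, linear (b2 X : M -> R^o)) ->
  (forall Y, linear (b1^~ Y : M -> R^o)) -> (forall Y, linear (b2^~ Y : M -> R^o)) ->
  exists beta : 'Hom(MC, 'Hom(MC, C)),
    forall X Y, beta (mxC X) (mxC Y) = b1 X Y +i* b2 X Y.
Proof.
move=> L1 L2 L1' L2'.
have mk (l : M -> R^o) : linear l -> exists l' : {linear M -> R^o}, l =1 l'.
  move=> ll; pose f := GRing.isLinear.Build R _ _ _ _ ll.
  by exists (HB.pack l f : {linear M -> R^o}).
have /choice[d dE] : forall ij : 'I_m * 'I_n, exists d : 'Hom(MC, C),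
    forall Y, d (mxC Y) = b1 (delta_mx ij.1 ij.2) Y +i* b2 (delta_mx ij.1 ij.2) Y.
  move=> [i j] /=.
  have [l1 E1] := mk _ (L1 (delta_mx i j)); have [l2 E2] := mk _ (L2 (delta_mx i j)).
  have [d dE] := complex_linear_ext l1 l2; exists d => Y.
  by rewrite dE -E1 -E2.
exists (linfun (bil_ext (fun i j => d (i, j)))) => X Y.
rewrite lfunE/= /bil_ext sum_lfunE.
have [l1 E1] := mk _ (L1' Y); have [l2 E2] := mk _ (L2' Y).
have -> : b1 X Y = l1 X by rewrite -E1.
have -> : b2 X Y = l2 X by rewrite -E2.
rewrite (linear_coordE l1) (linear_coordE l2).
apply: complex_ext => /=.
  rewrite Re_sum; apply: eq_bigr => i _; rewrite sum_lfunE Re_sum; apply: eq_bigr => j _.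
  by rewrite mxE scale_lfunE dE cReM/= mul0r subr0 -E1.
rewrite Im_sum; apply: eq_bigr => i _; rewrite sum_lfunE Im_sum; apply: eq_bigr => j _.
by rewrite mxE scale_lfunE dE cImM/= mul0r addr0 -E2.
Qed.

Lemma is_cderive_linear (delta : 'Hom(MC, C)) (y : R -> M) (D : M) :
  is_derive (0 : R) (1 : R) y D ->
  is_cderive (fun s => delta (mxC (y s))) (delta (mxC D)).
Proof.
move=> dy.
have E (X : M) : delta (mxC X) = \sum_i \sum_j delta (delta_mx i j) * (X i j)%:C.
  rewrite {1}(matrix_sum_delta (mxC X)) linear_sum; apply: eq_bigr => i _.
  rewrite linear_sum; apply: eq_bigr => j _; rewrite linearZ/= mxE.
  by rewrite mulrC.
under eq_fun do rewrite E.
rewrite E; apply: is_cderive_sum => i; apply: is_cderive_sum => j.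
apply: is_cderiveZ; split => /=; first exact: is_derive_mx_coord.
exact: is_derive_cst.
Qed.

End ComplexExtension.

(** * Second derivatives along exponential curves *)

Section Jets.
Context {R : realType} {n : nat}.
Local Notation M := 'M[R]_n.+1.
Local Notation MC := 'M[R[i]]_n.+1.
Local Notation C := (R[i]^o).

Lemma is_derive_along (F : M -> R) (y : R -> M) (s : R) (D : M) :
  differentiable F (y s) -> is_derive s (1 : R) y D ->
  is_derive s (1 : R) (fun s => F (y s)) ('D_D F (y s)).
Proof.
move=> dF [dy <-].
have dy' : differentiable y s by apply/derivable1_diffP.
have dFy : differentiable (F \o y) s by exact: differentiable_comp.
apply: DeriveDef; first exact: diff_derivable.
by rewrite [LHS](deriveE _ dFy) diff_comp//= -[in LHS](deriveE _ dy') (deriveE _ dF).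
Qed.

Lemma derive_delta_sum (F : M -> R) (x V : M) : differentiable F x ->
  'D_V F x = \sum_i \sum_j V i j * 'D_(delta_mx i j) F x.
Proof.
move=> dF; rewrite deriveE// {1}(matrix_sum_delta V) linear_sum; apply: eq_bigr => i _.
by rewrite linear_sum; apply: eq_bigr => j _; rewrite linearZ/= deriveE.
Qed.

Definition C2_at (U : set M) (F : M -> R) :=
  (forall x, U x -> differentiable F x) /\
  (forall v x, U x -> differentiable (fun y => 'D_v F y) x).

(** The product rule for s |-> D_(X y(s)) F (y(s)) at 0, where y(s) = exp(sY) x: the first summand
    differentiates the direction X y(s), the second the partial derivatives of F. *)
Definition jet2 (F : M -> R) (x X Y : M) : R :=
  \sum_i \sum_j ((X *m Y *m x) i j * 'D_(delta_mx i j) F x +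
    (X *m x) i j * 'D_(Y *m x) (fun y => 'D_(delta_mx i j) F y) x).

Lemma is_derive_expmx_mul (Y x : M) (s : R) :
  is_derive s (1 : R) (fun s : R => expmx (s *: Y) *m x) (Y *m (expmx (s *: Y) *m x)).
Proof.
have H := is_derive_mulmx (is_derive_expmx Y s) (is_derive_cst x s (1 : R)).
by move: H; rewrite mulmx0 addr0 mulmxA.
Qed.

Lemma expmx_mul_near (U : set M) (Y x : M) : open U -> U x ->
  \forall s \near (0 : R), U (expmx (s *: Y) *m x).
Proof.
move=> oU Ux.
have c : {for (0 : R), continuous (fun s : R => expmx (s *: Y) *m x)}.
  apply/differentiable_continuous/derivable1_diffP.
  by case: (is_derive_expmx_mul Y x 0).
apply: c; rewrite scale0r expmx0 mul1mx; exact: open_nbhs_nbhs.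
Qed.

Lemma is_derive_jet2 (U : set M) (F : M -> R) (x X Y : M) : open U -> U x -> C2_at U F ->
  is_derive (0 : R) (1 : R)
    (fun s : R => 'D_(X *m (expmx (s *: Y) *m x)) F (expmx (s *: Y) *m x)) (jet2 F x X Y).
Proof.
move=> oU Ux [dF d2F].
pose y (s : R) := expmx (s *: Y) *m x.
have y0 : y 0 = x by rewrite /y scale0r expmx0 mul1mx.
have H : is_derive (0 : R) (1 : R) (fun s => \sum_i \sum_j (X *m y s) i j *
    'D_(delta_mx i j) F (y s)) (jet2 F x X Y).
  have -> : (fun s => \sum_i \sum_j (X *m y s) i j * 'D_(delta_mx i j) F (y s)) =
     \sum_i \sum_j ((fun s => (X *m y s) i j) * (fun s => 'D_(delta_mx i j) F (y s))).
    apply/funext => s; rewrite fct_sumE; apply: eq_bigr => i _.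
    by rewrite fct_sumE; apply: eq_bigr.
  apply: is_derive_sum => i; apply: is_derive_sum => j.
  have h1 : is_derive (0 : R) (1 : R) (fun s => (X *m y s) i j) ((X *m Y *m x) i j).
    apply: is_derive_mx_coord.
    have := is_derive_mulmx (is_derive_cst X (0 : R) (1 : R)) (is_derive_expmx_mul Y x 0).
    by rewrite mul0mx add0r scale0r expmx0 mul1mx mulmxA.
  have h2 : is_derive (0 : R) (1 : R) (fun s => 'D_(delta_mx i j) F (y s))
      ('D_(Y *m x) (fun z => 'D_(delta_mx i j) F z) x).
    have := @is_derive_along (fun z => 'D_(delta_mx i j) F z) y 0 (Y *m x).
    rewrite y0; apply; first exact: d2F.
    by have := is_derive_expmx_mul Y x 0; rewrite scale0r expmx0 mul1mx.
  have := is_deriveM h1 h2; rewrite y0 => h; apply: is_derive_eq h _.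
  by rewrite addrC [X in X + _ = _]mulrC.
apply: near_eq_is_derive H; near=> s; rewrite derive_delta_sum//.
by apply: dF; near: s; exact: expmx_mul_near.
Unshelve. all: by end_near. Qed.

Lemma jet2_linearl F x Y : linear ((jet2 F x)^~ Y : M -> R^o).
Proof.
move=> a u v; rewrite /jet2 scaler_sumr -big_split/=; apply: eq_bigr => i _.
rewrite scaler_sumr -big_split/=; apply: eq_bigr => j _.
by rewrite !mulmxDl -!scalemxAl !mxE /GRing.scale/=; ring.
Qed.

Lemma jet2_linearr U F x X : U x -> C2_at U F -> linear (jet2 F x X : M -> R^o).
Proof.
move=> Ux [dF d2F] a u v; rewrite /jet2 scaler_sumr -big_split/=; apply: eq_bigr => i _.
rewrite scaler_sumr -big_split/=; apply: eq_bigr => j _.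
have dG := d2F (delta_mx i j) x Ux.
have -> : 'D_((a *: u + v) *m x) (fun y => 'D_(delta_mx i j) F y) x =
    a * 'D_(u *m x) (fun y => 'D_(delta_mx i j) F y) x +
    'D_(v *m x) (fun y => 'D_(delta_mx i j) F y) x.
  by rewrite !(deriveE _ dG) mulmxDl -scalemxAl linearP.
have -> : X *m (a *: u + v) *m x = a *: (X *m u *m x) + X *m v *m x :> M.
  by rewrite mulmxDr mulmxDl -scalemxAr -scalemxAl.
rewrite mxE [X in (X + _) * _]mxE.
move: ((X *m u *m x) i j) ((X *m v *m x) i j) ((X *m x) i j) => p1 p2 p3.
move: ('D_(delta_mx i j) F x) ('D_(u *m x) _ x) ('D_(v *m x) _ x) => q1 q2 q3.
by rewrite /GRing.scale/=; ring.
Qed.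

Definition C2_on (G : set M) (f : M -> R[i]) (x : M) : Prop :=
  exists (U : set M) (F1 F2 : M -> R),
    [/\ open U, U x, C2_at U F1, C2_at U F2 &
        forall y, G y -> U y -> f y = F1 y +i* F2 y].

Lemma smooth_on_C2 (G : set M) f x : smooth_on G f -> G x -> C2_on G f x.
Proof.
move=> H /H [U [F1 [F2 [oU Ux HC fE]]]]; exists U, F1, F2; split => //.
  by have [[d H2] _] := HC 2%N; split => // v; case: (H2 v).
by have [_ [d H2]] := HC 2%N; split => // v; case: (H2 v).
Qed.

Lemma C2_at_comp (L : {linear M -> M}) U F : C2_at U F -> C2_at (L @^-1` U) (F \o L).
Proof.
move=> [dF d2F].
have cL : continuous L by exact: linear_mx_continuous.
have dL x : differentiable L x by exact: linear_differentiable.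
have E v y : 'D_v (F \o L) y = 'D_(L v) F (L y).
  have H : (fun h => h^-1 *: ((F \o L) (h *: v + y) - (F \o L) y)) =
      (fun h => h^-1 *: (F (h *: L v + L y) - F (L y))).
    by apply/funext => h /=; rewrite linearP.
  by rewrite /derive H.
split=> [x Ux|v x Ux].
  by apply: differentiable_comp => //; exact: dF.
under eq_fun do rewrite E.
by apply: (@differentiable_comp _ _ _ _ L (fun y => 'D_(L v) F y)) => //; exact: d2F.
Qed.

Lemma C2_on_comp (G : set M) f (L : {linear M -> M}) x :
  (forall y, G y -> G (L y)) -> C2_on G f (L x) -> C2_on G (f \o L) x.
Proof.
move=> GL [U [F1 [F2 [oU Ux H1 H2 fE]]]].
exists (L @^-1` U), (F1 \o L), (F2 \o L); split => //.
- by apply: open_comp => // y _; exact: linear_mx_continuous.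
- exact: C2_at_comp.
- exact: C2_at_comp.
- by move=> y /GL Gy Uy; exact: fE.
Qed.

(** The derivatives are those of a local extension F1 + i F2 of [f]. They agree with those of [f]
    because exp(sX) y stays in [G], and stays in [U] for small s. *)
Lemma jets (G : set M) (alg : set M) f x :
  (forall X s y, alg X -> G y -> G (expmx (s *: X) *m y)) ->
  G x -> C2_on G f x ->
  exists (delta : 'Hom(MC, C)) (beta : 'Hom(MC, 'Hom(MC, C))),
    (forall X, alg X -> is_cderive (fun s => f (expmx (s *: X) *m x)) (delta (mxC X))) /\
    (forall X Y, alg X -> alg Y ->
      is_cderive (fun s => actr f X (expmx (s *: Y) *m x)) (beta (mxC X) (mxC Y))).
Proof.
move=> GE Gx [U [F1 [F2 [oU Ux H1 H2 fE]]]].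
have D1 (X y : M) : alg X -> G y -> U y ->
    is_cderive (fun s => f (expmx (s *: X) *m y)) ('D_(X *m y) F1 y +i* 'D_(X *m y) F2 y).
  move=> aX Gy Uy.
  apply: (@near_is_cderive _ (fun s => F1 (expmx (s *: X) *m y) +i* F2 (expmx (s *: X) *m y))).
    near=> s; rewrite fE//; first exact: GE.
    by near: s; exact: expmx_mul_near.
  have := is_derive_expmx_mul X y 0; rewrite scale0r expmx0 mul1mx => dX.
  split=> /=.
    have := @is_derive_along F1 (fun s => expmx (s *: X) *m y) 0 (X *m y).
    by rewrite scale0r expmx0 mul1mx; apply => //; apply: (proj1 H1).
  have := @is_derive_along F2 (fun s => expmx (s *: X) *m y) 0 (X *m y).
  by rewrite scale0r expmx0 mul1mx; apply => //; apply: (proj1 H2).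
have mk (F : M -> R) : C2_at U F -> exists l : {linear M -> R^o}, forall X, l X = 'D_(X *m x) F x.
  move=> [dF _]; have ll : linear (fun X => 'D_(X *m x) F x : R^o).
    move=> a u v; rewrite mulmxDl -scalemxAl deriveE ?linearP/=; last exact: dF.
    by rewrite !deriveE//; exact: dF.
  pose h := GRing.isLinear.Build R _ _ _ _ ll.
  by exists (HB.pack (fun X => 'D_(X *m x) F x : R^o) h : {linear M -> R^o}).
have [l1 E1] := mk _ H1; have [l2 E2] := mk _ H2.
have [delta dE] := complex_linear_ext l1 l2.
have [beta bE] := complex_bilinear_ext
  (fun X => jet2_linearr X Ux H1) (fun X => jet2_linearr X Ux H2)
  (fun Y => jet2_linearl F1 x Y) (fun Y => jet2_linearl F2 x Y).
exists delta, beta; split=> [X aX|X Y aX aY].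
  by rewrite dE E1 E2; exact: D1.
rewrite bE.
apply: (@near_is_cderive _ (fun s => 'D_(X *m (expmx (s *: Y) *m x)) F1 (expmx (s *: Y) *m x)
   +i* 'D_(X *m (expmx (s *: Y) *m x)) F2 (expmx (s *: Y) *m x))).
  near=> s; apply/esym/is_cderiveE; apply: D1 => //; first exact: GE.
  by near: s; exact: expmx_mul_near.
by split => /=; exact: (is_derive_jet2 _ _ oU Ux).
Unshelve. all: by end_near. Qed.

End Jets.

(** * Jets of zonal functions *)

Section Constants.
Context {R : realType}.

Lemma eta_tr n : (eta n : 'M[R]_n.+1)^T = eta n.
Proof. by rewrite /eta tr_diag_mx. Qed.

Lemma eta_sqr n : (eta n : 'M[R]_n.+1) *m eta n = 1%:M.
Proof.
rewrite /eta mulmx_diag -[RHS]diag_const_mx; congr diag_mx; apply/rowP => i.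
by rewrite !mxE; case: eqP; rewrite ?mulrNN mulr1.
Qed.

Lemma eta_unit n : (eta n : 'M[R]_n.+1) \in unitmx.
Proof. by case: (mulmx1_unit (eta_sqr n)). Qed.

Lemma Smx_sqr d p : (Smx d p : 'M[R]_d.+2) *m Smx d p = 1%:M.
Proof.
rewrite /Smx mulmx_diag -[RHS]diag_const_mx; congr diag_mx; apply/rowP => i.
by rewrite !mxE; case: ifP; rewrite ?mulrNN mulr1.
Qed.

Lemma Smx_tr d p : (Smx d p : 'M[R]_d.+2)^T = Smx d p.
Proof. by rewrite /Smx tr_diag_mx. Qed.

Lemma eta_Smx_comm d p : eta d.+1 *m Smx d p = Smx d p *m eta d.+1 :> 'M[R]_d.+2.
Proof.
by rewrite /eta /Smx !mulmx_diag; congr diag_mx; apply/rowP => i; rewrite !mxE mulrC.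
Qed.

Lemma defect_dim d p : (p <= d)%N -> ((d - p) + p.+2)%N = d.+2.
Proof. by move=> pd; rewrite !addnS subnK. Qed.

Lemma eta_block d p (e : ((d - p) + p.+2)%N = d.+2) :
  eta d.+1 = bd e 1%:M (eta p.+1) :> 'M[R]_d.+2.
Proof.
apply/matrixP => i j; rewrite /bd castmxE block_mxEh !mxE.
have vi : nat_of_ord (cast_ord (esym e) i) = i by [].
have vj : nat_of_ord (cast_ord (esym e) j) = j by [].
have di := ltn_ord i; have dj := ltn_ord j.
have E : (i == j) = (nat_of_ord i == nat_of_ord j) by [].
have E1 : (j == ord_max) = (nat_of_ord j == d.+1) by [].
have E1' : (i == ord_max) = (nat_of_ord i == d.+1) by [].
rewrite E E1'.
case: splitP => k /=; rewrite ?vj => Ek; rewrite !mxE; case: splitP => l /=; rewrite ?vi => El; rewrite !mxE.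
- rewrite El Ek; have dl := ltn_ord l.
  have -> : (nat_of_ord l == d.+1) = false by apply/eqP; lia.
  by [].
- have dk := ltn_ord k; rewrite El Ek.
  have -> : (d - p + l == k)%N = false by apply/eqP; lia.
  by rewrite mulr0n.
- have dl := ltn_ord l; rewrite El Ek.
  have -> : (l == d - p + k :> nat)%N = false by apply/eqP; lia.
  by rewrite mulr0n.
- rewrite El Ek eqn_add2l.
  have -> : (d - p + l == d.+1 :> nat)%N = (l == ord_max).
    by rewrite -val_eqE /=; apply/eqP/eqP; lia.
  by [].
Qed.

Lemma Smx_block d p (e : ((d - p) + p.+2)%N = d.+2) :
  Smx d p = bd e 1%:M (- 1%:M) :> 'M[R]_d.+2.
Proof.
apply/matrixP => i j; rewrite /bd castmxE block_mxEh !mxE.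
have vi : nat_of_ord (cast_ord (esym e) i) = i by [].
have vj : nat_of_ord (cast_ord (esym e) j) = j by [].
have E : (i == j) = (nat_of_ord i == nat_of_ord j) by [].
rewrite E.
case: splitP => k /=; rewrite ?vj => Ek; rewrite !mxE; case: splitP => l /=; rewrite ?vi => El; rewrite !mxE.
- rewrite El Ek; have dl := ltn_ord l.
  by rewrite dl.
- have dk := ltn_ord k; rewrite El Ek.
  have -> : (d - p + l == k)%N = false by apply/eqP; lia.
  by rewrite mulr0n.
- have dl := ltn_ord l; rewrite El Ek.
  have -> : (l == d - p + k :> nat)%N = false by apply/eqP; lia.
  by rewrite mulr0n.
- rewrite El Ek eqn_add2l.
  have -> : (d - p + l < d - p)%N = false by lia.
  by rewrite mulNrn.
Qed.

Lemma defect_subgroupE d p (e : ((d - p) + p.+2)%N = d.+2) :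
  (defect_subgroup d p : set 'M[R]_d.+2) = block_group e (eta p.+1).
Proof.
have E (A : 'M[R]_(d - p)) (B : 'M[R]_p.+2) :
  conform_mx (0 : 'M[R]_d.+2) (block_mx A 0 0 B) = bd e A B.
  by rewrite /bd -(conform_castmx (e, e)) conform_mx_id.
by apply/seteqP; split=> h [A [B [HA HB ->]]]; exists A, B; rewrite E.
Qed.

End Constants.

Section Invariance.
Context {R : realType} {d p : nat}.
Hypothesis pd : (p <= d)%N.
Local Notation M := 'M[R]_d.+2.
Local Notation MC := 'M[R[i]]_d.+2.
Local Notation C := (R[i]^o).
Local Notation G := (SO0 d : set M).

Definition alg : set M := [set X | X^T *m eta d.+1 + eta d.+1 *m X = 0].
Definition halg : set M := [set X | alg X /\ sigma p X = X].

Lemma algP X : (X \in so_conf d) <-> alg X.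
Proof. by rewrite /so_conf mem_so_alg; split=> [/eqP//|/eqP]. Qed.

Lemma algZ a X : alg X -> alg (a *: X).
Proof.
by rewrite /alg/= => H; rewrite linearZ/= -scalemxAl -scalemxAr -scalerDr H scaler0.
Qed.

Lemma algD X Y : alg X -> alg Y -> alg (X + Y).
Proof.
rewrite /alg/= => H K; rewrite linearD/= mulmxDl mulmxDr addrACA H K addr0 //.
Qed.

Lemma algN X : alg X -> alg (- X).
Proof. by move=> H; rewrite -scaleN1r; exact: algZ. Qed.

Lemma G_isom g : G g -> g^T *m eta d.+1 *m g = eta d.+1.
Proof. by move=> /SOc_sub[]. Qed.

Lemma isom_inv (g : M) : g^T *m eta d.+1 *m g = eta d.+1 ->
  (eta d.+1 *m g^T *m eta d.+1) *m g = 1%:M.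
Proof. by move=> H; rewrite -!mulmxA (mulmxA g^T) H eta_sqr. Qed.

Lemma isom_invmx (g : M) : g^T *m eta d.+1 *m g = eta d.+1 ->
  invmx g = eta d.+1 *m g^T *m eta d.+1.
Proof.
move=> /isom_inv H; have [_ U] := mulmx1_unit H.
by rewrite -[RHS]mulmx1 -(mulmxV U) mulmxA H mul1mx.
Qed.

Lemma isom_unit (g : M) : g^T *m eta d.+1 *m g = eta d.+1 -> g \in unitmx.
Proof. by move=> /isom_inv H; have [_ U] := mulmx1_unit H. Qed.

Lemma alg_isom (g X : M) : g^T *m eta d.+1 *m g = eta d.+1 -> alg X ->
  alg (g *m X *m invmx g).
Proof.
move=> gJ XJ; rewrite /alg/= (isom_invmx gJ).
set J := eta d.+1 in gJ XJ *; have JJ : J *m J = 1%:M by exact: eta_sqr.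
have JT : J^T = J by exact: eta_tr.
rewrite !trmx_mul JT trmxK.
have E1 : J *m (g *m J) *m (X^T *m g^T) *m J = J *m g *m J *m X^T *m (g^T *m J).
  by rewrite !mulmxA.
have E3 : X^T *m J = - (J *m X) by apply/eqP; rewrite -addr_eq0 XJ.
have E4 : X^T = - (J *m X *m J) by rewrite -mulNmx -E3 -mulmxA JJ mulmx1.
rewrite E1 E4 mulmxN mulNmx -!mulmxA !(mulmxA J J) JJ !mul1mx !mulmxA.
by rewrite addNr.
Qed.

Lemma G_exp X : alg X -> G (expmx X).
Proof. by move=> aX; apply: expmx_SOc => //; exact: eta_unit. Qed.

Lemma G_expl X s y : alg X -> G y -> G (expmx (s *: X) *m y).
Proof. by move=> aX Gy; apply: SOc_mul => //; apply: G_exp; exact: algZ. Qed.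

Lemma G_mul a b : G a -> G b -> G (a *m b). Proof. exact: SOc_mul. Qed.

(* Equal to the inverse on G, but linear in g, so that composition with it
   preserves differentiability on open sets of matrices. *)
Definition einv (g : M) : M := eta d.+1 *m g^T *m eta d.+1.

Lemma einvE g : G g -> einv g = invmx g.
Proof. by move=> /G_isom/isom_invmx. Qed.

Lemma einv_mul g h : einv (g *m h) = einv h *m einv g.
Proof.
by rewrite /einv trmx_mul -!mulmxA (mulmxA (eta d.+1) (eta d.+1)) eta_sqr mul1mx.
Qed.

Lemma G_einv g : G g -> G (einv g).
Proof.
apply: (SOc_image (phi := einv)).
- move=> k; apply: (@continuous_comp _ _ _ (@trmx R d.+2 d.+2) (fun g => eta d.+1 *m g *m eta d.+1)).
    exact: trmx_continuous.
  exact: conj_continuous.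
- move=> k [kJ k1]; split.
    have kk : k *m einv k = 1%:M by apply: mulmx1C; exact: isom_inv.
    rewrite {1}/einv !trmx_mul trmxK eta_tr.
    rewrite -!mulmxA (mulmxA (eta d.+1) (eta d.+1)) eta_sqr mul1mx.
    by rewrite kk mulmx1.
  by rewrite /einv !det_mulmx det_tr k1 mulr1 -det_mulmx eta_sqr det1.
- by rewrite /einv trmx1 mulmx1 eta_sqr; exact: SOc1.
Qed.

Lemma einv_exp X : alg X -> einv (expmx X) = expmx (- X).
Proof. by move=> aX; rewrite einvE ?invmx_expmx//; exact: G_exp. Qed.

Lemma sigma_comm (X : M) : sigma p X = X <-> X *m Smx d p = Smx d p *m X.
Proof.
rewrite /sigma; split=> E; last by rewrite -mulmxA E mulmxA Smx_sqr mul1mx.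
by rewrite -{1}E -!mulmxA Smx_sqr mulmx1.
Qed.

Lemma H_exp X : halg X -> defect_subgroup d p (expmx X).
Proof.
move=> [aX /sigma_comm sX]; have e := defect_dim pd.
rewrite (defect_subgroupE e); apply: block_group_exp; first exact: eta_unit.
  by rewrite -eta_block.
by rewrite -Smx_block.
Qed.

Lemma H1 : defect_subgroup d p (1%:M : M).
Proof.
have e := defect_dim pd; rewrite (defect_subgroupE e); exists 1%:M, 1%:M.
by rewrite bd1; split; [exact: SO_of1|exact: SOc1|].
Qed.

Lemma halgZ a X : halg X -> halg (a *: X).
Proof.
move=> [aX sX]; split; first exact: algZ.
by rewrite /sigma -scalemxAr -scalemxAl -[RHS](congr1 _ sX).
Qed.

(** f(h g h' t) = f(h (g t) (t^-1 h' t)), and [t] normalizes the defect subgroup because [sigma]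
    fixes it. *)
Lemma zonal_mulr (f : M -> R[i]) (t : M) : G t -> sigma p t = t ->
  zonal p f -> zonal p (fun g => f (g *m t)).
Proof.
move=> Gt st zf g h h' Gg Hh Hh'; have e := defect_dim pd.
have tu : t \in unitmx := isom_unit (G_isom Gt).
have -> : h *m g *m h' *m t = h *m (g *m t) *m (invmx t *m h' *m t).
  by rewrite !mulmxA (mulmxK tu).
apply: zf => //; first exact: G_mul.
have -> : invmx t *m h' *m t = einv t *m h' *m invmx (einv t).
  by rewrite (einvE Gt) invmxK.
rewrite (defect_subgroupE e); apply: block_group_conj.
- exact: eta_unit.
- exact: eta_sqr.
- by rewrite -eta_block; apply: G_isom; exact: G_einv.
- move/sigma_comm : st => st; rewrite -Smx_block.
  have := congr1 trmx st; rewrite !trmx_mul Smx_tr /einv => H.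
  rewrite -!mulmxA eta_Smx_comm (mulmxA _ (Smx d p)) -H !mulmxA.
  by rewrite eta_Smx_comm.
- by rewrite -defect_subgroupE.
Qed.

Lemma zonal_einv (f : M -> R[i]) : zonal p f -> zonal p (fun g => f (einv g)).
Proof.
move=> zf g h h' Gg Hh Hh'; have e := defect_dim pd.
rewrite !einv_mul mulmxA.
have H k : defect_subgroup d p k -> defect_subgroup d p (einv k).
  rewrite (defect_subgroupE e) /einv (eta_block e).
  by apply: block_group_adj; [exact: eta_tr|exact: eta_sqr].
by apply: zf; [exact: G_einv|exact: H|exact: H].
Qed.

Lemma linear_pack (L : M -> M) : linear L -> exists L' : {linear M -> M}, L =1 L'.
Proof.
by move=> ll; pose f := GRing.isLinear.Build R _ _ _ _ ll; exists (HB.pack L f : {linear M -> M}).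
Qed.

Lemma C2_mulr (f : M -> R[i]) (t : M) x : G t -> C2_on G f (x *m t) ->
  C2_on G (fun g => f (g *m t)) x.
Proof.
move=> Gt cf.
have [L LE] : exists L : {linear M -> M}, (fun g => g *m t) =1 L.
  by apply: linear_pack => a u v; rewrite mulmxDl scalemxAl.
have -> : (fun g => f (g *m t)) = f \o L by apply/funext => g /=; rewrite -LE.
apply: C2_on_comp; first by move=> y Gy; rewrite -LE; exact: G_mul.
by rewrite -LE.
Qed.

Lemma C2_einv (f : M -> R[i]) x : C2_on G f (einv x) ->
  C2_on G (fun g => f (einv g)) x.
Proof.
move=> cf.
have [L LE] : exists L : {linear M -> M}, einv =1 L.
  by apply: linear_pack => a u v; rewrite /einv linearP/= mulmxDr mulmxDl -scalemxAr -scalemxAl.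
have -> : (fun g => f (einv g)) = f \o L by apply/funext => g /=; rewrite -LE.
apply: C2_on_comp; first by move=> y Gy; rewrite -LE; exact: G_einv.
by rewrite -LE.
Qed.

(** [beta X Y] is the derivative of f(exp(uX) exp(sY) x) in u and s, extended complex-bilinearly.
    The order of the two exponentials matters: [beta] need not be symmetric. *)
Definition jet_at (f : M -> R[i]) (x : M) (delta : 'Hom(MC, C))
    (beta : 'Hom(MC, 'Hom(MC, C))) : Prop :=
  (forall X, alg X -> is_cderive (fun s => f (expmx (s *: X) *m x)) (delta (mxC X))) /\
  (forall X Y, alg X -> alg Y ->
     is_cderive (fun s => actr f X (expmx (s *: Y) *m x)) (beta (mxC X) (mxC Y))).

Lemma jet_at_exists f x : G x -> C2_on G f x -> exists delta beta, jet_at f x delta beta.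
Proof. by move=> Gx cf; apply: (jets (G := G)) => // X s y; exact: G_expl. Qed.

(** exp(uX) is the leftmost factor and is absorbed by left invariance, so the derivative along X
    vanishes on the whole group. *)
Lemma jet_h_outer f x delta beta X Y : zonal p f -> G x -> jet_at f x delta beta ->
  halg X -> alg Y -> beta (mxC X) (mxC Y) = 0.
Proof.
move=> zf Gx [_ jb] hX aY; have aX := hX.1.
rewrite -(is_cderiveE (jb _ _ aX aY)).
have E y : G y -> actr f X y = 0.
  move=> Gy; rewrite -[RHS](cderiv0_cst (f y)); congr cderiv0; apply/funext => s.
  by rewrite -[_ *m y]mulmx1; apply: zf => //; [apply: H_exp; exact: halgZ|exact: H1].
transitivity (cderiv0 (fun=> 0 : R[i])); last exact: cderiv0_cst.
by congr cderiv0; apply/funext => s; apply: E; exact: G_expl.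
Qed.

(** exp(s Ad(x)U) x = x exp(sU), and the rightmost factor is absorbed by right invariance. *)
Lemma jet_Adh_inner f x delta beta X U : zonal p f -> G x -> jet_at f x delta beta ->
  alg X -> halg U -> beta (mxC X) (mxC (x *m U *m invmx x)) = 0.
Proof.
move=> zf Gx [_ jb] aX hU; have aU := hU.1.
have xu := isom_unit (G_isom Gx).
have aUx : alg (x *m U *m invmx x) by apply: alg_isom => //; exact: G_isom.
rewrite -(is_cderiveE (jb _ _ aX aUx)).
have E s : expmx (s *: (x *m U *m invmx x)) *m x = x *m expmx (s *: U).
  have := expmx_conj (s *: U) (mulmxV xu); rewrite -scalemxAr -scalemxAl => <-.
  by rewrite mulmxKV.
under [X in cderiv0 X]eq_fun do rewrite E.
have E2 s : actr f X (x *m expmx (s *: U)) = actr f X x.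
  congr cderiv0; apply/funext => u; rewrite mulmxA.
  have := zf (expmx (u *: X) *m x) 1%:M (expmx (s *: U)); rewrite mul1mx; apply.
  - exact: G_expl.
  - exact: H1.
  - by apply: H_exp; exact: halgZ.
under [X in cderiv0 X]eq_fun do rewrite E2.
exact: cderiv0_cst.
Qed.

(** Left invariance under exp(-sU) replaces exp(uA) exp(sU) x by exp(u y(s)) x with y(s) =
    Ad(exp(-sU)) A, whose derivative at s = 0 is [A, U]. *)
Lemma jet_h_inner f x delta beta A U : zonal p f -> G x -> jet_at f x delta beta ->
  alg A -> halg U -> beta (mxC A) (mxC U) = delta (mxC (A *m U - U *m A)).
Proof.
move=> zf Gx [jd jb] aA hU; have aU := hU.1.
rewrite -(is_cderiveE (jb _ _ aA aU)).
pose y (s : R) := expmx (s *: - U) *m A *m expmx (s *: U).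
have ay s : alg (y s).
  have := alg_isom (G_isom (G_exp (algZ s (algN aU)))) aA.
  by rewrite invmx_expmx -scalerN opprK.
have E s : actr f A (expmx (s *: U) *m x) = delta (mxC (y s)).
  rewrite -(is_cderiveE (jd _ (ay s))); congr cderiv0; apply/funext => u.
  have := expmx_conj (u *: A) (expNmx (s *: U)); rewrite -scalemxAr -scalemxAl -scalerN => <-.
  rewrite -[LHS](zf _ (expmx (s *: - U)) 1%:M).
  - by rewrite mulmx1 !mulmxA.
  - by apply: G_expl => //; exact: G_expl.
  - by apply: H_exp; rewrite scalerN -scaleNr; exact: halgZ.
  - exact: H1.
under [X in cderiv0 X]eq_fun do rewrite E.
apply: is_cderiveE; apply: is_cderive_linear.
have D1 := is_derive_mulmx (is_derive_expmxN U 0) (is_derive_cst A (0 : R) (1 : R)).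
have := is_derive_mulmx D1 (is_derive_expmx U 0).
rewrite !scale0r !expmx0 !mulmx1 !mul1mx addr0 => D; apply: is_derive_eq D _.
by rewrite mulNmx addrC.
Qed.

End Invariance.

(** * Bivectors *)

Section Wedge.
Context {K : fieldType} {n : nat} (J : 'M[K]_n).
Hypotheses (JT : J^T = J) (JJ : J *m J = 1%:M).
Implicit Types (u w z : 'cV[K]_n) (X Y g : 'M[K]_n).

Definition dotJ u w : K := (u^T *m J *m w) 0 0.

(** The bivector u /\ w as an element of so(J), namely z |-> <w, z> u - <u, z> w; on standard basis
    vectors it is a generator F. *)
Definition bivec u w : 'M[K]_n := u *m w^T *m J - w *m u^T *m J.

Definition isskew X : Prop := X^T *m J + J *m X = 0.

Lemma dotJC u w : dotJ u w = dotJ w u.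
Proof.
by rewrite /dotJ -{1}[_ *m w]trmxK mxE !trmx_mul trmxK JT mulmxA.
Qed.

Lemma dotJDl u u' w : dotJ (u + u') w = dotJ u w + dotJ u' w.
Proof. by rewrite /dotJ linearD/= !mulmxDl mxE. Qed.

Lemma dotJZl a u w : dotJ (a *: u) w = a * dotJ u w.
Proof. by rewrite /dotJ linearZ/= -!scalemxAl mxE. Qed.

Lemma dotJDr u w w' : dotJ u (w + w') = dotJ u w + dotJ u w'.
Proof. by rewrite /dotJ !mulmxDr mxE. Qed.

Lemma dotJZr a u w : dotJ u (a *: w) = a * dotJ u w.
Proof. by rewrite /dotJ -!scalemxAr mxE. Qed.

Lemma dotJ_scale u w z : z *m u^T *m J *m w = dotJ u w *: z.
Proof.
rewrite -!mulmxA (mulmxA u^T) [u^T *m J *m w]mx11_scalar -/(dotJ u w).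
by rewrite mul_mx_scalar.
Qed.

Lemma bivec_apply u w z : bivec u w *m z = dotJ w z *: u - dotJ u z *: w.
Proof. by rewrite /bivec mulmxBl !dotJ_scale. Qed.

Lemma bivecDl u u' w : bivec (u + u') w = bivec u w + bivec u' w.
Proof.
rewrite /bivec linearD/= mulmxDr !mulmxDl opprD.
by rewrite -!addrA; congr (_ + _); rewrite [RHS]addrCA.
Qed.

Lemma bivecZl a u w : bivec (a *: u) w = a *: bivec u w.
Proof. by rewrite /bivec linearZ/= -!scalemxAr -!scalemxAl scalerBr. Qed.

Lemma bivecC u w : bivec u w = - bivec w u.
Proof. by rewrite /bivec opprB. Qed.

Lemma bivecNl u w : bivec (- u) w = bivec w u.
Proof. by rewrite -scaleN1r bivecZl scaleN1r -bivecC. Qed.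

Lemma bivecDr u w w' : bivec u (w + w') = bivec u w + bivec u w'.
Proof. by rewrite bivecC bivecDl opprD -!bivecC. Qed.

Lemma bivecZr a u w : bivec u (a *: w) = a *: bivec u w.
Proof. by rewrite bivecC bivecZl -scalerN -bivecC. Qed.

Lemma bivec_diag u : bivec u u = 0.
Proof. by rewrite /bivec subrr. Qed.

Lemma bivec0r u : bivec u 0 = 0.
Proof. by rewrite -(scale0r 0) bivecZr scale0r. Qed.

Lemma bivec0l w : bivec 0 w = 0.
Proof. by rewrite bivecC bivec0r oppr0. Qed.

Lemma bivec_skew u w : isskew (bivec u w).
Proof.
rewrite /isskew /bivec linearB/= !trmx_mul !trmxK JT mulmxBl mulmxBr !mulmxA.
by rewrite addrC addrA subrK subrr.
Qed.

Lemma skewZ a X : isskew X -> isskew (a *: X).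
Proof. by rewrite /isskew => H; rewrite linearZ/= -scalemxAl -scalemxAr -scalerDr H scaler0. Qed.

Lemma skewD X Y : isskew X -> isskew Y -> isskew (X + Y).
Proof. by rewrite /isskew => H H'; rewrite linearD/= mulmxDl mulmxDr addrACA H H' addr0. Qed.

Lemma skewB X Y : isskew X -> isskew Y -> isskew (X - Y).
Proof. by move=> H H'; apply: skewD => //; rewrite -scaleN1r; exact: skewZ. Qed.

Lemma skew_dotJ Y u w : isskew Y -> dotJ (Y *m u) w = - dotJ u (Y *m w).
Proof.
move=> sY; rewrite /dotJ trmx_mul -!mulmxA (mulmxA Y^T).
have -> : Y^T *m J = - (J *m Y) by apply/eqP; rewrite -addr_eq0 sY.
by rewrite mulNmx mulmxN mxE -!mulmxA.
Qed.

Lemma skew_bivec Y u w : isskew Y ->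
  Y *m bivec u w - bivec u w *m Y = bivec (Y *m u) w + bivec u (Y *m w).
Proof.
move=> sY; have E : Y^T *m J = - (J *m Y) by apply/eqP; rewrite -addr_eq0 sY.
rewrite /bivec mulmxBr mulmxBl !trmx_mul -!mulmxA E !mulmxN.
rewrite !opprB !opprK -!addrA; congr (_ + _).
by rewrite addrC -!addrA; congr (_ + _); rewrite addrC.
Qed.

Lemma bivec_conj g g' u w : g^T *m J *m g = J -> g *m g' = 1%:M ->
  g *m bivec u w *m g' = bivec (g *m u) (g *m w).
Proof.
move=> gJ gg'; have E : J *m g' = g^T *m J.
  by rewrite -{1}gJ -!mulmxA gg' mulmx1.
by rewrite /bivec mulmxBr mulmxBl !trmx_mul -!mulmxA E.
Qed.

Lemma trace_bivec Y u w : isskew Y -> \tr (bivec u w *m Y) = dotJ w (Y *m u) *+ 2.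
Proof.
move=> sY.
have T (a b : 'cV[K]_n) : \tr (a *m b^T *m J *m Y) = dotJ b (Y *m a).
  by rewrite -!mulmxA mxtrace_mulC /mxtrace big_ord1 /dotJ !mulmxA.
rewrite /bivec mulmxBl linearB/= !T -[dotJ u _]opprK -skew_dotJ// opprK dotJC.
by rewrite mulr2n.
Qed.

End Wedge.

(** * Real and imaginary parts of complex matrices *)

Section MatrixParts.
Context {R : realType}.
Local Notation C := R[i].

Lemma mxC_mul m n k (A : 'M[R]_(m, n)) (B : 'M[R]_(n, k)) : mxC (A *m B) = mxC A *m mxC B.
Proof. exact: map_mxM. Qed.

Lemma mxC_tr m n (A : 'M[R]_(m, n)) : mxC A^T = (mxC A)^T.
Proof. by rewrite /mxC map_trmx. Qed.

Lemma mxCD m n (A B : 'M[R]_(m, n)) : mxC (A + B) = mxC A + mxC B.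
Proof. exact: map_mxD. Qed.

Lemma mxCN m n (A : 'M[R]_(m, n)) : mxC (- A) = - mxC A.
Proof. exact: map_mxN. Qed.

Lemma mxCB m n (A B : 'M[R]_(m, n)) : mxC (A - B) = mxC A - mxC B.
Proof. exact: map_mxB. Qed.

Lemma mxC0 m n : mxC (0 : 'M[R]_(m, n)) = 0.
Proof. exact: map_mx0. Qed.

Lemma mxC1 n : mxC (1%:M : 'M[R]_n) = 1%:M.
Proof. exact: map_mx1. Qed.

Lemma mxCZ m n a (A : 'M[R]_(m, n)) : mxC (a *: A) = a%:C *: mxC A.
Proof. exact: map_mxZ. Qed.

Lemma mxC_inj m n : injective (@mxC R m n).
Proof. by move=> A B /matrixP H; apply/matrixP => i j; have := H i j; rewrite !mxE => -[]. Qed.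

Lemma mxRe_mxC m n (A : 'M[R]_(m, n)) : mxRe (mxC A) = A.
Proof. by apply/matrixP => i j; rewrite !mxE. Qed.

Lemma mxIm_mxC m n (A : 'M[R]_(m, n)) : mxIm (mxC A) = 0.
Proof. by apply/matrixP => i j; rewrite !mxE. Qed.

Lemma mxReIm m n (A : 'M[C]_(m, n)) : A = mxC (mxRe A) + 'i%C *: mxC (mxIm A).
Proof. by apply/matrixP => i j; rewrite !mxE [LHS]complexE. Qed.

Lemma mxRe_mul m n k l (A : 'M[R]_(m, n)) (W : 'M[C]_(n, k)) (B : 'M[R]_(k, l)) :
  mxRe (mxC A *m W *m mxC B) = A *m mxRe W *m B.
Proof.
apply/matrixP => i j; rewrite !mxE Re_sum; apply: eq_bigr => x _.
rewrite cReM !mxE/= mulr0 subr0 Re_sum; congr (_ * _); apply: eq_bigr => y _.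
by rewrite cReM !mxE/= mul0r subr0.
Qed.

Lemma mxIm_mul m n k l (A : 'M[R]_(m, n)) (W : 'M[C]_(n, k)) (B : 'M[R]_(k, l)) :
  mxIm (mxC A *m W *m mxC B) = A *m mxIm W *m B.
Proof.
apply/matrixP => i j; rewrite !mxE Im_sum; apply: eq_bigr => x _.
rewrite cImM !mxE/= mulr0 add0r Im_sum; congr (_ * _); apply: eq_bigr => y _.
by rewrite cImM !mxE/= mul0r addr0.
Qed.

Lemma mxReD m n (A B : 'M[C]_(m, n)) : mxRe (A + B) = mxRe A + mxRe B.
Proof. by apply/matrixP => i j; rewrite !mxE cReD. Qed.

Lemma mxImD m n (A B : 'M[C]_(m, n)) : mxIm (A + B) = mxIm A + mxIm B.
Proof. by apply/matrixP => i j; rewrite !mxE cImD. Qed.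

Lemma mxRe_tr m n (A : 'M[C]_(m, n)) : mxRe A^T = (mxRe A)^T.
Proof. by apply/matrixP => i j; rewrite !mxE. Qed.

Lemma mxIm_tr m n (A : 'M[C]_(m, n)) : mxIm A^T = (mxIm A)^T.
Proof. by apply/matrixP => i j; rewrite !mxE. Qed.

Lemma mxReZ m n a (A : 'M[C]_(m, n)) :
  mxRe (a *: A) = complex.Re a *: mxRe A - complex.Im a *: mxIm A.
Proof. by apply/matrixP => i j; rewrite !mxE cReM. Qed.

Lemma mxImZ m n a (A : 'M[C]_(m, n)) :
  mxIm (a *: A) = complex.Re a *: mxIm A + complex.Im a *: mxRe A.
Proof. by apply/matrixP => i j; rewrite !mxE cImM. Qed.

Definition Jc n : 'M[C]_n.+1 := mxC (eta n).
Definition Sc d p : 'M[C]_d.+2 := mxC (Smx d p).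

Lemma Jc_tr n : (Jc n)^T = Jc n. Proof. by rewrite /Jc -mxC_tr eta_tr. Qed.
Lemma Jc_sqr n : Jc n *m Jc n = 1%:M. Proof. by rewrite /Jc -mxC_mul eta_sqr mxC1. Qed.
Lemma Sc_sqr d p : Sc d p *m Sc d p = 1%:M. Proof. by rewrite /Sc -mxC_mul Smx_sqr mxC1. Qed.
Lemma Sc_isom d p : (Sc d p)^T *m Jc d.+1 *m Sc d p = Jc d.+1.
Proof.
by rewrite /Sc /Jc -mxC_tr -!mxC_mul Smx_tr -eta_Smx_comm -mulmxA Smx_sqr mulmx1.
Qed.

Lemma skew_parts d (W : 'M[C]_d.+2) : isskew (Jc d.+1) W ->
  alg (mxRe W) /\ alg (mxIm W).
Proof.
rewrite /isskew /alg/= => H; split.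
  have := congr1 mxRe H; rewrite mxReD -[W^T *m _]mul1mx -[_ *m W]mulmx1 -mxC1 /Jc.
  rewrite mulmxA !mxRe_mul mxRe_tr mul1mx mulmx1 => ->.
  by apply/matrixP => i j; rewrite !mxE.
have := congr1 mxIm H; rewrite mxImD -[W^T *m _]mul1mx -[_ *m W]mulmx1 -mxC1 /Jc.
rewrite mulmxA !mxIm_mul mxIm_tr mul1mx mulmx1 => ->.
by apply/matrixP => i j; rewrite !mxE.
Qed.

Lemma skew_mxC d (X : 'M[R]_d.+2) : alg X -> isskew (Jc d.+1) (mxC X).
Proof. by move=> aX; rewrite /isskew /Jc -mxC_tr -!mxC_mul -mxCD aX mxC0. Qed.

End MatrixParts.

(** Bi-invariance of f at x as its jet sees it, over the complexified Lie algebra of H; [x'] stands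
    for the inverse of x. The evaluation of the Casimir sum depends on f through these identities
    alone. *)
Definition casimir_axioms {R : realType} (d p : nat) (x x' : 'M[R[i]]_d.+2)
  (delta : 'Hom('M[R[i]]_d.+2, R[i]^o))
  (beta : 'Hom('M[R[i]]_d.+2, 'Hom('M[R[i]]_d.+2, R[i]^o))) : Prop :=
  let h U := isskew (Jc d.+1) U /\ Sc d p *m U *m Sc d p = U in
  [/\ forall U Y, h U -> isskew (Jc d.+1) Y -> beta U Y = 0,
      forall X U, isskew (Jc d.+1) X -> h U -> beta X (x *m U *m x') = 0 &
      forall A U, isskew (Jc d.+1) A -> h U -> beta A U = delta (A *m U - U *m A)].

Section JetAxioms.
Context {R : realType} {d p : nat}.
Hypothesis pd : (p <= d)%N.
Local Notation C := R[i].

Lemma halg_parts (U : 'M[C]_d.+2) : isskew (Jc d.+1) U -> Sc d p *m U *m Sc d p = U ->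
  halg (p := p) (mxRe U) /\ halg (p := p) (mxIm U).
Proof.
move=> /skew_parts[U1 U2] SU; split; split => //; rewrite /sigma.
  by rewrite -mxRe_mul -[in RHS]SU.
by rewrite -mxIm_mul -[in RHS]SU.
Qed.

(** Each identity follows by linearity from the real and imaginary parts, which are again skew and,
    for U, fixed by [sigma]. *)
Lemma jet_casimir_axioms f (x : 'M[R]_d.+2) delta beta : zonal p f -> SO0 d x ->
  jet_at f x delta beta -> casimir_axioms p (mxC x) (mxC (invmx x)) delta beta.
Proof.
move=> zf Gx jf; split=> [U Y [hU SU] sY|X U sX [hU SU]|A U sA [hU SU]].
- have [h1 h2] := halg_parts hU SU; have [a1 a2] := skew_parts sY.
  rewrite (mxReIm U) (mxReIm Y) !(linearD, linearZ)/= !(add_lfunE, scale_lfunE).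
  by rewrite !(jet_h_outer pd zf Gx jf)// !(scaler0, addr0).
- have [h1 h2] := halg_parts hU SU; have [a1 a2] := skew_parts sX.
  rewrite (mxReIm U) (mxReIm X) mulmxDr mulmxDl -scalemxAr -scalemxAl -!mxC_mul.
  rewrite !(linearD, linearZ)/= !(add_lfunE, scale_lfunE).
  by rewrite !(jet_Adh_inner pd zf Gx jf)// !(scaler0, addr0).
- have [h1 h2] := halg_parts hU SU; have [a1 a2] := skew_parts sA.
  rewrite {1}(mxReIm U) {1}(mxReIm A) !(linearD, linearZ)/= !(add_lfunE, scale_lfunE).
  rewrite !(jet_h_inner pd zf Gx jf)//.
  rewrite -!(linearZ, linearD)/=; congr (delta _).
  rewrite [in RHS](mxReIm U) [in RHS](mxReIm A) !mxCB !mxC_mul.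
  move: (mxC (mxRe A)) (mxC (mxIm A)) (mxC (mxRe U)) (mxC (mxIm U)) => p1 p2 q1 q2.
  rewrite !(mulmxDl, mulmxDr) -!scalemxAl -!scalemxAr.
  move: (p1 *m q1) (p1 *m q2) (p2 *m q1) (p2 *m q2) => a11 a12 a21 a22.
  move: (q1 *m p1) (q1 *m p2) (q2 *m p1) (q2 *m p2) => b11 b12 b21 b22.
  by apply/matrixP => i j; rewrite !mxE; ring.
Qed.

End JetAxioms.

(** * Second derivatives along root vectors *)

Section RootSum.
Context {C : numFieldType} {N M : nat}.
Local Notation I := ('I_N * bool + 'I_M)%type.

Lemma sum_offdiag (A : 'I_N -> 'I_N -> C) :
  \sum_i \sum_j A i j = \sum_i A i i + \sum_(i : 'I_N) \sum_(j : 'I_N | (i < j)%N) (A i j + A j i).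
Proof.
have H i : \sum_j A i j = A i i + (\sum_(j : 'I_N | (i < j)%N) A i j + \sum_(j : 'I_N | (j < i)%N) A i j).
  rewrite (bigD1 i)//=; congr (_ + _); rewrite (bigID (fun j : 'I_N => (i < j)%N))/=.
  by congr (_ + _); apply: eq_bigl => j; rewrite -val_eqE /=; lia.
under eq_bigr do rewrite H.
rewrite !big_split/=; congr (_ + _).
under [in RHS]eq_bigr do rewrite big_split/=.
rewrite big_split/=; congr (_ + _).
by rewrite (exchange_big_dep xpredT).
Qed.

(** An index [inl (i, s)] is an eigenvector of weight plus or minus the i-th, and [inr m] one killed
    by the Cartan subspace. Over ordered pairs, opposite indices occur twice for each i, a short
    root M times in each order, a long root once in each order; this yields the coefficients 1/2,
    M/2 and 1/2. *)
Lemma root_sum (T : I -> I -> C) (bb gs : 'I_N -> C) (gl : 'I_N -> 'I_N -> bool -> C) :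
  (forall k, T k k = 0) -> (forall k l, T k l = T l k) ->
  (forall m m', T (inr m) (inr m') = 0) ->
  (forall i s, T (inl (i, s)) (inl (i, ~~ s)) = - bb i) ->
  (forall i j s, i != j ->
     T (inl (i, false)) (inl (j, s)) + T (inl (i, true)) (inl (j, ~~ s)) = - gl i j s) ->
  (forall i m, T (inl (i, false)) (inr m) + T (inl (i, true)) (inr m) = - gs i) ->
  - 4^-1 * \sum_k \sum_l T k l =
  2^-1 * \sum_i bb i + (M%:R / 2) * \sum_i gs i +
  2^-1 * \sum_(i : 'I_N) \sum_(j : 'I_N | (i < j)%N) (gl i j false + gl i j true).
Proof.
move=> Td Ts Tu To Tl Tsh.
have pp (F : 'I_N * bool -> C) : \sum_q F q = \sum_i (F (i, true) + F (i, false)).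
  under [RHS]eq_bigr do rewrite -(big_bool _ (fun s => F (_, s))).
  by rewrite (pair_bigA _ (fun i s => F (i, s)))/=; apply: eq_bigr => -[].
pose A i j := T (inl (i, true)) (inl (j, true)) + T (inl (i, true)) (inl (j, false)) +
  (T (inl (i, false)) (inl (j, true)) + T (inl (i, false)) (inl (j, false))).
have E : \sum_k \sum_l T k l = \sum_i \sum_j A i j - 2 * (M%:R * \sum_i gs i).
  rewrite big_sumType/=; under eq_bigr do rewrite big_sumType/=.
  under [X in _ + X]eq_bigr do rewrite big_sumType/=.
  rewrite !big_split/= [X in _ + (_ + X)]big1 ?addr0; last first.
    by move=> m _; apply: big1 => m' _; exact: Tu.
  rewrite -addrA; congr (_ + _).
    rewrite pp; apply: eq_bigr => i _; rewrite !pp -big_split/=; apply: eq_bigr => j _.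
    by [].
  have E1 : \sum_(k : 'I_N * bool) \sum_m T (inl k) (inr m) = - (M%:R * \sum_i gs i).
    rewrite pp mulr_sumr -sumrN; apply: eq_bigr => i _; rewrite -big_split/=.
    under eq_bigr do rewrite addrC Tsh.
    by rewrite sumr_const card_ord mulNrn mulr_natl.
  have E2 : \sum_m \sum_(k : 'I_N * bool) T (inr m) (inl k) = - (M%:R * \sum_i gs i).
    rewrite exchange_big/= -E1; apply: eq_bigr => k _; apply: eq_bigr => m _; exact: Ts.
  by rewrite E1 E2; ring.
have Aij i j : i != j -> A i j = - (gl i j false + gl i j true).
  by move=> ij; rewrite opprD -!Tl//= /A; ring.
have AC i j : A i j = A j i.
  rewrite /A (Ts (inl (i, true)) (inl (j, false))) (Ts (inl (i, false)) (inl (j, true))).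
  rewrite (Ts (inl (i, true)) (inl (j, true))) (Ts (inl (i, false)) (inl (j, false))).
  by ring.
rewrite E sum_offdiag.
have -> : \sum_i A i i = - (2 * \sum_i bb i).
  rewrite mulr_sumr -sumrN; apply: eq_bigr => i _.
  rewrite /A !Td (To i true) (To i false); ring.
have -> : \sum_(i : 'I_N) \sum_(j : 'I_N | (i < j)%N) (A i j + A j i) =
   - (2 * \sum_(i : 'I_N) \sum_(j : 'I_N | (i < j)%N) (gl i j false + gl i j true)).
  rewrite mulr_sumr -sumrN; apply: eq_bigr => i _; rewrite mulr_sumr -sumrN; apply: eq_bigr => j ij.
  have nij : i != j by rewrite -val_eqE /=; lia.
  rewrite (AC j i) Aij//; ring.
by field; rewrite ?pnatr_eq0.
Qed.

End RootSum.

(** * Eigenvectors of the Cartan subspace and their bivectors *)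

Section Frame.
Context {R : realType} {d p N M : nat}.
Variables (a b : 'I_N -> 'I_d.+2) (u : 'I_M -> 'I_d.+2).
Local Notation C := R[i].
Local Notation V := 'cV[C]_d.+2.
Local Notation J := (Jc d.+1 : 'M[C]_d.+2).
Local Notation S := (Sc d p : 'M[C]_d.+2).
Local Notation W := (bivec J).
Local Notation "<< x , y >>" := (dotJ J x y).

(* a i and b i span the plane rotated (or boosted) by the i-th generator of the
   Cartan subspace, which kills the basis vectors u m. *)
Definition frame_index (k : 'I_N + 'I_N + 'I_M) : 'I_d.+2 :=
  match k with inl (inl i) => a i | inl (inr i) => b i | inr m => u m end.

(** Each plane joins the two eigenspaces of [Smx], so [sigma] is -1 on its generator. The leftover
    vectors lie on one side, so [sigma] fixes the bivectors they form among themselves. *)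
Definition is_frame : Prop :=
  [/\ bijective frame_index, forall i, (a i < d - p)%N, forall i, (d - p <= b i)%N &
      (forall m, (u m < d - p)%N) \/ (forall m, (d - p <= u m)%N)].

Hypothesis frame : is_frame.

Definition ev (s : 'I_d.+2) : V := delta_mx s 0.
Definition sg (s : 'I_d.+2) : C := if s == ord_max then -1 else 1.
(* Chosen such that ev (a i) +/- om i *: ev (b i) are isotropic. *)
Definition om (i : 'I_N) : C := if b i == ord_max then 1 else 'i%C.

Lemma sg_sqr s : sg s * sg s = 1.
Proof. by rewrite /sg; case: ifP; rewrite ?mulrNN mulr1. Qed.

Lemma om_sqr i : om i * om i = - sg (b i).
Proof.
by rewrite /om /sg; case: ifP; rewrite ?mulr1 ?opprK// -expr2 sqr_i.
Qed.

Lemma om_neq0 i : om i != 0.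
Proof. by rewrite /om; case: ifP => _; rewrite ?oner_neq0// neq0Ci. Qed.

Lemma sg_a i : sg (a i) = 1.
Proof.
case: frame => _ aL _ _; rewrite /sg; case: eqP => // E; have := aL i; rewrite E /=.
lia.
Qed.

Lemma JE s t : J s t = sg s *+ (s == t).
Proof.
rewrite /Jc /Defs.eta !mxE /sg; case: eqP => [->|] /=; case: eqP => //= _.
all: by rewrite ?rmorphN ?rmorph1 ?rmorph0.
Qed.

Lemma form_ev s t : <<ev s, ev t>> = sg s *+ (s == t).
Proof.
by rewrite /dotJ /ev trmx_delta -mulmxA -rowE mxE -colE mxE JE.
Qed.

Lemma a_neq_b i j : (a i == b j) = false.
Proof.
case: frame => _ aL bR _; apply/eqP => E; have := aL i; have := bR j; rewrite E; lia.
Qed.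

Lemma frame_inj : injective frame_index.
Proof. by case: frame => /bij_inj. Qed.

Lemma a_inj i j : (a i == a j) = (i == j).
Proof.
apply/eqP/eqP => [E|->//].
by have /frame_inj[] : frame_index (inl (inl i)) = frame_index (inl (inl j)).
Qed.

Lemma b_inj i j : (b i == b j) = (i == j).
Proof.
apply/eqP/eqP => [E|->//].
by have /frame_inj[] : frame_index (inl (inr i)) = frame_index (inl (inr j)).
Qed.

Lemma u_inj i j : (u i == u j) = (i == j).
Proof. by apply/eqP/eqP => [E|->//]; have /frame_inj[] : frame_index (inr i) = frame_index (inr j). Qed.

Lemma a_neq_u i j : (a i == u j) = false.
Proof. by apply/eqP => E; have /frame_inj : frame_index (inl (inl i)) = frame_index (inr j). Qed.

Lemma b_neq_u i j : (b i == u j) = false.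
Proof. by apply/eqP => E; have /frame_inj : frame_index (inl (inr i)) = frame_index (inr j). Qed.

Let I := ('I_N * bool + 'I_M)%type.

Definition partner (k : I) : I :=
  match k with inl (i, s) => inl (i, ~~ s) | inr m => inr m end.

(** The factor [sg (b i)] makes the generator of the i-th plane act on [rt (inl (i, false))] by
    [om i], for a rotation and for a boost alike. *)
Definition rt (k : I) : V :=
  match k with
  | inl (i, s) => ev (a i) + ((-1) ^+ s * (sg (b i) * om i)) *: ev (b i)
  | inr m => ev (u m)
  end.

(* The basis dual to rt for the form J. *)
Definition rt' (k : I) : V :=
  match k with inl (i, s) => 2^-1 *: rt (inl (i, ~~ s)) | inr m => sg (u m) *: rt (inr m) end.

Lemma partnerK : involutive partner.
Proof. by move=> [[i s]|m] //=; rewrite negbK. Qed.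

Lemma C2_neq0 : (2 : C) != 0. Proof. by rewrite pnatr_eq0. Qed.

Lemma form_rt_pair i s j s' :
  <<rt (inl (i, s)), rt (inl (j, s'))>> = 2 *+ ((i == j) && (s != s')).
Proof.
rewrite /rt !(dotJDl, dotJDr, dotJZl, dotJZr) !form_ev a_inj b_inj.
rewrite a_neq_b (eq_sym (b i)) a_neq_b !mulr0n !mulr0 addr0 add0r sg_a.
case: (eqVneq i j) => [<-|_] /=; last by rewrite !mulr0n !mulr0 addr0.
rewrite !mulr1n.
have -> : (-1) ^+ s * (sg (b i) * om i) * ((-1) ^+ s' * (sg (b i) * om i) * sg (b i)) =
   ((-1) ^+ s' * (-1) ^+ s) * (sg (b i) * sg (b i)) * (sg (b i) * (om i * om i)) :> C by ring.
rewrite sg_sqr om_sqr mulrN sg_sqr mulr1.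
by case: s s' => -[] /=; rewrite ?expr0 ?expr1 ?mulr0n ?mulr1n; ring.
Qed.

Lemma form_rt_pu i s m : <<rt (inl (i, s)), rt (inr m)>> = 0.
Proof.
by rewrite /rt dotJDl dotJZl !form_ev a_neq_u b_neq_u !mulr0n mulr0 addr0.
Qed.

Lemma form_rt_uu m m' : <<rt (inr m), rt (inr m')>> = sg (u m) *+ (m == m').
Proof. by rewrite /rt form_ev u_inj. Qed.

Lemma form_dual k l : <<rt' k, rt l>> = (k == l)%:R.
Proof.
case: k l => [[i s]|m] [[j s']|m']; rewrite /rt' dotJZl.
- rewrite form_rt_pair.
  have -> : (inl (i, s) == inl (j, s') :> I) = (i == j) && (~~ s != s').
    by rewrite [LHS]/eq_op/= /eq_op/=; case: s s' => -[]; rewrite ?andbT ?andbF.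
  by case: (_ && _); rewrite ?mulr0// mulVf ?C2_neq0.
- by rewrite form_rt_pu mulr0.
- by rewrite dotJC ?Jc_tr// form_rt_pu mulr0.
- rewrite form_rt_uu mulrnAr sg_sqr.
  by have -> : (inr m == inr m' :> I) = (m == m') by [].
Qed.

Lemma S_ev s : S *m ev s = (if (s < d - p)%N then 1 else -1) *: ev s.
Proof.
apply/matrixP => i j; rewrite -colE !mxE; case: (eqVneq i s) => [->|] /=.
  by rewrite mulr1n ord1 eqxx mulr1; case: ifP => _; rewrite ?rmorph1 ?rmorphN1.
by move=> _; rewrite mulr0n rmorph0 mulr0.
Qed.

Definition us (m : 'I_M) : C := if (u m < d - p)%N then 1 else -1.
Definition ss (k : I) : C := if k is inr m then us m else 1.

Lemma S_rt k : S *m rt k = ss k *: rt (partner k).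
Proof.
case: frame => _ aL bR _.
case: k => [[i s]|m] /=; last by rewrite S_ev.
rewrite mulmxDr -scalemxAr !S_ev aL ltnNge bR/= !scale1r scaleN1r scalerN -scaleNr.
by congr (_ + _ *: _); case: s; rewrite ?expr0 ?expr1; ring.
Qed.

(** Both sides contract T with the inverse of the form, once in the standard basis and once in the
    dual pair [rt'], [rt]. *)
Lemma frame_sum (T : V -> V -> C^o) :
  (forall x, linear (T x)) -> (forall y, linear (T^~ y)) ->
  \sum_(s < d.+2) sg s * T (ev s) (ev s) = \sum_(k : I) T (rt' k) (rt k).
Proof.
move=> Tr Tl.
have TD x y z : T x (y + z) = T x y + T x z by have := Tr x 1 y z; rewrite !scale1r.
have T0 x : T x 0 = 0 by have := TD x 0 0; rewrite addr0 => /eqP;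
  rewrite -subr_eq0 opprD addNKr oppr_eq0 => /eqP.
have TZ x c y : T x (c *: y) = c * T x y by have := Tr x c y 0; rewrite !addr0 T0 addr0.
have DT x y z : T (x + y) z = T x z + T y z by have := Tl z 1 x y; rewrite !scale1r.
have OT z : T 0 z = 0 by have := DT 0 0 z; rewrite addr0 => /eqP;
  rewrite -subr_eq0 opprD addNKr oppr_eq0 => /eqP.
have ZT x c z : T (c *: x) z = c * T x z by have := Tl z c x 0; rewrite !addr0 OT addr0.
have X c c' x y : T (2^-1 *: (x + c *: y)) (x + c' *: y) =
    2^-1 * (T x x + c' * T x y + c * (T y x + c' * T y y)).
  by rewrite ZT DT ZT !TD !TZ.
case: (frame) => fb _ _ _.
rewrite (reindex frame_index) /=; last by apply: onW_bij.
rewrite big_sumType/= big_sumType/= [RHS]big_sumType; congr (_ + _).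
  rewrite -big_split/=.
  rewrite [RHS](eq_bigr (fun q => T (rt' (inl (q.1, q.2))) (rt (inl (q.1, q.2))))); last by case.
  rewrite -(pair_bigA _ (fun i s => T (rt' (inl (i, s))) (rt (inl (i, s))))).
  apply: eq_bigr => i _; rewrite big_bool /= !X sg_a expr0 expr1 !mul1r.
  move: (T (ev (a i)) (ev (a i))) (T (ev (a i)) (ev (b i))) (T (ev (b i)) (ev (a i)))
    (T (ev (b i)) (ev (b i))) => t1 t2 t3 t4.
  have -> : t4 = (sg (b i) * sg (b i)) * t4 by rewrite sg_sqr mul1r.
  have E : sg (b i) = - (om i * om i) by rewrite om_sqr opprK.
  have E2 : sg (b i) * om i * (sg (b i) * om i) = - sg (b i).
    by rewrite mulrACA sg_sqr mul1r om_sqr.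
  have h : 2 * 2^-1 = 1 :> C by rewrite mulfV ?C2_neq0.
  transitivity ((2 * 2^-1) * (t1 - (sg (b i) * om i * (sg (b i) * om i)) * ((sg (b i) * sg (b i)) * t4))).
    by rewrite h mul1r E2; ring.
  ring.
by apply: eq_bigr => m _; rewrite /rt' ZT.
Qed.

(* Sealed: conversion problems between its instances diverge when it unfolds. *)
Fact HH_subproof (k : I) : {A : 'M[C]_d.+2 | A = W (rt k) (rt' k)}.
Proof. by exists (W (rt k) (rt' k)). Qed.

Definition HH (k : I) : 'M[C]_d.+2 := sval (HH_subproof k).

Lemma HHE k : HH k = W (rt k) (rt' k). Proof. exact: (svalP (HH_subproof k)). Qed.

Definition Hc (i : 'I_N) : 'M[C]_d.+2 := HH (inl (i, false)).

Lemma HcHH i : Hc i = HH (inl (i, false)). Proof. by []. Qed.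

Lemma HH_inr m : HH (inr m) = 0.
Proof. by rewrite HHE /rt' bivecZr bivec_diag scaler0. Qed.

Lemma HH_inl i s : HH (inl (i, s)) = (-1) ^+ s *: Hc i.
Proof.
rewrite HcHH !HHE /rt' !bivecZr; case: s => /=; rewrite ?expr0 ?scale1r// expr1.
by rewrite bivecC scalerN scaleN1r.
Qed.

Lemma HcE i : Hc i = - (sg (b i) * om i) *: W (ev (a i)) (ev (b i)).
Proof.
rewrite HcHH !HHE /rt' /rt /= expr0 expr1 mul1r bivecZr !(bivecDl, bivecDr, bivecZl, bivecZr).
rewrite !bivec_diag !scaler0 addr0 add0r [W (ev (b i)) _]bivecC scalerN mulN1r scaleNr -opprD.
move: (W _ _) (sg _ * _) => w t.
by rewrite -scalerDl -!scaleNr scalerA; congr (_ *: _); field; rewrite ?C2_neq0.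
Qed.

(** The pairs whose bivector is a root vector. Opposite indices give Cartan elements instead, and
    two killed vectors give elements of the Lie algebra of H. *)
Definition root_pair (k l : I) : bool :=
  match k, l with inr _, inr _ => false | _, _ => (k != l) && (k != partner l) end.

Lemma root_pairP k l : root_pair k l -> (k != l) /\ (k != partner l).
Proof. by case: k l => [?|?] [?|?] //= /andP[]. Qed.

Lemma rt'_opp k : exists c : C, rt' k = c *: rt (partner k).
Proof. by case: k => [[i s]|m]; eexists. Qed.

Lemma bivec_rt'_opp k : W (rt' k) (rt (partner k)) = 0.
Proof. by have [c ->] := rt'_opp k; rewrite bivecZl bivec_diag scaler0. Qed.

Lemma rt'_rt (k l : I) : W (rt' k) (rt' l) *m rt k = (k == l)%:R *: rt' k - rt' l.
Proof. by rewrite bivec_apply !form_dual eqxx scale1r [l == k]eq_sym. Qed.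

Lemma rt'_rtr (k l : I) : W (rt' k) (rt' l) *m rt l = rt' k - (k == l)%:R *: rt' l.
Proof. by rewrite bivec_apply !form_dual eqxx scale1r. Qed.

(** This is coth y at q = exp(2y). *)
Definition cth (q : C) : C := (q + 1) / (q - 1).

Lemma cthV q : q != 0 -> cth q^-1 = - cth q.
Proof.
(* At q = 1 both sides are 0, because the inverse of 0 is 0. *)
move=> q0; rewrite /cth; have [->|q1] := eqVneq q 1; first by rewrite invr1 subrr invr0 !mulr0 oppr0.
have q1' : q - 1 != 0 by rewrite subr_eq0.
have q1'' : q^-1 - 1 != 0 by rewrite subr_eq0 invr_eq1.
have q3 : 1 - q != 0 by rewrite -oppr_eq0 opprB.
field; rewrite q0 q1' /=; apply/eqP => E; move/eqP: q3; apply; rewrite -[RHS]E; ring.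
Qed.

Lemma Sc_bivec y z : S *m W y z *m S = W (S *m y) (S *m z).
Proof. exact: (bivec_conj _ _ (Sc_isom d p) (Sc_sqr d p)). Qed.

Lemma Sc_conjK (X : 'M[C]_d.+2) : S *m (S *m X *m S) *m S = X.
Proof. by rewrite !mulmxA Sc_sqr mul1mx -mulmxA Sc_sqr mulmx1. Qed.

Lemma root_pair_partner k l : root_pair k l -> root_pair (partner k) (partner l).
Proof.
move=> kl; have [H1 H2] := root_pairP kl.
have : partner k != partner l by rewrite (inj_eq (inv_inj partnerK)).
have : partner k != partner (partner l) by rewrite (inj_eq (inv_inj partnerK)).
by case: k l kl H1 H2 => [[i s]|m] [[j s']|m'] //= _ _ _ -> ->.
Qed.

#[local] Opaque bivec dotJ Jc Sc ev.

(** The bracket of the dual root vector with the root vector is a Cartan element: the one that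
    represents, through B, twice the weight of [rt k /\ rt l]. *)
Lemma bracket_root k l : k != l ->
  W (rt' k) (rt' l) *m W (rt k) (rt l) - W (rt k) (rt l) *m W (rt' k) (rt' l) = HH k + HH l.
Proof.
move=> kNl; rewrite skew_bivec; last by apply: bivec_skew; exact: Jc_tr.
rewrite rt'_rt rt'_rtr (negPf kNl) !scale0r sub0r subr0.
by rewrite bivecNl !HHE [LHS]addrC.
Qed.

(** Up to scalars both [rt' k] and [S *m rt k] are [rt (partner k)], so the two bivectors are
    proportional and commute. *)
Lemma bracket_sroot k l : k != partner l ->
  W (rt' k) (rt' l) *m W (S *m rt k) (S *m rt l) -
  W (S *m rt k) (S *m rt l) *m W (rt' k) (rt' l) = 0.
Proof.
move=> kNol; rewrite !S_rt bivecZl bivecZr.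
rewrite -!scalemxAr.
rewrite -!scalemxAl.
rewrite -!scalerBr.
rewrite skew_bivec; last by apply: bivec_skew; exact: Jc_tr.
have -> : W (rt' k) (rt' l) *m rt (partner k) = - (k == partner k)%:R *: rt' l.
  rewrite bivec_apply !form_dual.
  have -> : (l == partner k) = false by rewrite -[l]partnerK (inj_eq (inv_inj partnerK)) eq_sym (negPf kNol).
  by rewrite scale0r sub0r scaleNr.
have -> : W (rt' k) (rt' l) *m rt (partner l) = (l == partner l)%:R *: rt' k.
  by rewrite bivec_apply !form_dual (negPf kNol) scale0r subr0.
rewrite bivecZl bivecZr [W (rt (partner k)) _]bivecC !bivec_rt'_opp.
by rewrite oppr0 !scaler0 addr0 !scaler0.
Qed.

Section Core.
Variables (x x' : 'M[C]_d.+2) (e : I -> C).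
Variables (delta : 'Hom('M[C]_d.+2, C^o)) (beta : 'Hom('M[C]_d.+2, 'Hom('M[C]_d.+2, C^o))).
Hypotheses (xJ : x^T *m J *m x = J) (xx' : x *m x' = 1%:M).
Hypothesis xe : forall k, x *m rt k = e k *: rt k.
Hypothesis ee : forall k, e k * e (partner k) = 1.
Hypothesis reg : forall k l, root_pair k l -> (e k * e l) ^+ 2 != 1.
Hypothesis ax : casimir_axioms p x x' delta beta.

Lemma e_neq0 k : e k != 0.
Proof. by apply/eqP => E; have := ee k; rewrite E mul0r => /esym/eqP; rewrite oner_eq0. Qed.

Definition cterm k l : C := beta (W (rt' k) (rt' l)) (W (rt k) (rt l)).

(** [A] is the dual root vector, [E'] is sigma E and [B] the bracket [A, E]. The equations [e1] and
    [e2] for the two second derivatives have determinant q^-1 - q. *)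
Lemma casimir_solve (A E E' B : 'M[C]_d.+2) q :
  isskew J A -> isskew J E -> isskew J E' -> S *m E *m S = E' ->
  A *m E - E *m A = B -> A *m E' - E' *m A = 0 ->
  x *m E *m x' = q *: E -> x *m E' *m x' = q^-1 *: E' -> q != 0 -> q ^+ 2 != 1 ->
  beta A E = - (q ^+ 2 - 1)^-1 * delta B.
Proof.
move=> sA sE sE' SE brE brE' xE xE' q0 q2; case: ax => _ axI axO.
have SE' : S *m E' *m S = E by rewrite -SE Sc_conjK.
have sU : isskew J (E + E') by exact: skewD.
have SU : S *m (E + E') *m S = E + E' by rewrite mulmxDr mulmxDl SE SE' addrC.
have e1 : beta A E + beta A E' = delta B.
  have := axO _ _ sA (conj sU SU); rewrite linearD/= => ->; congr (delta _).
  by rewrite mulmxDr mulmxDl opprD addrACA brE brE' addr0.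
have e2 : q * beta A E + q^-1 * beta A E' = 0.
  have := axI _ _ sA (conj sU SU).
  by rewrite mulmxDr mulmxDl xE xE' linearD !linearZ.
have e3 : beta A E' = - q ^+ 2 * beta A E.
  move/(congr1 ( *%R q)) : e2; rewrite mulr0 mulrDr !mulrA divff// mul1r => /eqP.
  by rewrite addrC addr_eq0 => /eqP ->; rewrite expr2 mulNr.
have q21 : q ^+ 2 - 1 != 0 by rewrite subr_eq0.
apply: (mulfI q21); rewrite mulrA mulrN mulfV// mulN1r -e1 e3.
by move: (beta A E) => t; ring.
Qed.

Lemma e_opp k : e (partner k) = (e k)^-1.
Proof. by apply: (mulfI (e_neq0 k)); rewrite ee divff ?e_neq0. Qed.

Lemma cterm_root k l : root_pair k l ->
  cterm k l = - ((e k * e l) ^+ 2 - 1)^-1 * delta (HH k + HH l).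
Proof.
move=> kl; have q2 := reg kl; have [kNl kNol] := root_pairP kl.
apply: (casimir_solve (E' := W (S *m rt k) (S *m rt l))).
- by apply: bivec_skew; exact: Jc_tr.
- by apply: bivec_skew; exact: Jc_tr.
- by apply: bivec_skew; exact: Jc_tr.
- exact: Sc_bivec.
- exact: bracket_root.
- exact: bracket_sroot.
- by rewrite (bivec_conj _ _ xJ xx') !xe bivecZl bivecZr scalerA.
- rewrite (bivec_conj _ _ xJ xx') !S_rt -!scalemxAr !xe !(bivecZl, bivecZr) !scalerA !e_opp.
  by congr (_ *: _); rewrite invfM; ring.
- by rewrite mulf_neq0 ?e_neq0.
- exact: q2.
Qed.

(** The killed vectors lie on one side of [Smx], so the two equal signs [us] cancel and the first
    bivector lies in the Lie algebra of H. *)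
Lemma cterm_unp m m' : cterm (inr m) (inr m') = 0.
Proof.
case: ax => axL _ _; apply: axL; last by apply: bivec_skew; exact: Jc_tr.
split; first by apply: bivec_skew; exact: Jc_tr.
rewrite Sc_bivec /rt' -!scalemxAr !S_rt /= /us.
rewrite !(bivecZl, bivecZr) !scalerA.
case: frame => _ _ _ [H|H].
  by rewrite !H !mulr1.
by rewrite ![(_ < d - p)%N]ltnNge !H /= !mulrN1; congr (_ *: _); ring.
Qed.

Lemma cterm_diag k : cterm k k = 0.
Proof. by rewrite /cterm !bivec_diag !linear0. Qed.

(** For s = false the bivector is 2 Hc and its dual is -Hc/2; both change sign with s. *)
Lemma cterm_opp i s : cterm (inl (i, s)) (inl (i, ~~ s)) = - beta (Hc i) (Hc i).
Proof.
have rtE s' : rt' (inl (i, s')) = 2^-1 *: rt (inl (i, ~~ s')) by [].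
have E1 : W (rt (inl (i, s))) (rt (inl (i, ~~ s))) = ((-1) ^+ s * 2) *: Hc i.
  rewrite mulrC -scalerA -(HH_inl i s) HHE rtE bivecZr scalerA mulfV ?C2_neq0//.
  by rewrite scale1r.
rewrite /cterm !rtE negbK bivecZl bivecZr [W (rt (inl (i, ~~ s))) _]bivecC E1.
rewrite !(linearZ, linearN)/= !(scale_lfunE, opp_lfunE).
move: (beta (Hc i) (Hc i)) => t; rewrite /GRing.scale/=.
by case: s {E1}; rewrite ?expr0 ?expr1; field; rewrite ?C2_neq0.
Qed.

(** The partner pair has eigenvalue q^-1 and the opposite bracket, and 1/(Q - 1) - 1/(Q^-1 - 1) = (Q
    + 1)/(Q - 1) for Q = q^2. *)
Lemma cterm_root_opp k l : root_pair k l ->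
  cterm k l + cterm (partner k) (partner l) = - (cth ((e k * e l) ^+ 2) * delta (HH k + HH l)).
Proof.
move=> kl.
have kl' := root_pair_partner kl.
rewrite !cterm_root//.
have HHo j : HH (partner j) = - HH j.
  case: j => [[i s]|m] /=; last by rewrite HH_inr oppr0.
  by rewrite !HH_inl -scaleNr; case: s; rewrite /= ?expr0 ?expr1 ?opprK.
rewrite !HHo -opprD linearN /=.
have H j : e (partner j) = (e j)^-1.
  by apply: (mulfI (e_neq0 j)); rewrite ee divff ?e_neq0.
rewrite !H -invfM exprVn /cth.
have q2 := reg kl; set q := (_ ^+ 2) in q2 *.
have q0 : q != 0 by rewrite expf_neq0// mulf_neq0 ?e_neq0.
have q1 : q - 1 != 0 by rewrite subr_eq0.
have q1' : q^-1 - 1 != 0 by rewrite subr_eq0 invr_eq1.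
move: (delta _) => D.
have -> : (q^-1 - 1)^-1 = - q / (q - 1).
  apply: (mulfI q1'); rewrite mulfV// mulrA mulrN mulrBl mulVf// mul1r opprB mulfV//.
by move: (q - 1)^-1 => w; ring.
Qed.

Definition gshort i : C := cth (e (inl (i, false)) ^+ 2) * delta (Hc i).
Definition glong (i j : 'I_N) (s : bool) : C :=
  cth ((e (inl (i, false)) * e (inl (j, s))) ^+ 2) * delta (Hc i + (-1) ^+ s *: Hc j).

Lemma cterm_sym k l : cterm k l = cterm l k.
Proof.
rewrite /cterm [W (rt' k) _]bivecC [W (rt k) _]bivecC.
by move: (W (rt' l) _) (W (rt l) _) => A B; rewrite !linearN/= opp_lfunE opprK.
Qed.

Lemma core_sum :
  - 4^-1 * \sum_k \sum_l cterm k l =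
  2^-1 * \sum_i beta (Hc i) (Hc i) + (M%:R / 2) * \sum_i gshort i +
  2^-1 * \sum_(i : 'I_N) \sum_(j : 'I_N | (i < j)%N) (glong i j false + glong i j true).
Proof.
apply: root_sum.
- exact: cterm_diag.
- exact: cterm_sym.
- exact: cterm_unp.
- exact: cterm_opp.
- move=> i j s ij; rewrite /glong -HH_inl.
  have rp : root_pair (inl (i, false)) (inl (j, s)).
    by rewrite /=; apply/andP; split; apply/eqP => -[] E; rewrite E eqxx in ij.
  rewrite HcHH; exact: (cterm_root_opp rp).
- move=> i m.
  have rp : root_pair (inl (i, false)) (inr m) by [].
  (* A killed vector is its own partner, so it leaves the square of the eigenvalue of a short root
     vector equal to that of e_i. *)
  have em : e (inr m) ^+ 2 = 1 by rewrite expr2; exact: (ee (inr m)).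
  have := cterm_root_opp rp; rewrite /gshort exprMn em mulr1 HH_inr addr0 HcHH.
  exact.
Qed.

End Core.

End Frame.

(** * Toral elements and the Casimir tensor *)

Section ComplexExp.
Context {R : realType}.
Implicit Types x y : R[i].

Lemma cexpD x y : cexp (x + y) = cexp x * cexp y.
Proof.
apply: complex_ext; rewrite ?(cReM, cImM) /cexp /= ?cReD ?cImD ?expRD ?cosD ?sinD; ring.
Qed.

Lemma cexp0 : cexp 0 = 1 :> R[i].
Proof. by rewrite /cexp /= expR0 cos0 sin0 mul1r mulr0. Qed.

Lemma cexpN x : cexp (- x) * cexp x = 1.
Proof. by rewrite -cexpD addNr cexp0. Qed.

Lemma cexp_neq0 x : cexp x != 0.
Proof. by apply/eqP => E; have := cexpN x; rewrite E mulr0 => /esym/eqP; rewrite oner_eq0. Qed.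

Lemma cexpNV x : cexp (- x) = (cexp x)^-1.
Proof. by apply: (mulIf (cexp_neq0 x)); rewrite cexpN mulVf ?cexp_neq0. Qed.

Lemma cexp2 x : cexp x ^+ 2 = cexp (2 * x).
Proof. by rewrite expr2 -cexpD mulr2n mulrDl mul1r. Qed.

Lemma cexp_real (r : R) : cexp r%:C = (expR r)%:C.
Proof. by apply: complex_ext; rewrite /cexp /= ?cos0 ?sin0 ?mulr1 ?mulr0. Qed.

Lemma cexp_imag (r : R) : cexp ('i%C * r%:C) = cos r +i* sin r.
Proof.
have -> : 'i%C * r%:C = 0 +i* r :> R[i].
  by apply: complex_ext; rewrite /= ?mul0r ?mul1r ?mulr0 ?subr0 ?add0r.
by rewrite /cexp /= expR0 !mul1r.
Qed.

End ComplexExp.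

(** * The Casimir tensor in terms of the generators F *)

Section CasimirTensor.
Context {R : realType} {d : nat}.
Local Notation C := R[i].
Local Notation J := (Jc d.+1 : 'M[C]_d.+2).
Local Notation W := (bivec J).

Lemma mxC_Fmx s t : mxC (Fmx s t) = W (ev s) (ev t) :> 'M[C]_d.+2.
Proof.
have H x y : ev x *m (ev y)^T *m J = \matrix_(i, j) (J y j *+ (i == x)) :> 'M[C]_d.+2.
  apply/matrixP => i j; rewrite /ev trmx_delta -mulmxA -rowE !mxE big_ord1 !mxE.
  by rewrite eqxx andbT; case: (_ == _); rewrite ?mul1r ?mul0r.
rewrite /bivec !H; apply/matrixP => i j; rewrite !mxE.
by rewrite rmorphB !rmorphMn.
Qed.

Lemma Fmx_alg s t : alg (Fmx s t : 'M[R]_d.+2).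
Proof.
apply: mxC_inj; rewrite mxC0 mxCD !mxC_mul mxC_tr mxC_Fmx.
by apply: bivec_skew; exact: Jc_tr.
Qed.

Lemma Fmx_trace s t (Y : 'M[R]_d.+2) : alg Y ->
  Bform (Fmx s t) Y = (eta d.+1 *m Y) t s *+ 2.
Proof.
move=> aY; have anti : (eta d.+1 *m Y) s t = - (eta d.+1 *m Y) t s.
  have /matrixP/(_ s t) := aY; rewrite !mxE => /eqP; rewrite addrC addr_eq0 => /eqP ->.
  by congr (- _); apply: eq_bigr => k _; rewrite -[in RHS](eta_tr d.+1) !mxE mulrC.
rewrite mulr2n -[X in _ + X]opprK -anti /Bform /mxtrace.
have E x y : \sum_i \sum_j (eta d.+1 y j *+ (i == x)) * Y j i = (eta d.+1 *m Y) y x :> R.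
  rewrite (bigD1 x)//= [X in _ + X]big1 ?addr0.
    by rewrite mxE; apply: eq_bigr => j _; rewrite eqxx mulr1n.
  by move=> i /negPf ->; apply: big1 => j _; rewrite mulr0n mul0r.
rewrite -!E -sumrB; apply: eq_bigr => i _; rewrite mxE -sumrB; apply: eq_bigr => j _.
by rewrite mxE mulrBl.
Qed.

Lemma dual_bases_expand (X Y : (\dim (so_conf d : {vspace 'M[R]_d.+2})).-tuple 'M[R]_d.+2) V :
  dual_bases X Y -> alg V ->
  V = \sum_i Bform V (tnth Y i) *: tnth X i /\ V = \sum_i Bform V (tnth X i) *: tnth Y i.
Proof.
move=> [bX bY XY] /algP aV.
have BDl I (r : seq I) (c : I -> R) (A : I -> 'M[R]_d.+2) B :
    Bform (\sum_(i <- r) c i *: A i) B = \sum_(i <- r) c i * Bform (A i) B.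
  rewrite /Bform mulmx_suml linear_sum; apply: eq_bigr => i _.
  by rewrite -scalemxAl linearZ.
have BC (A B : 'M[R]_d.+2) : Bform A B = Bform B A by rewrite /Bform mxtrace_mulC.
have sumdelta m (c : 'I_m -> R) j : \sum_i c i * (i == j)%:R = c j.
  rewrite (bigD1 j)//= eqxx mulr1 big1 ?addr0// => i /negPf ->; by rewrite mulr0.
split.
  rewrite {1}(coord_basis bX aV); apply: eq_bigr => i _; rewrite -tnth_nth; congr (_ *: _).
  rewrite [in RHS](coord_basis bX aV).
  under [in RHS]eq_bigr do rewrite -tnth_nth.
  by rewrite BDl; under eq_bigr do rewrite XY; rewrite sumdelta.
rewrite {1}(coord_basis bY aV); apply: eq_bigr => i _; rewrite -tnth_nth; congr (_ *: _).
rewrite [in RHS](coord_basis bY aV).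
under [in RHS]eq_bigr do rewrite -tnth_nth.
by rewrite BDl; under eq_bigr do rewrite BC XY eq_sym; rewrite sumdelta.
Qed.

Definition etas (s : 'I_d.+2) : R := if s == ord_max then -1 else 1.

Lemma sgE s : sg s = (etas s)%:C.
Proof. by rewrite /sg /etas; case: ifP => _; rewrite ?rmorphN ?rmorph1. Qed.

Lemma etas_mul (A : 'M[R]_d.+2) s t : (eta d.+1 *m A) s t = etas s * A s t.
Proof.
by rewrite /Defs.eta mul_diag_mx !mxE.
Qed.

Lemma etas_sqr s : etas s * etas s = 1.
Proof. by rewrite /etas; case: ifP; rewrite ?mulrNN mulr1. Qed.

(** The completeness relation of the F_st for B, summed over ordered pairs: the norm -2 eta_s eta_t
    and the double count make -4. *)
Lemma Fmx_casimir_trace (A B : 'M[R]_d.+2) : alg A -> alg B ->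
  \sum_s \sum_t etas s * etas t * (Bform (Fmx s t) A * Bform (Fmx s t) B) = - 4 * Bform A B.
Proof.
move=> aA aB.
have anti s t : etas t * B t s = - (etas s * B s t).
  have /matrixP/(_ s t) := aB; rewrite !mxE => /eqP; rewrite addr_eq0 => /eqP E.
  rewrite -!etas_mul [in RHS]mxE -E mxE; apply: eq_bigr => k _.
  by rewrite -[in LHS](eta_tr d.+1) !mxE mulrC.
rewrite [in RHS]/Bform [in RHS]/mxtrace exchange_big mulr_sumr; apply: eq_bigr => t _.
rewrite [in RHS]mxE mulr_sumr; apply: eq_bigr => s _.
rewrite !Fmx_trace// !etas_mul anti.
have h := etas_sqr s; have h' := etas_sqr t.
transitivity (- 4 * (etas t * etas t) * (etas s * etas s) * (A t s * B s t)); first by ring.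
by rewrite h h' !mulr1.
Qed.

(** Expanding one copy of F_st on [X] and the other on [Y] reduces the double sum, by
    [Fmx_casimir_trace], to the pairing of the dual bases. *)
Lemma casimir_tensor X Y (beta : 'Hom('M[C]_d.+2, 'Hom('M[C]_d.+2, C^o))) :
  dual_bases X Y ->
  \sum_i beta (mxC (tnth X i)) (mxC (tnth Y i)) =
  - 4^-1 * \sum_s \sum_t sg s * (sg t * beta (W (ev s) (ev t)) (W (ev s) (ev t))).
Proof.
move=> dXY.
have aX i : alg (tnth X i).
  by case: dXY => bX _ _; apply/algP; have := memv_span (mem_tnth i X); rewrite (span_basis bX).
have aY i : alg (tnth Y i).
  by case: dXY => _ bY _; apply/algP; have := memv_span (mem_tnth i Y); rewrite (span_basis bY).
have E s t : beta (W (ev s) (ev t)) (W (ev s) (ev t)) =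
   \sum_i \sum_j (Bform (Fmx s t) (tnth Y i) * Bform (Fmx s t) (tnth X j))%:C *
     beta (mxC (tnth X i)) (mxC (tnth Y j)).
  rewrite -!mxC_Fmx; have [E1 E2] := dual_bases_expand dXY (Fmx_alg s t).
  have mxC_sum m (c : 'I_m -> R) (A : 'I_m -> 'M[R]_d.+2) :
      mxC (\sum_i c i *: A i) = \sum_i (c i)%:C *: mxC (A i).
    rewrite (big_morph _ (@mxCD R d.+2 d.+2) (mxC0 d.+2 d.+2)).
    by apply: eq_bigr => i _; rewrite mxCZ.
  apply: (etrans (congr2 (fun A B => beta (mxC A) (mxC B)) E1 E2)).
  rewrite !mxC_sum linear_sum/= [RHS]exchange_big/=; apply: eq_bigr => j _.
  rewrite !linearZ/= linear_sum/= sum_lfunE scaler_sumr; apply: eq_bigr => i _.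
  rewrite linearZ/= scale_lfunE rmorphM/=; move: (beta _ _) => t0.
  by rewrite /GRing.scale/=; ring.
under [X in _ * X]eq_bigr => s _.
  under eq_bigr => t _.
    rewrite E !mulr_sumr; under eq_bigr do rewrite !mulr_sumr; over.
  rewrite exchange_big/=; under eq_bigr do rewrite exchange_big/=; over.
rewrite exchange_big/=.
under [X in _ * X]eq_bigr do rewrite exchange_big/=.
rewrite mulr_sumr; apply: eq_bigr => i _; rewrite mulr_sumr.
have H j : \sum_s \sum_t sg s * (sg t * ((Bform (Fmx s t) (tnth Y i) *
    Bform (Fmx s t) (tnth X j))%:C * beta (mxC (tnth X i)) (mxC (tnth Y j)))) =
   - 4 * (j == i)%:R * beta (mxC (tnth X i)) (mxC (tnth Y j)).
  transitivity ((\sum_s \sum_t etas s * etas t * (Bform (Fmx s t) (tnth Y i) *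
    Bform (Fmx s t) (tnth X j)))%:C * beta (mxC (tnth X i)) (mxC (tnth Y j))).
    rewrite rmorph_sum mulr_suml; apply: eq_bigr => s _.
    rewrite rmorph_sum mulr_suml; apply: eq_bigr => t _.
    by rewrite !sgE [in RHS]rmorphM [in RHS]rmorphM/= !mulrA.
  rewrite Fmx_casimir_trace//; congr (_ * _).
  rewrite /Bform mxtrace_mulC -/(Bform _ _); case: dXY => _ _ ->.
  by rewrite rmorphM rmorphN !rmorph_nat.
under [RHS]eq_bigr do rewrite H.
rewrite (bigD1 i)//= [X in _ + X]big1 ?addr0.
  by rewrite eqxx mulr1; move: (beta _ _) => t0; field; rewrite ?pnatr_eq0.
by move=> j /negPf ->; rewrite mulr0 mul0r mulr0.
Qed.

End CasimirTensor.

(** * Eigenvalues of exp(Z) and regularity *)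

Section CartanFrame.
Context {R : realType} {d p N M : nat}.
Variables (a b : 'I_N -> 'I_d.+2) (u : 'I_M -> 'I_d.+2).
Hypothesis frame : is_frame (p := p) a b u.
Local Notation C := R[i].
Local Notation J := (Jc d.+1 : 'M[C]_d.+2).
Local Notation S := (Sc d p : 'M[C]_d.+2).
Local Notation W := (bivec J).
Local Notation I := ('I_N * bool + 'I_M)%type.
Local Notation rt := (rt (R := R) a b u).
Local Notation rt' := (rt' (R := R) a b u).
Local Notation Hc := (Hc (R := R) a b u).

(** [frame_sum] changes the basis in one slot of the bivectors at a time. *)
Lemma casimir_frame_sum X Y (beta : 'Hom('M[C]_d.+2, 'Hom('M[C]_d.+2, C^o))) :
  dual_bases X Y ->
  \sum_i beta (mxC (tnth X i)) (mxC (tnth Y i)) =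
  - 4^-1 * \sum_k \sum_l cterm a b u beta k l.
Proof.
move=> dXY; apply: (etrans (casimir_tensor beta dXY)).
apply: (congr1 ( *%R (- 4^-1))).
have E t : \sum_s sg s * beta (W (ev s) (ev t)) (W (ev s) (ev t)) =
   \sum_k beta (W (rt' k) (ev t)) (W (rt k) (ev t)).
  apply: (frame_sum frame (T := fun x y => beta (W x (ev t)) (W y (ev t)))) => z.
    by move=> c x y; rewrite bivecDl bivecZl linearP.
  by move=> c x y; rewrite bivecDl bivecZl linearP add_lfunE scale_lfunE.
rewrite exchange_big/=.
under eq_bigr => t _.
  under eq_bigr do rewrite mulrCA.
  rewrite -mulr_sumr E mulr_sumr; over.
rewrite exchange_big/=; apply: eq_bigr => k _.
apply: (frame_sum frame (T := fun x y => beta (W (rt' k) x) (W (rt k) y))) => z.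
  by move=> c x y; rewrite bivecDr bivecZr linearP.
by move=> c x y; rewrite bivecDr bivecZr linearP add_lfunE scale_lfunE.
Qed.

Definition wt (i : 'I_N) (k : I) : C := if k is inl (j, s) then (-1) ^+ s *+ (i == j) else 0.

Lemma Hc_rt i k : Hc i *m rt k = wt i k *: rt k.
Proof.
rewrite HcHH HHE /rt' bivecZr -scalemxAl bivec_apply -/rt.
case: k => [[j s]|m].
  rewrite !(form_rt_pair frame) /=; case: (eqVneq i j) => [<-|_] /=; last first.
    by rewrite !mulr0n !scale0r subr0 scaler0.
  rewrite mulr1n; case: s => /=.
    by rewrite mulr0n scale0r sub0r scalerN scalerA mulVf ?C2_neq0// scale1r expr1 scaleN1r.
  by rewrite mulr0n scale0r subr0 scalerA mulVf ?C2_neq0// scale1r expr0 scale1r.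
by rewrite !(form_rt_pu frame) !scale0r subr0 scaler0.
Qed.

Lemma wt_partner i k : wt i (partner k) = - wt i k.
Proof.
case: k => [[j s]|m] /=; last by rewrite oppr0.
by rewrite -mulNrn; case: s; rewrite /= ?expr0 ?expr1 ?opprK.
Qed.

Lemma root_pair_wt k l : root_pair k l -> exists i, wt i k + wt i l != 0.
Proof.
have h (s : bool) : (-1) ^+ s != 0 :> C by rewrite signr_eq0.
case: k l => [[i s]|m] [[j s']|m'] //= H.
- exists i; rewrite eqxx mulr1n.
  case: (eqVneq i j) => [E|_]; last by rewrite mulr0n addr0.
  by subst j; move: H; case: s s' => -[] /andP[/eqP A /eqP B]; exfalso; (apply: A + apply: B).
- by exists i; rewrite eqxx mulr1n addr0.
- by exists j; rewrite eqxx mulr1n add0r.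
Qed.

Lemma rt_neq0 k : rt k != 0.
Proof.
apply/eqP => E; have := form_dual (R := R) frame k k; rewrite E eqxx.
rewrite -(scale0r 0) /dotJ -scalemxAr mxE mul0r => /esym/eqP.
by rewrite oner_eq0.
Qed.

Lemma bivec_rt_neq0 k l : k != l -> W (rt k) (rt l) != 0.
Proof.
move=> kl; apply/eqP => E; have := congr1 (mulmx^~ (rt' k)) E.
rewrite mul0mx bivec_apply dotJC ?Jc_tr// (form_dual frame) (negPf kl) scale0r sub0r.
rewrite dotJC ?Jc_tr// (form_dual frame) eqxx scale1r => /eqP; rewrite oppr_eq0.
by rewrite (negPf (rt_neq0 l)).
Qed.

Section Element.
Variables (z : 'I_N -> R).
Definition Zel : 'M[R]_d.+2 := \sum_i z i *: Fmx (a i) (b i).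
Definition eigv (k : I) : C :=
  if k is inl (i, s) then cexp ((-1) ^+ s * (om b i * (z i)%:C)) else 1.
Local Notation e := eigv.

Lemma eigv_partner k : e k * e (partner k) = 1.
Proof.
case: k => [[i s]|m] /=; last by rewrite mulr1.
by rewrite -cexpD; case: s; rewrite /= ?expr0 ?expr1 -mulrDl ?addNr ?subrr mul0r cexp0.
Qed.

Lemma evC s : mxC (delta_mx s 0) = ev s :> 'cV[C]_d.+2.
Proof. by rewrite /mxC map_delta_mx. Qed.

Lemma Fmx_ev s t r : mxC (Fmx s t) *m ev r =
  (sg t *+ (t == r)) *: ev s - (sg s *+ (s == r)) *: ev t :> 'cV[C]_d.+2.
Proof. by rewrite mxC_Fmx bivec_apply !form_ev. Qed.

Lemma Fmx_delta s t r : Fmx s t *m delta_mx r 0 =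
  (etas t *+ (t == r)) *: delta_mx s 0 - (etas s *+ (s == r)) *: delta_mx t 0 :> 'cV[R]_d.+2.
Proof.
apply: mxC_inj; rewrite mxC_mul mxCB !mxCZ !evC Fmx_ev !sgE.
by rewrite !rmorphMn.
Qed.

Lemma etas_a i : etas (a i) = 1 :> R.
Proof. by have := sg_a (R := R) frame i; rewrite sgE => -[]. Qed.

Lemma Zel_a i : Zel *m delta_mx (a i) 0 = - z i *: delta_mx (b i) 0 :> 'cV[R]_d.+2.
Proof.
rewrite /Zel mulmx_suml (bigD1 i)//= big1 ?addr0 => [|j ji].
  rewrite -scalemxAl Fmx_delta eqxx mulr1n [b i == _]eq_sym (a_neq_b frame) mulr0n scale0r sub0r.
  by rewrite etas_a scale1r scalerN scaleNr.
rewrite -scalemxAl Fmx_delta (a_inj frame) (negPf ji) [b j == _]eq_sym (a_neq_b frame).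
by rewrite !mulr0n !scale0r subr0 scaler0.
Qed.

Lemma Zel_b i : Zel *m delta_mx (b i) 0 = (etas (b i) * z i) *: delta_mx (a i) 0 :> 'cV[R]_d.+2.
Proof.
rewrite /Zel mulmx_suml (bigD1 i)//= big1 ?addr0 => [|j ji].
  rewrite -scalemxAl Fmx_delta eqxx mulr1n (a_neq_b frame) mulr0n scale0r subr0.
  by rewrite scalerA mulrC.
rewrite -scalemxAl Fmx_delta (b_inj frame) (negPf ji) (a_neq_b frame).
by rewrite !mulr0n !scale0r subr0 scaler0.
Qed.

Lemma Zel_u m : Zel *m delta_mx (u m) 0 = 0 :> 'cV[R]_d.+2.
Proof.
rewrite /Zel mulmx_suml big1// => j _.
by rewrite -scalemxAl Fmx_delta (a_neq_u frame) (b_neq_u frame) !mulr0n !scale0r subr0 scaler0.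
Qed.

Lemma Zel_alg : alg Zel.
Proof.
rewrite /Zel; elim/big_ind: _ => //.
- by rewrite /alg/= trmx0 mul0mx mulmx0 addr0.
- by move=> X Y; exact: algD.
- by move=> i _; apply: algZ; exact: Fmx_alg.
Qed.

Lemma exp_rt k : mxC (expmx Zel) *m rt k = e k *: rt k.
Proof.
case: k => [[i s]|m]; last first.
  rewrite /rt /eigv scale1r -evC -mxC_mul; congr mxC.
  by rewrite (@expmx_eigenvector _ _ _ _ _ 0) ?expR0 ?scale1r// Zel_u scale0r.
rewrite /rt /eigv mulmxDr -scalemxAr -!evC -!mxC_mul.
(* A boost preserves two real isotropic lines; a rotation, the second case, has complex eigenvectors
   and is evaluated through cos and sin. *)
have [bi|bi] := eqVneq (b i) ord_max.
  have Ea := Zel_a i; have Eb := Zel_b i.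
  have eb : etas (b i) = -1 :> R by rewrite /etas bi eqxx.
  have sb : sg (b i) = -1 :> C by rewrite sgE eb rmorphN rmorph1.
  have ob : om b i = 1 :> C by rewrite /om bi eqxx.
  rewrite eb mulN1r in Eb.
  have H (r : bool) : expmx Zel *m (delta_mx (a i) 0 - (-1) ^+ r *: delta_mx (b i) 0) =
      expR ((-1) ^+ r * z i) *: (delta_mx (a i) 0 - (-1) ^+ r *: delta_mx (b i) 0) :> 'cV[R]_d.+2.
    apply: expmx_eigenvector; rewrite mulmxBr -scalemxAr Ea Eb scalerBr !scalerA.
    case: r; rewrite ?expr0 ?expr1 ?mulN1r ?mul1r ?mulrN1 ?opprK ?scaleNr ?opprK addrC //.
    by rewrite mulr1.
  have := congr1 mxC (H s); rewrite mulmxBr -scalemxAr mxCB !mxCZ mxCB mxCZ sb ob !mulr1 mulrN1.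
  have -> : ((-1) ^+ s)%:C = (-1) ^+ s :> C by rewrite rmorphXn rmorphN rmorph1.
  rewrite !scaleNr => ->; congr (_ *: _).
  by rewrite -cexp_real rmorphM rmorphXn rmorphN rmorph1 mul1r.
have Ea := Zel_a i; have Eb := Zel_b i.
have eb : etas (b i) = 1 :> R by rewrite /etas (negPf bi).
have sb : sg (b i) = 1 :> C by rewrite sgE eb rmorph1.
have ob : om b i = 'i%C :> C by rewrite /om (negPf bi).
rewrite eb mul1r in Eb.
have Xa : expmx Zel *m delta_mx (a i) 0 =
    cos (z i) *: delta_mx (a i) 0 - sin (z i) *: delta_mx (b i) 0 :> 'cV[R]_d.+2.
  by rewrite (expmx_rotation Ea) ?opprK// cosN sinN scaleNr.
have Xb : expmx Zel *m delta_mx (b i) 0 =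
    cos (z i) *: delta_mx (b i) 0 + sin (z i) *: delta_mx (a i) 0 :> 'cV[R]_d.+2.
  by rewrite (expmx_rotation Eb).
rewrite Xa Xb mxCB mxCD !mxCZ sb ob mul1r.
have -> : cexp ((-1) ^+ s * ('i%C * (z i)%:C)) = (cos (z i))%:C + (-1) ^+ s * 'i%C * (sin (z i))%:C.
  have -> : (-1) ^+ s * ('i%C * (z i)%:C) = 'i%C * ((-1) ^+ s * z i)%:C :> C.
    by rewrite rmorphM rmorphXn rmorphN rmorph1; ring.
  rewrite cexp_imag; case: s; rewrite ?expr0 ?expr1 ?mulN1r ?mul1r ?cosN ?sinN.
    by apply: complex_ext; rewrite ?cReD ?cImD ?mulNr ?cReN ?cImN ?cReM ?cImM /=; ring.
  by apply: complex_ext; rewrite ?cReD ?cImD ?cReM ?cImM /=; ring.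
have ii : 'i%C * 'i%C = -1 :> C by rewrite -expr2 sqr_i.
have ssgn : (-1) ^+ s * (-1) ^+ s = 1 :> C by rewrite -expr2 sqrr_sign.
have ww : ((-1) ^+ s * 'i%C) * ((-1) ^+ s * 'i%C) = -1 :> C.
  by rewrite mulrACA ssgn ii mul1r.
move: ((-1) ^+ s * 'i%C) ww (mxC (delta_mx (a i) 0)) (mxC (delta_mx (b i) 0)) => w ww va vb.
move: ((cos (z i))%:C) ((sin (z i))%:C) => co si.
apply/matrixP => j l; rewrite !mxE.
transitivity (co * va j l + (w * w) * (si * vb j l) + w * (co * vb j l + si * va j l)).
  by rewrite ww mulN1r.
by ring.
Qed.

Lemma Fmx_pair_comm i j :
  Fmx (a i) (b i) *m Fmx (a j) (b j) = Fmx (a j) (b j) *m Fmx (a i) (b i) :> 'M[R]_d.+2.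
Proof.
have [->//|ij] := eqVneq i j.
apply: mxC_inj; rewrite !mxC_mul; apply/eqP; rewrite -subr_eq0; apply/eqP.
rewrite [mxC (Fmx (a j) _)]mxC_Fmx skew_bivec; last by apply: skew_mxC; exact: Fmx_alg.
rewrite !Fmx_ev (a_inj frame) (b_inj frame) (negPf ij) (a_neq_b frame) [b i == a j]eq_sym.
by rewrite (a_neq_b frame) !mulr0n !scale0r !subr0 bivec0l bivec0r addr0.
Qed.

Lemma Zel_comm i : Fmx (a i) (b i) *m Zel = Zel *m Fmx (a i) (b i).
Proof.
rewrite /Zel mulmx_sumr mulmx_suml; apply: eq_bigr => j _.
by rewrite -scalemxAr -scalemxAl Fmx_pair_comm.
Qed.

Lemma Fmx_sigma i : sigma p (Fmx (a i) (b i)) = - Fmx (a i) (b i) :> 'M[R]_d.+2.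
Proof.
apply: mxC_inj; rewrite mxCN /sigma !mxC_mul !mxC_Fmx Sc_bivec !S_ev.
case: frame => _ aL bR _; rewrite aL ltnNge bR/= scale1r scaleN1r.
by rewrite bivecC bivecNl.
Qed.

Lemma Hc_Fmx i : Hc i = - (sg (b i) * om b i) *: mxC (Fmx (a i) (b i)).
Proof. by rewrite HcE mxC_Fmx. Qed.

Lemma Hc_skew i : isskew J (Hc i).
Proof. by rewrite HcHH HHE; apply: bivec_skew; exact: Jc_tr. Qed.

Lemma Hc_bracket i k l :
  Hc i *m W (rt k) (rt l) - W (rt k) (rt l) *m Hc i = (wt i k + wt i l) *: W (rt k) (rt l).
Proof. by rewrite skew_bivec ?Hc_rt ?bivecZl ?bivecZr -?scalerDl//; exact: Hc_skew. Qed.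

Lemma bracketB m (H A B : 'M[C]_m) :
  H *m (A - B) - (A - B) *m H = (H *m A - A *m H) - (H *m B - B *m H).
Proof.
rewrite mulmxBr mulmxBl; move: (H *m A) (H *m B) (A *m H) (B *m H) => p1 p2 q1 q2.
by apply/matrixP => i j; rewrite !mxE; ring.
Qed.

(** If q^2 = 1, then Ad(x) multiplies D = E - sigma E by q, so the real and imaginary parts of D lie
    in the commutative intersection, as do the generators of the Cartan subspace. Some [Hc j] has a
    weight w <> 0 on E, hence -w on sigma E, so [Hc j, D] = w (E + sigma E) must vanish. Then E = -
    sigma E has both weights w and -w, which forces E = 0. *)
Lemma comm_regular k l :
  (forall X Y, (sigma_minus d p `&` (Ad (expmx Zel) @` sigma_minus d p)) X ->
               (sigma_minus d p `&` (Ad (expmx Zel) @` sigma_minus d p)) Y ->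
               X *m Y = Y *m X) ->
  root_pair k l -> (e k * e l) ^+ 2 != 1.
Proof.
move=> comm kl; apply/eqP => q2; have Gg := G_exp Zel_alg.
have [kNl _] := root_pairP kl; have [j w0] := root_pair_wt kl.
have [E EE] := ex_intro (fun E => E = W (rt k) (rt l)) _ erefl.
have [E' E'E] := ex_intro (fun E' => E' = W (S *m rt k) (S *m rt l)) _ erefl.
have SE : S *m E *m S = E' by rewrite EE E'E; exact: Sc_bivec.
have SE' : S *m E' *m S = E by rewrite -SE; exact: Sc_conjK.
have sE : isskew J E by rewrite EE; apply: bivec_skew; exact: Jc_tr.
have sE' : isskew J E' by rewrite E'E; apply: bivec_skew; exact: Jc_tr.
have sD : isskew J (E - E') by apply: skewB.
have SD : S *m (E - E') *m S = - (E - E').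
  by rewrite mulmxBr mulmxBl SE SE' opprB.
(* q is real here, which allows the real and imaginary parts of D to be treated separately. *)
have [r [qr rr]] : exists r : R, e k * e l = r%:C /\ r * r = 1.
  have /eqP := q2; rewrite sqrf_eq1 => /orP[/eqP->|/eqP->].
    by exists 1; rewrite rmorph1 mulr1.
  by exists (-1); rewrite rmorphN rmorph1 mulrNN mulr1.
pose g := expmx Zel; have gJ : g^T *m eta d.+1 *m g = eta d.+1 by exact: G_isom.
have gu : g \in unitmx by exact: isom_unit gJ.
have gJc : (mxC g)^T *m J *m mxC g = J by rewrite /Jc -mxC_tr -!mxC_mul gJ.
have ggc : mxC g *m mxC (invmx g) = 1%:M by rewrite -mxC_mul mulmxV// mxC1.
have rtg m : mxC g *m rt m = e m *: rt m by exact: exp_rt.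
have e_inv m : e (partner m) = (e m)^-1.
  have h := eigv_partner m; have h0 : e m != 0.
    by apply/eqP => h0; move: h; rewrite h0 mul0r => /esym/eqP; rewrite oner_eq0.
  by apply: (mulfI h0); rewrite h divff.
have gD : mxC g *m (E - E') *m mxC (invmx g) = r%:C *: (E - E').
  rewrite mulmxBr mulmxBl scalerBr -qr; congr (_ - _).
    by rewrite EE (bivec_conj _ _ gJc ggc) !rtg bivecZl bivecZr scalerA.
  rewrite E'E (bivec_conj _ _ gJc ggc) !(S_rt frame) -!scalemxAr !rtg !bivecZl !bivecZr !scalerA.
  congr (_ *: _); rewrite !e_inv.
  have r0 : r != 0.
    by apply/eqP => r0; move: rr; rewrite r0 mul0r => /esym/eqP; rewrite oner_eq0.
  have qi : (e k)^-1 * (e l)^-1 = e k * e l.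
    by rewrite -invfM qr -fmorphV; congr (_%:C); rewrite -[LHS]mulr1 -{1}rr mulrA mulVf ?mul1r.
  by transitivity (ss (p := p) u k * ss (p := p) u l * ((e k)^-1 * (e l)^-1)); [ring|rewrite qi; ring].
have mem X : alg X -> sigma p X = - X -> g *m X *m invmx g = r *: X ->
    (sigma_minus d p `&` (Ad g @` sigma_minus d p)) X.
  move=> aX sX gX; split; first by split => //; apply/algP.
  exists (r *: X); last by rewrite /Ad -scalemxAr -scalemxAl gX scalerA rr scale1r.
  split; first by apply/algP; exact: algZ.
  by rewrite /sigma -scalemxAr -scalemxAl -[_ *m X *m _]/(sigma p X) sX scalerN.
have memF : (sigma_minus d p `&` (Ad g @` sigma_minus d p)) (Fmx (a j) (b j)).
  have sF : sigma_minus d p (Fmx (a j) (b j) : 'M[R]_d.+2).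
    by split; [apply/algP; exact: Fmx_alg|exact: Fmx_sigma].
  split => //; exists (Fmx (a j) (b j)) => //.
  by rewrite /Ad -(expmx_comm (Zel_comm j)) -mulmxA -/g mulmxV// mulmx1.
have [aR aI] := skew_parts sD.
have memR : (sigma_minus d p `&` (Ad g @` sigma_minus d p)) (mxRe (E - E')).
  apply: mem => //.
    have /(congr1 mxRe) := SD; rewrite /sigma /Sc mxRe_mul => ->.
    by rewrite -scaleN1r mxReZ /= oppr0 scale0r subr0 scaleN1r.
  by have /(congr1 mxRe) := gD; rewrite mxRe_mul mxReZ /= scale0r subr0.
have memI : (sigma_minus d p `&` (Ad g @` sigma_minus d p)) (mxIm (E - E')).
  apply: mem => //.
    have /(congr1 mxIm) := SD; rewrite /sigma /Sc mxIm_mul => ->.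
    by rewrite -scaleN1r mxImZ /= oppr0 scale0r addr0 scaleN1r.
  by have /(congr1 mxIm) := gD; rewrite mxIm_mul mxImZ /= scale0r addr0.
have cR := comm _ _ memR memF; have cI := comm _ _ memI memF.
have DF : (E - E') *m mxC (Fmx (a j) (b j)) = mxC (Fmx (a j) (b j)) *m (E - E').
  by rewrite [E - E']mxReIm mulmxDl mulmxDr -scalemxAl -scalemxAr -!mxC_mul cR cI.
have DH : Hc j *m (E - E') - (E - E') *m Hc j = 0.
  by rewrite Hc_Fmx -scalemxAl -scalemxAr DF subrr.
have bE : Hc j *m E - E *m Hc j = (wt j k + wt j l) *: E by rewrite EE Hc_bracket.
have bE' : Hc j *m E' - E' *m Hc j = - ((wt j k + wt j l) *: E').
  rewrite E'E !(S_rt frame) !bivecZl !bivecZr -!scalemxAr -!scalemxAl -!scalerBr Hc_bracket.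
  rewrite !wt_partner -opprD scaleNr !scalerN !scalerA; congr (- (_ *: _)); ring.
have E1 : E + E' = 0.
  have /eqP := DH; rewrite bracketB bE bE' opprK -scalerDr scaler_eq0 (negPf w0)/=.
  by move/eqP.
have EN : E = - E' by apply/eqP; rewrite -addr_eq0 E1.
have E0 : E = 0.
  have := bE; rewrite EN mulmxN mulNmx -opprD bE' opprK scalerN => /eqP.
  rewrite -addr_eq0 -mulr2n -scaler_nat scalerA scaler_eq0 mulf_eq0.
  by rewrite (negPf (C2_neq0 (R := R))) (negPf w0) => /eqP ->; rewrite oppr0.
by have := bivec_rt_neq0 kNl; rewrite -EE E0 eqxx.
Qed.

End Element.

End CartanFrame.

(** * The root system *)

Lemma complexify_mem (R : realType) n (c : {vspace 'M[R]_n}) (W : 'M[R[i]]_n) :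
  (W \in complexify c) = (mxRe W \in c) && (mxIm W \in c).
Proof.
have incl (v : 'M[R]_n) : v \in c -> mxC v \in complexify c.
  move=> /coord_vbasis ->; rewrite (big_morph _ (@mxCD R n n) (mxC0 n n)).
  apply: memv_suml => i _; rewrite mxCZ; apply: memvZ; apply: memv_span.
  by apply: map_f; rewrite mem_nth// size_tuple.
apply/idP/andP => [|[WR WI]]; last first.
  by rewrite (mxReIm W) memvD ?memvZ// incl.
move=> WC; have : W \in <<[tuple of map mxC (vbasis c)]>>%VS by [].
move=> /coord_span ->; set X := [tuple of _].
elim/big_ind: _ => [|A B [A1 A2] [B1 B2]|i _].
- have -> : mxRe (0 : 'M[R[i]]_n) = 0 by apply/matrixP => i j; rewrite !mxE.
  have -> : mxIm (0 : 'M[R[i]]_n) = 0 by apply/matrixP => i j; rewrite !mxE.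
  by rewrite !mem0v.
- by rewrite mxReD mxImD !memvD.
- have [v vc ->] : exists2 v, v \in c & X`_i = mxC v.
    exists (vbasis c)`_i; last by rewrite (nth_map 0) ?size_tuple.
    by apply: vbasis_mem; rewrite mem_nth ?size_tuple.
  by rewrite mxReZ mxImZ mxRe_mxC mxIm_mxC !scaler0 subr0 add0r !memvZ.
Qed.

Section DualSide.
Context {R : realType} {d p N M : nat}.
Variables (a b : 'I_N -> 'I_d.+2) (u : 'I_M -> 'I_d.+2) (c : {vspace 'M[R]_d.+2}).
Hypothesis frame : is_frame (p := p) a b u.
Hypothesis cE : c = <<[tuple Fmx (a i) (b i) | i < N]>>%VS.
Local Notation C := R[i].
Local Notation J := (Jc d.+1 : 'M[C]_d.+2).
Local Notation W := (bivec J).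
Local Notation I := ('I_N * bool + 'I_M)%type.
Local Notation rt := (rt (R := R) a b u).
Local Notation rt' := (rt' (R := R) a b u).
Local Notation Hc := (Hc (R := R) a b u).
Local Notation HH := (HH (R := R) a b u).
Local Notation wt := (wt (R := R) (N := N) (M := M)).
Local Notation cC := (complexify c).
Local Notation T := (subvs_of cC).
Local Notation D := (dualC c).
Local Notation coroot := (@Defs.coroot R d c).
Local Notation root_system := (@Defs.root_system R d c).
Local Notation dual_form := (@Defs.dual_form R d c).
Local Notation orthogonal_frame := (@Defs.orthogonal_frame R d c).

Lemma mem_cP X : X \in c -> exists z, X = Zel a b z.
Proof.
rewrite cE => /coord_span XE; exists (coord [tuple Fmx (a i) (b i) | i < N] ^~ X).
by rewrite {1}XE; apply: eq_bigr => i _; rewrite -tnth_nth tnth_mktuple.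
Qed.

Lemma Fmx_mem i : Fmx (a i) (b i) \in c.
Proof. by rewrite cE; apply: memv_span; rewrite -(tnth_mktuple (fun i => Fmx (a i) (b i)) i) mem_tnth. Qed.

Lemma Hc_mem i : Hc i \in cC.
Proof.
rewrite Hc_Fmx complexify_mem mxReZ mxImZ mxRe_mxC mxIm_mxC !scaler0 subr0 add0r.
by rewrite !memvZ ?Fmx_mem.
Qed.

Lemma c_alg X : X \in c -> alg X.
Proof. by move=> /mem_cP[z ->]; exact: Zel_alg. Qed.

Lemma cC_skew A : A \in cC -> isskew J A.
Proof.
rewrite complexify_mem => /andP[/c_alg AR /c_alg AI]; rewrite (mxReIm A).
by apply: skewD; [|apply: skewZ]; exact: skew_mxC.
Qed.

Fact Hs_subproof i : {A : T | vsval A = Hc i}.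
Proof. by exists (vsproj cC (Hc i)); rewrite vsprojK ?Hc_mem. Qed.

Definition Hs i : T := sval (Hs_subproof i).

Lemma HsE i : vsval (Hs i) = Hc i.
Proof. exact: (svalP (Hs_subproof i)). Qed.

Lemma BformC (A B : 'M[C]_d.+2) : Bform A B = Bform B A.
Proof. by rewrite /Bform mxtrace_mulC. Qed.

Lemma BformDr (A B B' : 'M[C]_d.+2) : Bform A (B + B') = (Bform A B + Bform A B' : C).
Proof. by rewrite /Bform mulmxDr linearD. Qed.

Lemma BformZr x (A B : 'M[C]_d.+2) : Bform A (x *: B) = (x * Bform A B : C).
Proof. by rewrite /Bform -scalemxAr linearZ. Qed.

Lemma BformDl (A B B' : 'M[C]_d.+2) : Bform (B + B') A = (Bform B A + Bform B' A : C).
Proof. by rewrite !(BformC _ A) BformDr. Qed.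

Lemma BformZl x (A B : 'M[C]_d.+2) : Bform (x *: B) A = (x * Bform B A : C).
Proof. by rewrite !(BformC _ A) BformZr. Qed.

Lemma BformNl (A B : 'M[C]_d.+2) : Bform (- B) A = (- Bform B A : C).
Proof. by rewrite -scaleN1r BformZl mulN1r. Qed.

Lemma Bform_sumr I' (r : seq I') (P : pred I') (F : I' -> 'M[C]_d.+2) A :
  Bform A (\sum_(i <- r | P i) F i) = (\sum_(i <- r | P i) Bform A (F i) : C).
Proof. by rewrite /Bform mulmx_sumr linear_sum. Qed.

Lemma Bform_HH_Hc k j : Bform (HH k) (Hc j) = (2 * wt j k : C).
Proof.
rewrite /Bform HHE (trace_bivec (Jc_tr _)); last exact: Hc_skew.
rewrite (Hc_rt frame) dotJZr (form_dual frame) eqxx mulr1.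
by rewrite mulr_natl.
Qed.

Lemma Bform_Hc i j : Bform (Hc i) (Hc j) = (2 * (i == j)%:R : C).
Proof. by rewrite [Hc i]HcHH Bform_HH_Hc /= eq_sym. Qed.

Lemma cC_expand A : A \in cC -> A = \sum_i (Bform A (Hc i) / 2) *: Hc i.
Proof.
move=> hA.
have [x ->] : exists x : 'I_N -> C, A = \sum_i x i *: Hc i.
  have H X : X \in c -> exists x : 'I_N -> C, mxC X = \sum_i x i *: Hc i.
    move=> /mem_cP[z ->]; exists (fun i => (z i)%:C * - (sg (b i) * om b i)^-1).
    rewrite /Zel (big_morph _ (@mxCD R _ _) (mxC0 _ _)); apply: eq_bigr => i _.
    rewrite mxCZ Hc_Fmx scalerA -mulrA mulrNN mulVf ?mulr1//.
    rewrite mulf_neq0 ?om_neq0//; apply/eqP => s0; have := sg_sqr (R := R) (b i).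
    by rewrite s0 mul0r => /esym/eqP; rewrite oner_eq0.
  move: hA; rewrite complexify_mem => /andP[/H[x xE] /H[y yE]].
  exists (fun i => x i + 'i%C * y i); rewrite (mxReIm A) xE yE scaler_sumr -big_split/=.
  by apply: eq_bigr => i _; rewrite scalerDl scalerA.
apply: eq_bigr => i _; congr (_ *: _).
rewrite BformC Bform_sumr (bigD1 i)//= big1 ?addr0 => [|j ji].
  by rewrite BformZr Bform_Hc eqxx mulr1 mulfK ?C2_neq0.
by rewrite BformZr Bform_Hc eq_sym (negPf ji) !mulr0.
Qed.

Lemma Bform_Hs i j : Bform (vsval (Hs i)) (vsval (Hs j)) = (2 * (i == j)%:R : C).
Proof. by rewrite -Bform_Hc; exact: (congr2 (@Bform _ _) (HsE i) (HsE j)). Qed.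

Lemma Hs_expand (Y : T) : Y = \sum_i (Bform (vsval Y) (Hc i) / 2) *: Hs i.
Proof.
apply: val_inj => /=; rewrite linear_sum/= {1}(cC_expand (subvsP Y)).
by apply: eq_bigr => i _; rewrite HsE.
Qed.

Definition is_coroot (l : D) (A : T) := forall Y, (l Y : C) = Bform (vsval A) (vsval Y).

Lemma is_coroot_uniq l A A' : is_coroot l A -> is_coroot l A' -> A = A'.
Proof.
move=> lA lA'; rewrite (Hs_expand A) (Hs_expand A'); apply: eq_bigr => i _.
by rewrite -HsE -lA -lA'.
Qed.

Lemma corootP l : is_coroot l (coroot l).
Proof.
(* B(Hc i, Hc j) is twice the Kronecker delta, whence the division by 2. *)
pose A : T := \sum_i (l (Hs i) / 2 : C) *: Hs i.
have lA : is_coroot l A.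
  move=> Y; rewrite {1}(Hs_expand Y) linear_sum/= BformC linear_sum/= Bform_sumr.
  apply: eq_bigr => i _; rewrite !linearZ/= BformZr HsE.
  by rewrite /GRing.scale/=; ring.
exact: (@xgetPex _ 0 [set C | forall Y, (l Y : R[i]) = Bform (vsval C) (vsval Y)] (ex_intro _ A lA)).
Qed.

Lemma coroot_eq l A : is_coroot l A -> coroot l = A.
Proof. by move=> lA; exact: (is_coroot_uniq (corootP l) lA). Qed.

Lemma coroot_inj : injective coroot.
Proof.
by move=> l m E; apply/lfunP => Y; rewrite [LHS]corootP [RHS]corootP E.
Qed.

Lemma corootD l m : coroot (l + m) = coroot l + coroot m.
Proof.
by apply: coroot_eq => Y; rewrite add_lfunE linearD/= BformDl -!corootP.
Qed.

Lemma corootZ x (l : D) : coroot (x *: l) = x *: coroot l.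
Proof.
by apply: coroot_eq => Y; rewrite scale_lfunE linearZ/= BformZl -!corootP.
Qed.

Lemma corootN l : coroot (- l) = - coroot l.
Proof. by rewrite -scaleN1r corootZ scaleN1r. Qed.

Lemma coroot0 : coroot (0%R : D) = 0.
Proof. by rewrite -(scale0r (0%R : D)) corootZ scale0r. Qed.

Definition Bfun (A : T) (Y : T) : C^o := Bform (vsval A) (vsval Y).

Lemma Bfun_linear A : linear (Bfun A).
Proof. by move=> x Y Y'; rewrite /Bfun linearP/= BformDr BformZr. Qed.

HB.instance Definition _ A := GRing.isLinear.Build C T C^o _ (Bfun A) (Bfun_linear A).

Definition dualof (A : T) : D := linfun (Bfun A).

Lemma coroot_dualof A : coroot (dualof A) = A.
Proof. by apply: coroot_eq => Y; rewrite lfunE. Qed.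

(** B(Hc i, .) is twice the weight of [rt (inl (i, false))], so the doubled roots are sums of signed
    [eps] without a further factor. *)
Definition eps : N.-tuple D := [tuple dualof (Hs i) | i < N].

Lemma coroot_eps i : coroot (tnth eps i) = Hs i.
Proof. by rewrite tnth_mktuple coroot_dualof. Qed.

Lemma eps_val i j : tnth eps i (Hs j) = 2 * (i == j)%:R :> C.
Proof.
by rewrite (corootP (tnth eps i) (Hs j)) coroot_eps; exact: Bform_Hs.
Qed.

Lemma dual_expand (l : D) : l = \sum_i (l (Hs i) / 2 : C) *: tnth eps i.
Proof.
apply/lfunP => Y; rewrite sum_lfunE {1}(Hs_expand Y) linear_sum; apply: eq_bigr => i _.
rewrite linearZ/= scale_lfunE (corootP (tnth eps i) Y) coroot_eps HsE BformC.
by rewrite /GRing.scale/=; ring.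
Qed.

Lemma dual_eq0 (l : D) : (forall i, l (Hs i) = 0 :> C) -> l = 0.
Proof.
by move=> H; rewrite (dual_expand l) big1 // => i _; rewrite H mul0r scale0r.
Qed.

Lemma eps_basis : basis_of fullv eps.
Proof.
rewrite basisEfree subvf; apply/andP; split.
  apply/freeP => k k0 i.
  have k1 : \sum_j k j *: tnth eps j = 0 by rewrite -[RHS]k0; apply: eq_bigr => j _; rewrite -tnth_nth.
  have := congr1 (fun l : D => l (Hs i) : C) k1; rewrite sum_lfunE lfunE (bigD1 i)//.
  rewrite big1 => [|j ji]; last by rewrite scale_lfunE eps_val (negPf ji) mulr0; exact: mulr0.
  move=> H; have : (k i *: tnth eps i) (Hs i) = 0 :> C := etrans (esym (addr0 _)) H.
  rewrite scale_lfunE eps_val eqxx mulr1 => /eqP.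
  by rewrite mulf_eq0 (negPf (C2_neq0 (R := R))) orbF => /eqP.
rewrite size_tuple /=.
have le : (fullv <= <<eps>>)%VS.
  apply/subvP => l _; rewrite (dual_expand l); apply: memv_suml => i _.
  by apply: memvZ; apply: memv_span; exact: mem_tnth.
by have := leq_trans (dimvS le) (dim_span eps); rewrite size_tuple.
Qed.

Lemma eps_frame : orthogonal_frame eps.
Proof.
split; first exact: eps_basis.
exists 2; split => // i j; rewrite /Defs.dual_form !coroot_eps Bform_Hs.
by case: eqP => _; rewrite ?mulr1n ?mulr0n ?mulr1 ?mulr0 ?rmorph0// rmorph_nat.
Qed.

Lemma cC_rt A k : A \in cC -> A *m rt k = (Bform (HH k) A / 2) *: rt k.
Proof.
move=> hA; rewrite {1}(cC_expand hA) {2}(cC_expand hA) mulmx_suml Bform_sumr mulr_suml scaler_suml.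
apply: eq_bigr => i _; rewrite -scalemxAl (Hc_rt frame) scalerA BformZr Bform_HH_Hc.
by congr (_ *: _); field; rewrite ?C2_neq0.
Qed.

Lemma rt_ext m (A : 'M[C]_(m, d.+2)) : (forall k, A *m rt k = 0) -> A = 0.
Proof.
move=> H; have Aev s : A *m ev s = 0.
  case: (frame) => -[h hK Kh] _ _ _; rewrite -(Kh s); case: (h s) => [[i|i]|k] /=.
  - have := congr2 +%R (H (inl (i, false))) (H (inl (i, true))).
    rewrite -mulmxDr /rt expr0 expr1 addrACA -scalerDl mul1r mulN1r subrr scale0r !addr0.
    rewrite mulmxDr -mulr2n -scaler_nat => /eqP; rewrite scaler_eq0 (negPf (C2_neq0 (R := R)))/=.
    by move/eqP.
  - have := congr2 (fun x y => x - y) (H (inl (i, false))) (H (inl (i, true))).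
    rewrite -mulmxBr /rt expr0 expr1 opprD addrACA subrr add0r -scaleNr -scalerDl subr0.
    rewrite mul1r mulN1r opprK -scalemxAr => /eqP; rewrite scaler_eq0 => /orP[|/eqP//].
    rewrite -mulr2n -mulr_natl mulf_eq0 (negPf (C2_neq0 (R := R)))/= mulf_eq0.
    rewrite (negPf (om_neq0 b i)) orbF => /eqP s0; have := sg_sqr (R := R) (b i).
    by rewrite s0 mul0r => /esym/eqP; rewrite oner_eq0.
  - exact: (H (inr k)).
apply/matrixP => i j; have /matrixP/(_ i 0) := Aev j.
by rewrite /ev -colE !mxE.
Qed.

Lemma HH_mem k : HH k \in cC.
Proof.
case: k => [[i s]|m]; last by rewrite HH_inr mem0v.
by rewrite HH_inl memvZ// Hc_mem.
Qed.

Lemma half_sum_eq (t y1 y2 l : C) : t != 0 ->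
  - (y1 / 2) * t + -1 * (y2 / 2 * t) = l * t -> l = - ((y1 + y2) / 2).
Proof. by move=> t0 H; apply: (mulIf t0); rewrite -H; ring. Qed.

(** Pairing [Y, E] = l E with [rt k] and [rt m], on which the skew Y acts by scalars, determines
    l. *)
Lemma cC_eigenvalue (Y E : 'M[C]_d.+2) k m (l : C) :
  Y \in cC -> isskew J E -> dotJ J (rt k) (E *m rt m) != 0 ->
  Y *m E - E *m Y = l *: E -> l = - (Bform (HH k + HH m) Y / 2).
Proof.
move=> YC sE km El.
have := congr1 (fun A => dotJ J (rt k) (A *m rt m)) El.
rewrite mulmxBl -!mulmxA (cC_rt m YC) -scalemxAr -scaleN1r dotJDr dotJZr.
have -> : dotJ J (rt k) (Y *m (E *m rt m)) = - (Bform (HH k) Y / 2) * dotJ J (rt k) (E *m rt m).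
  rewrite -[LHS]opprK -skew_dotJ; last exact: cC_skew.
  by rewrite (cC_rt k YC) dotJZl mulNr.
rewrite -scalemxAl !dotJZr BformDl => H.
exact: (half_sum_eq km H).
Qed.

(** A weight vector E has a nonzero coefficient between some [rt k] and [rt m], which pins its
    weight to minus the sum of theirs, that is, to the sum over their partners. Conversely
    [rt k /\ rt l] is a weight vector. *)
Lemma root_systemP (r : D) : root_system r <->
  exists k l, root_pair k l /\ vsval (coroot r) = HH k + HH l.
Proof.
split=> [[l [l0 [E [EC E0 El]]] ->]|[k [l [kl rE]]]].
  have sE : isskew J E.
    move: EC; rewrite complexify_mem => /andP[/algP ER /algP EI]; rewrite (mxReIm E).
    by apply: skewD; [|apply: skewZ]; exact: skew_mxC.
  (* The form is nondegenerate and the eigenvectors span, so E would otherwise be 0. *)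
  have [k [m km]] : exists k m, dotJ J (rt k) (E *m rt m) != 0.
    apply: contrapT => /forallNP H; move/eqP: E0; apply; apply: rt_ext => m.
    have JJE : (E *m rt m)^T *m J = 0.
      apply: rt_ext => k; have := H k => /forallNP/(_ m)/negP; rewrite negbK => /eqP.
      rewrite dotJC ?Jc_tr// /dotJ => H0; apply/matrixP => i j.
      by rewrite !ord1 H0 mxE.
    have /(congr1 (mulmx^~ J)) := JJE; rewrite -mulmxA Jc_sqr mulmx1 mul0mx.
    by move=> /(congr1 trmx); rewrite trmxK trmx0.
  have lE (Y : T) : (l Y : C) = - (Bform (HH k + HH m) (vsval Y) / 2).
    by apply: (cC_eigenvalue (subvsP Y) sE km); exact: El.
  have sumE : vsval (coroot (2 *: l)) = HH (partner k) + HH (partner m).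
    have HHo j : HH (partner j) = - HH j.
      case: j => [[i s]|j] /=; last by rewrite HH_inr oppr0.
      by rewrite !HH_inl -scaleNr; case: s; rewrite /= ?expr0 ?expr1 ?opprK.
    have mem : HH (partner k) + HH (partner m) \in cC by rewrite memvD ?HH_mem.
    rewrite -(vsprojK mem); congr vsval; apply: coroot_eq => Y.
    rewrite scale_lfunE lE (vsprojK mem) !HHo -opprD BformNl.
    by move: (Bform _ _) => x; rewrite /GRing.scale/=; field; rewrite ?C2_neq0.
  exists (partner k), (partner m); split => //; apply: root_pair_partner.
  (* E is skew, so <rt m, E rt m> = 0. *)
  have kNm : k != m.
    apply/eqP => E1; move: km; rewrite E1; have := skew_dotJ (rt m) (rt m) sE.
    rewrite dotJC ?Jc_tr// => /eqP; rewrite -addr_eq0 -mulr2n -mulr_natl mulf_eq0.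
    by rewrite (negPf (C2_neq0 (R := R)))/= => ->.
  (* A nonzero weight excludes opposite indices and pairs of killed vectors. *)
  have sum0 : HH k + HH m != 0.
    apply: contraNneq l0 => S0; apply/eqP/funext => Y.
    by rewrite lE S0 -(scale0r 0) BformZl !mul0r oppr0.
  case: k m {km lE sumE} kNm sum0 => [[i s]|k] [[j s']|m] //=; last by rewrite !HH_inr addr0 eqxx.
    move=> -> /= sum0; apply/eqP => -[E1 E2]; move: sum0.
    by rewrite E1 E2 !HH_inl -scalerDl; case: (s'); rewrite /= ?expr0 ?expr1 ?addNr ?subrr scale0r eqxx.
have lE : r = 2 *: (2^-1 *: r) by rewrite scalerA mulfV ?C2_neq0// scale1r.
have [kNl _] := root_pairP kl.
exists (2^-1 *: r) => //; split.
  apply/eqP => r0; have {}r0 : r = 0.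
    rewrite lE (dual_eq0 (l := 2^-1 *: r)) ?scaler0// => i.
    exact: (congr1 (fun h => h (Hs i)) r0).
  have [j w0] := root_pair_wt (R := R) kl.
  have : 2 * (wt j k + wt j l) = 0 :> C.
    rewrite mulrDr -!Bform_HH_Hc -BformDl -rE r0 coroot0.
    by rewrite linear0 /Bform mul0mx mxtrace0.
  by move/eqP; rewrite mulf_eq0 (negPf w0) (negPf (C2_neq0 (R := R))).
exists (W (rt k) (rt l)); split.
- rewrite complexify_mem; have [aR aI] := skew_parts (bivec_skew (Jc_tr d.+1) (rt k) (rt l)).
  by apply/andP; split; apply/algP.
- exact: (bivec_rt_neq0 frame).
- move=> Y; apply: (etrans (skew_bivec _ _ (cC_skew (subvsP Y)))).
  rewrite (cC_rt k (subvsP Y)) (cC_rt l (subvsP Y)) bivecZl bivecZr -scalerDl.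
  rewrite scale_lfunE (corootP r Y) rE BformDl -mulrDl mulrC.
  by [].
Qed.

End DualSide.

(** * The radial operator *)

Lemma bilinear_sums (K : fieldType) (U : vectType K) n (x : 'I_n -> K) (A : 'I_n -> U)
    (beta : 'Hom(U, 'Hom(U, K^o))) :
  beta (\sum_i x i *: A i) (\sum_i x i *: A i) =
  \sum_i \sum_j x i * x j * beta (A i) (A j) :> K.
Proof.
have -> : beta (\sum_i x i *: A i) = \sum_i x i *: beta (A i).
  by rewrite linear_sum; apply: eq_bigr => i _; rewrite linearZ.
rewrite sum_lfunE; apply: eq_bigr => i _.
rewrite scale_lfunE linear_sum /GRing.scale/= mulr_sumr; apply: eq_bigr => j _.
by rewrite linearZ /GRing.scale/= mulrA.
Qed.

Lemma orthogonal_sums (K : fieldType) n (m : 'I_n -> 'I_n -> K) r (g : 'I_n -> 'I_n -> K) :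
  (forall j k, \sum_i m i j * m i k = r * (j == k)%:R) ->
  \sum_i \sum_j \sum_k m i j * m i k * g j k = r * \sum_j g j j.
Proof.
move=> mm; rewrite exchange_big/= mulr_sumr; apply: eq_bigr => j _.
rewrite exchange_big/= (bigD1 j)//= [X in _ + X]big1 => [|k kj].
  by rewrite addr0 -mulr_suml mm eqxx mulr1.
by rewrite -mulr_suml mm eq_sym (negPf kj) mulr0 mul0r.
Qed.

Lemma signed_sum (K : comNzRingType) (J : finType) (P : pred J) (g : bool -> bool -> J -> K) :
  (forall s s' j, g (~~ s) (~~ s') j = g s s' j) ->
  \sum_(j | P j) (g true true j + g true false j) +
  \sum_(j | P j) (g false true j + g false false j) =
  2 * \sum_(j | P j) (g false false j + g false true j).
Proof.
move=> gN; rewrite -big_split mulr_sumr; apply: eq_bigr => j _ /=.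
by rewrite -(gN true true) -(gN true false) /=; ring.
Qed.

Section RadialOperator.
Context {R : realType} {d p N M : nat}.
Variables (a b : 'I_N -> 'I_d.+2) (u : 'I_M -> 'I_d.+2) (c : {vspace 'M[R]_d.+2}).
Hypothesis frame : is_frame (p := p) a b u.
Hypothesis cE : c = <<[tuple Fmx (a i) (b i) | i < N]>>%VS.
Local Notation C := R[i].
Local Notation J := (Jc d.+1 : 'M[C]_d.+2).
Local Notation I := ('I_N * bool + 'I_M)%type.
Local Notation Hc := (Hc (R := R) a b u).
Local Notation HH := (HH (R := R) a b u).
Local Notation cC := (complexify c).
Local Notation T := (subvs_of cC).
Local Notation D := (dualC c).
Local Notation coroot := (@Defs.coroot R d c).
Local Notation root_system := (@Defs.root_system R d c).
Local Notation eps := (eps u cE).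
Local Notation Hs := (Hs u cE).

Definition signed_eps (k : I) : D := if k is inl (i, s) then (-1) ^+ s *: tnth eps i else 0.

Lemma coroot_signed_eps k : vsval (coroot (signed_eps k)) = HH k.
Proof.
case: k => [[i s]|m] /=; last by rewrite (coroot0 frame cE) HH_inr linear0.
by rewrite (corootZ frame cE) (coroot_eps frame cE) linearZ/= HsE HH_inl.
Qed.

Lemma root_system_signed_eps (r : D) : root_system r <->
  exists k l, root_pair k l /\ r = signed_eps k + signed_eps l.
Proof.
rewrite (root_systemP frame cE); split=> -[k [l [kl E]]]; exists k, l; split => //.
  apply: (coroot_inj frame cE); apply: val_inj => /=.
  by rewrite E (corootD frame cE) linearD/= !coroot_signed_eps.
by rewrite E (corootD frame cE) linearD/= !coroot_signed_eps.
Qed.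

Lemma short_signed_eps i s : short_roots c eps (signed_eps (inl (i, s))).
Proof.
by exists i; case: s => /=; [right; rewrite expr1 scaleN1r|left; rewrite expr0 scale1r].
Qed.

Lemma short_rootsP (r : D) : short_roots c eps r <-> exists i s, r = signed_eps (inl (i, s)).
Proof.
split=> [[i [->|->]]|[i [s ->]]]; last exact: short_signed_eps.
  by exists i, false; rewrite /= expr0 scale1r.
by exists i, true; rewrite /= expr1 scaleN1r.
Qed.

Lemma root_pair_inl i s j s' : i != j -> @root_pair N M (inl (i, s)) (inl (j, s')).
Proof. by move=> ij; apply/andP; split; apply/eqP => -[E]; rewrite E eqxx in ij. Qed.

Lemma root_pair_neq i s j s' : @root_pair N M (inl (i, s)) (inl (j, s')) -> i != j.
Proof.
by case/root_pairP => /eqP H1 /eqP H2; apply/eqP => E; subst j; move: H1 H2; case: s s' => -[].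
Qed.

Lemma long_root (r : D) : long_roots c eps r -> root_system r.
Proof.
case=> i [j [s [s' [ij ->]]]]; apply/root_system_signed_eps.
by exists (inl (i, s)), (inl (j, s')); split=> //; exact: root_pair_inl.
Qed.

Lemma root_cases (r : D) : root_system r -> long_roots c eps r \/ (0 < M)%N /\ short_roots c eps r.
Proof.
case/root_system_signed_eps => -[[i s]|m] [[[j s']|m'] [kl ->]] //.
- by left; exists i, j, s, s'; split=> //; exact: root_pair_neq kl.
- by right; split; [case: m' {kl} => m' /=; lia|rewrite addr0; exact: short_signed_eps].
- by right; split; [case: m {kl} => m /=; lia|rewrite add0r; exact: short_signed_eps].
Qed.

Lemma root_typeB : (0 < M)%N -> typeB c eps.
Proof.
move=> M0; split; first exact: (eps_frame frame cE).
apply/seteqP; split=> r.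
  by case/root_cases => [|[_]]; [right|left].
case=> [/short_rootsP[i [s ->]]|]; last exact: long_root.
apply/root_system_signed_eps; exists (inl (i, s)), (inr (Ordinal M0)).
by split=> //=; rewrite addr0.
Qed.

Lemma root_typeD : M = 0%N -> typeD c eps.
Proof.
move=> M0; split; first exact: (eps_frame frame cE).
apply/seteqP; split=> r; last exact: long_root.
by case/root_cases => // -[]; rewrite {1}M0.
Qed.

Lemma partial_jet (F : 'M[R]_d.+2 -> C) x delta beta (l : D) :
  jet_at F x delta beta -> partial c l F x = delta (vsval (coroot l)).
Proof.
move=> [jd _]; have := subvsP (coroot l); rewrite complexify_mem => /andP[cR cI].
rewrite /partial /actr (is_cderiveE (jd _ (c_alg cE cR))) (is_cderiveE (jd _ (c_alg cE cI))).
by rewrite [in RHS](mxReIm (vsval (coroot l))) linearD linearZ.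
Qed.

Lemma partial_partial_jet (F : 'M[R]_d.+2 -> C) x delta beta (l m : D) :
  jet_at F x delta beta ->
  partial c l (partial c m F) x = beta (vsval (coroot m)) (vsval (coroot l)).
Proof.
move=> [_ jb].
have := subvsP (coroot l); rewrite complexify_mem => /andP[/(c_alg cE) lR /(c_alg cE) lI].
have := subvsP (coroot m); rewrite complexify_mem => /andP[/(c_alg cE) mR /(c_alg cE) mI].
have H X : alg X -> actr (partial c m F) X x = beta (vsval (coroot m)) (mxC X).
  move=> aX; apply: is_cderiveE.
  have := is_cderiveD (jb _ _ mR aX) (is_cderiveZ 'i%C (jb _ _ mI aX)).
  by rewrite [in X in _ -> X](mxReIm (vsval (coroot m))) linearD linearZ add_lfunE scale_lfunE.
rewrite {1}/partial !H//.
by rewrite [in RHS](mxReIm (vsval (coroot l))) linearD linearZ.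
Qed.

(** The coordinate matrix m of the orthonormal basis satisfies m (2 m^T) = 1, the 2 being B(Hc i, Hc
    i). A one-sided inverse of a square matrix is two-sided, so m^T m = 1/2. *)
Lemma orthonormal_sum (xi : N.-tuple D) (beta : 'Hom('M[C]_d.+2, 'Hom('M[C]_d.+2, C^o))) :
  orthonormal_basis c xi ->
  \sum_i beta (vsval (coroot (tnth xi i))) (vsval (coroot (tnth xi i))) =
  2^-1 * \sum_i beta (Hc i) (Hc i).
Proof.
move=> [_ on].
pose m := \matrix_(i < N, j < N) (Bform (vsval (coroot (tnth xi i))) (Hc j) / 2 : C).
have CE i : vsval (coroot (tnth xi i)) = \sum_j m i j *: Hc j.
  rewrite {1}(cC_expand frame cE (subvsP (coroot (tnth xi i)))); apply: eq_bigr => j _.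
  by rewrite mxE.
have mm : m *m (2 *: m^T) = 1%:M.
  apply/matrixP => i j; rewrite -scalemxAr [LHS]mxE [(m *m _) i j]mxE [RHS]mxE.
  rewrite -[RHS]on /dual_form [X in Bform _ X]CE Bform_sumr mulr_sumr; apply: eq_bigr => k _.
  by rewrite BformZr !mxE; move: (Bform _ _) (Bform _ _) => s t; field; rewrite ?C2_neq0.
have mmT := mulmx1C mm.
have mjk j k : \sum_i m i j * m i k = 2^-1 * (j == k)%:R.
  have := congr1 (fun A : 'M[C]_N => A j k) mmT; rewrite -scalemxAl [LHS]mxE [(_ *m m) j k]mxE [RHS]mxE.
  move=> <-; rewrite mulKf ?C2_neq0//; apply: eq_bigr => i _; by rewrite [m^T _ _]mxE.
under eq_bigr do rewrite CE bilinear_sums.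
exact: (orthogonal_sums (fun j k => beta (Hc j) (Hc k)) mjk).
Qed.

Definition root_index := ('I_N * bool + ('I_N * bool) * ('I_N * bool))%type.

(** The ordering lists each long root once, with both signs; short roots occur only when some vector
    is killed. *)
Definition valid (q : root_index) : bool :=
  match q with inl _ => (0 < M)%N | inr (x, y) => (x.1 < y.1)%N end.

Definition root_of (q : root_index) : D :=
  match q with inl x => signed_eps (inl x) | inr (x, y) => signed_eps (inl x) + signed_eps (inl y) end.

Definition root_coord (q : root_index) (m : 'I_N) : C :=
  match q with
  | inl x => (-1) ^+ x.2 *+ (x.1 == m)
  | inr (x, y) => (-1) ^+ x.2 *+ (x.1 == m) + (-1) ^+ y.2 *+ (y.1 == m)
  end.

Lemma signed_eps_Hs x m : signed_eps (inl x) (Hs m) = 2 * ((-1) ^+ x.2 *+ (x.1 == m)) :> C.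
Proof.
case: x => i s /=; rewrite scale_lfunE (eps_val frame cE) /GRing.scale/=.
by case: (i == m); rewrite ?mulr1 ?mulr0 ?mulr1n ?mulr0n ?mulr0// mulrC.
Qed.

Lemma root_of_Hs q m : root_of q (Hs m) = 2 * root_coord q m :> C.
Proof.
by case: q => [x|[x y]]; rewrite /root_of /root_coord ?add_lfunE !signed_eps_Hs ?mulrDr.
Qed.

Lemma signC_inj (s t : bool) : (-1) ^+ s = (-1) ^+ t :> C -> s = t.
Proof. exact: signr_inj. Qed.

Lemma signC_eq0 (s t : bool) n : (-1) ^+ s = (-1) ^+ t *+ n :> C -> (0 < n)%N.
Proof. by case: n => // /eqP; rewrite mulr0n signr_eq0. Qed.

Lemma root_of_inj q q' : valid q -> valid q' -> root_of q = root_of q' -> q = q'.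
Proof.
move=> vq vq' E.
have {}E m : root_coord q m = root_coord q' m.
  apply: (mulfI (C2_neq0 (R := R))); rewrite -!root_of_Hs; exact: (congr1 (fun h : D => h (Hs m) : C) E).
(* A long root has two nonzero coordinates, a short one has a single one. *)
have short_long (i : 'I_N) (s : bool) (x y : 'I_N * bool) : (x.1 < y.1)%N ->
    root_coord (inr (x, y)) =1 root_coord (inl (i, s)) -> False.
  move=> xy H; have nxy : (x.1 == y.1) = false by apply/eqP => e; rewrite e ltnn in xy.
  have := H x.1; have := H y.1; rewrite /root_coord/= nxy [y.1 == x.1]eq_sym nxy.
  rewrite !eqxx !mulr1n !mulr0n addr0 add0r => /signC_eq0; case: eqP => // iy _ /signC_eq0.
  by rewrite iy [y.1 == x.1]eq_sym nxy.
case: q q' vq vq' E => [[i s]|[x y]] [[i' s']|[x' y']] /= vq vq' E.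
- have := E i; rewrite eqxx mulr1n => H; have := signC_eq0 H; case: eqP => // ii _.
  by move: H; rewrite ii eqxx mulr1n => /signC_inj ->.
- by case: (short_long i s x' y' vq') => m; exact/esym/E.
- by case: (short_long i' s' x y vq) => m; exact: E.
- have nxy : (x.1 == y.1) = false by apply/eqP => e; rewrite e ltnn in vq.
  have nxy' : (x'.1 == y'.1) = false by apply/eqP => e; rewrite e ltnn in vq'.
  have := E x.1; have := E y.1; rewrite nxy [y.1 == x.1]eq_sym nxy.
  rewrite !eqxx !mulr1n !mulr0n addr0 add0r => Hy Hx.
  have mem (z : 'I_N * bool) :
      (-1) ^+ z.2 = (-1) ^+ x'.2 *+ (x'.1 == z.1) + (-1) ^+ y'.2 *+ (y'.1 == z.1) :> C ->
      x'.1 = z.1 \/ y'.1 = z.1.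
    case: eqP; first by left.
    case: eqP; first by right.
    by move=> _ _ /eqP; rewrite !mulr0n addr0 signr_eq0.
  have [xx yy] : x'.1 = x.1 /\ y'.1 = y.1.
    case: (mem _ Hx) (mem _ Hy) => e1 [] e2; split => //;
    by move: vq vq'; rewrite -?e1 -?e2; lia.
  move: Hx Hy; rewrite xx yy !eqxx nxy [y.1 == x.1]eq_sym nxy !mulr0n !mulr1n addr0 add0r.
  move=> /signC_inj s1 /signC_inj s2.
  by rewrite (surjective_pairing x) (surjective_pairing y) (surjective_pairing x')
    (surjective_pairing y') xx yy s1 s2.
Qed.

Lemma epskN i s : signed_eps (inl (i, ~~ s)) = - signed_eps (inl (i, s)).
Proof. by rewrite /= -scaleNr; case: s; rewrite /= ?expr0 ?expr1 ?opprK. Qed.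

Lemma root_system_root_of (r : D) : root_system r <-> exists2 q, valid q & r = root_of q.
Proof.
split=> [|[[x|[x y]] /= v ->]].
- case/root_cases => [[i [j [s [s' [ij ->]]]]]|[M0 /short_rootsP[i [s ->]]]].
    have [lt|lt|/ord_inj E] := ltngtP i j; last by rewrite E eqxx in ij.
      by exists (inr ((i, s), (j, s'))).
    by exists (inr ((j, s'), (i, s))) => //=; rewrite addrC.
  by exists (inl (i, s)).
- apply/root_system_signed_eps; exists (inl x), (inr (Ordinal v)).
  by rewrite /= addr0; case: x.
- apply/root_system_signed_eps; exists (inl x), (inl y); split => //.
  case: x y v => [i s] [j s'] /= v; apply: root_pair_inl.
  by apply/eqP => e; rewrite e ltnn in v.
Qed.

Arguments signed_eps : simpl never.

(** P and -P together list every root once, and G is even. This is why the radial sum does not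
    depend on the choice of P. *)
Lemma positive_sum (P : seq D) (G : D -> C) : positive_system c P -> (forall r, G (- r) = G r) ->
  2 * (\sum_(r <- P) G r) = \sum_(q | valid q) G (root_of q).
Proof.
move=> [uP PE Pn _] GN.
have -> : 2 * (\sum_(r <- P) G r) = \sum_(r <- P ++ [seq - r | r <- P]) G r.
  rewrite big_cat big_map/= mulr2n mulrDl mul1r; congr (_ + _).
  by apply: eq_bigr => r _; rewrite GN.
have -> : \sum_(q | valid q) G (root_of q) = \sum_(r <- [seq root_of q | q <- enum valid]) G r.
  by rewrite big_map big_enum.
apply: perm_big; apply: uniq_perm.
- rewrite cat_uniq uP (map_inj_uniq (can_inj (@opprK _))) uP andbT/=.
  by apply/hasPn => r /mapP[r' r'P ->]; exact: Pn.
- rewrite map_inj_in_uniq ?enum_uniq// => q q'; rewrite !mem_enum => vq vq'.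
  exact: root_of_inj.
- move=> r; rewrite mem_cat; apply/idP/idP => [H|/mapP[q vq ->]].
    have /root_system_root_of[q vq ->] : root_system r.
      apply/PE; case/orP: H => [|/mapP[r' r'P ->]]; [by left|by right; rewrite opprK].
    by apply: map_f; rewrite mem_enum.
  have /PE[->//|H] : root_system (root_of q).
    by apply/root_system_root_of; exists q => //; move: vq; rewrite mem_enum.
  by apply/orP; right; apply/mapP; exists (- root_of q) => //; rewrite opprK.
Qed.

Lemma positive_sumE (P : seq D) (G : D -> C) : positive_system c P -> (forall r, G (- r) = G r) ->
  \sum_(r <- P) G r = (if (0 < M)%N then \sum_i G (signed_eps (inl (i, false))) else 0) +
    \sum_(i : 'I_N) \sum_(j : 'I_N | (i < j)%N)
      (G (signed_eps (inl (i, false)) + signed_eps (inl (j, false))) +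
       G (signed_eps (inl (i, false)) + signed_eps (inl (j, true)))).
Proof.
move=> pP GN; apply: (mulfI (C2_neq0 (R := R))); rewrite (positive_sum pP GN) big_sumType/=.
rewrite mulrDr; congr (_ + _).
  case: ifP => M0; last by rewrite big_pred0_eq mulr0.
  rewrite (eq_bigr (fun x => G (signed_eps (inl (x.1, x.2))))); last by case.
  rewrite -(pair_bigA _ (fun i s => G (signed_eps (inl (i, s)))))/= mulr_sumr; apply: eq_bigr => i _.
  by rewrite big_bool (epskN i false) GN mulr2n mulrDl mul1r.
rewrite (eq_bigl (fun z : ('I_N * bool) * ('I_N * bool) => true && (z.1.1 < z.2.1)%N)); last by case.
rewrite (eq_bigr (fun z => G (signed_eps (inl z.1) + signed_eps (inl z.2)))); last by case.
rewrite -(pair_big_dep xpredT (fun x y : 'I_N * bool => (x.1 < y.1)%N)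
  (fun x y => G (signed_eps (inl x) + signed_eps (inl y)))).
rewrite (eq_bigr (fun x : 'I_N * bool =>
  \sum_(y : 'I_N * bool | (x.1 < y.1)%N) G (signed_eps (inl (x.1, x.2)) + signed_eps (inl y)))); last by case.
rewrite -(pair_bigA _ (fun (i : 'I_N) (s : bool) =>
  \sum_(y : 'I_N * bool | (i < y.1)%N) G (signed_eps (inl (i, s)) + signed_eps (inl y)))).
rewrite mulr_sumr; apply: eq_bigr => i _.
have split_y s : \sum_(y : 'I_N * bool | (i < y.1)%N) G (signed_eps (inl (i, s)) + signed_eps (inl y)) =
    \sum_(j : 'I_N | (i < j)%N) (G (signed_eps (inl (i, s)) + signed_eps (inl (j, true))) +
                               G (signed_eps (inl (i, s)) + signed_eps (inl (j, false)))).
  rewrite (eq_bigr (fun y => G (signed_eps (inl (i, s)) + signed_eps (inl (y.1, y.2))))); last by case.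
  rewrite (eq_bigl (fun y : 'I_N * bool => (i < y.1)%N && true)); last by move=> y; rewrite andbT.
  rewrite -(pair_big (fun j : 'I_N => (i < j)%N) xpredT
    (fun j s' => G (signed_eps (inl (i, s)) + signed_eps (inl (j, s'))))).
  by apply: eq_bigr => j _; rewrite big_bool.
apply: (etrans (big_bool _ _)); apply: (etrans (congr2 +%R (split_y true) (split_y false))).
refine (@signed_sum C 'I_N (fun j => (i < j)%N)
  (fun s s' j => G (signed_eps (inl (i, s)) + signed_eps (inl (j, s')))) _) => s s' j.
by rewrite !epskN -opprD GN.
Qed.

End RadialOperator.

Arguments signed_eps : simpl never.

(** * The operator L(k) in terms of jets *)

Section LopFrame.
Context {R : realType} {d p N M : nat}.
Variables (a b : 'I_N -> 'I_d.+2) (u : 'I_M -> 'I_d.+2) (c : {vspace 'M[R]_d.+2}).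
Hypothesis frame : is_frame (p := p) a b u.
Hypothesis cE : c = <<[tuple Fmx (a i) (b i) | i < N]>>%VS.
Hypothesis Mp : `|d%:R - 2 - 2 * p%:R| = M%:R :> R.
Local Notation C := R[i].
Local Notation I := ('I_N * bool + 'I_M)%type.
Local Notation Hc := (Hc (R := R) a b u).
Local Notation HH := (HH (R := R) a b u).
Local Notation cC := (complexify c).
Local Notation T := (subvs_of cC).
Local Notation D := (dualC c).
Local Notation coroot := (@Defs.coroot R d c).
Local Notation eps := (eps u cE).
Local Notation signed_eps := (signed_eps u cE).
Local Notation root_of := (root_of u cE).
Local Notation mult := (multiplicity c p eps).

(** [multiplicity] tests shortness first, so a long root has to be told apart from short ones
    through its coordinates. *)
Lemma long_not_short (x y : 'I_N * bool) : (x.1 < y.1)%N -> ~ short_roots c eps (root_of (inr (x, y))).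
Proof.
move=> xy /short_rootsP[i [s E]].
have {}E m : root_coord (inr (x, y)) m = root_coord (inl (i, s)) m :> C.
  apply: (mulfI (C2_neq0 (R := R))); rewrite -!(root_of_Hs frame cE).
  exact: (congr1 (fun h : D => h (Hs u cE m) : C) E).
have nxy : (x.1 == y.1) = false by apply/eqP => e; rewrite e ltnn in xy.
have := E x.1; have := E y.1; rewrite /root_coord/= nxy [y.1 == x.1]eq_sym nxy.
rewrite !eqxx !mulr1n !mulr0n addr0 add0r => /signC_eq0; case: eqP => // iy _ /signC_eq0.
by rewrite iy [y.1 == x.1]eq_sym nxy.
Qed.

Lemma mult_short i s : mult (signed_eps (inl (i, s))) = M%:R / 2.
Proof.
rewrite /multiplicity; case: asboolP => [_|[]]; last exact: short_signed_eps.
by rewrite Mp rmorphM fmorphV !rmorph_nat.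
Qed.

Lemma mult_long (x y : 'I_N * bool) : (x.1 < y.1)%N -> mult (signed_eps (inl x) + signed_eps (inl y)) = 2^-1.
Proof.
move=> xy; rewrite /multiplicity; case: asboolP => [H|_].
  by case: (long_not_short xy).
by rewrite rmorphM fmorphV rmorph1 mul1r rmorph_nat.
Qed.

Lemma multN r : mult (- r) = mult r.
Proof.
rewrite /multiplicity; congr ((if _ then _ else _)%:C); apply/asboolP/asboolP;
move=> -[i [|] E]; exists i.
- by right; rewrite -E opprK.
- by left; apply: oppr_inj.
- by right; rewrite E.
- by left; rewrite E opprK.
Qed.

Section Weights.
Variable z : 'I_N -> R.
Local Notation Z := (Zel a b z).
Local Notation e := (eigv (M := M) b z).

Lemma Zel_mem : mxC Z \in cC.
Proof.
rewrite complexify_mem mxRe_mxC mxIm_mxC mem0v andbT cE /Zel.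
apply: memv_suml => i _; apply: memvZ; apply: memv_span.
by rewrite -(tnth_mktuple (fun i => Fmx (a i) (b i)) i) mem_tnth.
Qed.

Lemma exp_weightD (r q : D) : exp_weight c (r + q) Z = exp_weight c r Z * exp_weight c q Z.
Proof. by rewrite /exp_weight add_lfunE cexpD. Qed.

Lemma exp_weightN (r : D) : exp_weight c (- r) Z = (exp_weight c r Z)^-1.
Proof. by rewrite /exp_weight opp_lfunE cexpNV. Qed.

Lemma exp_weight_neq0 (r : D) : exp_weight c r Z != 0.
Proof. exact: cexp_neq0. Qed.

Lemma Bform_Hc_Zel i : Bform (Hc i) (mxC Z) = 2 * (om b i * (z i)%:C) :> C.
Proof.
have ZE : mxC Z = \sum_j ((z j)%:C * om b j) *: Hc j.
  rewrite /Zel (big_morph _ (@mxCD R _ _) (mxC0 _ _)); apply: eq_bigr => j _.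
  rewrite mxCZ Hc_Fmx scalerA; congr (_ *: _).
  have := sg_sqr (R := R) (b j); have := om_sqr (R := R) b j.
  move: (sg _) (om _ _) => s w ww ss.
  transitivity ((z j)%:C * - (s * (w * w))); last by ring.
  by rewrite ww !mulrN ss mulr1 opprK.
rewrite ZE Bform_sumr (bigD1 i)//= [X in _ + X]big1 ?addr0 => [|j ji].
  by rewrite BformZr (Bform_Hc frame) eqxx mulr1 mulrC [X in _ * X]mulrC.
by rewrite BformZr (Bform_Hc frame) eq_sym (negPf ji) !mulr0.
Qed.

(** R is doubled, so e^alpha is a square of eigenvalues: the same square that enters the regularity
    condition and [cth]. *)
Lemma exp_weight_signed_eps k : exp_weight c (signed_eps k) Z = e k ^+ 2.
Proof.
case: k => [[i s]|m]; last first.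
  by rewrite /exp_weight /= lfunE cexp0 expr1n.
rewrite /exp_weight /eigv cexp2 (corootP frame cE) (coroot_signed_eps frame cE).
rewrite (vsprojK Zel_mem) HH_inl BformZl Bform_Hc_Zel.
by congr cexp; rewrite mulrCA.
Qed.

Lemma cth_inv (q : C) : q != 0 -> (1 + q^-1) / (1 - q^-1) = cth q.
Proof.
move=> q0; have e1 : 1 + q^-1 = q^-1 * (q + 1) by rewrite mulrDr mulVf// mulr1.
have e2 : 1 - q^-1 = q^-1 * (q - 1) by rewrite mulrBr mulVf// mulr1.
by rewrite e1 e2 invfM mulrACA mulfV ?invr_eq0// mul1r.
Qed.

Lemma actr_mulr (f : 'M[R]_d.+2 -> C) X y (t : 'M[R]_d.+2) :
  actr f X (y *m t) = actr (fun g => f (g *m t)) X y.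
Proof. by rewrite /actr; congr cderiv0; apply/funext => s; rewrite mulmxA. Qed.

Lemma partial_mulr (f : 'M[R]_d.+2 -> C) (l : D) y (t : 'M[R]_d.+2) :
  partial c l f (y *m t) = partial c l (fun g => f (g *m t)) y.
Proof. by rewrite /partial !actr_mulr. Qed.

Lemma partial_partial_mulr (f : 'M[R]_d.+2 -> C) (l m : D) y (t : 'M[R]_d.+2) :
  partial c l (partial c m f) (y *m t) = partial c l (partial c m (fun g => f (g *m t))) y.
Proof.
rewrite partial_mulr; congr (partial c l _ y).
by apply/funext => g; exact: partial_mulr.
Qed.

Lemma Lop_frame (f : 'M[R]_d.+2 -> C) (t : 'M[R]_d.+2) (xi : N.-tuple D) (P : seq D) delta beta :
  positive_system c P -> orthonormal_basis c xi ->
  jet_at (fun g => f (g *m t)) (expmx Z) delta beta ->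
  Lop c xi P mult t f Z = 2^-1 * \sum_i beta (Hc i) (Hc i) +
    (M%:R / 2) * \sum_i gshort a b u e delta i +
    2^-1 * \sum_(i : 'I_N) \sum_(j : 'I_N | (i < j)%N)
       (glong a b u e delta i j false + glong a b u e delta i j true).
Proof.
move=> pP on jf; rewrite /Lop -addrA; congr (_ + _).
  rewrite -(orthonormal_sum frame cE beta on); apply: eq_bigr => i _.
  by rewrite partial_partial_mulr (partial_partial_jet cE _ _ jf).
pose G (r : D) : C := mult r * (cth (exp_weight c r Z) * delta (vsval (coroot r))).
transitivity (\sum_(r <- P) G r).
  apply: eq_bigr => r _; rewrite partial_mulr (partial_jet cE _ jf) exp_weightN.
  by rewrite cth_inv ?exp_weight_neq0// -mulrA.
have GN r : G (- r) = G r.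
  rewrite /G multN exp_weightN cthV ?exp_weight_neq0// (corootN frame cE) !linearN/=.
  by rewrite mulrNN.
rewrite (positive_sumE frame cE pP GN); congr (_ + _).
  have E i : G (signed_eps (inl (i, false))) = M%:R / 2 * gshort a b u e delta i.
    by rewrite /G mult_short exp_weight_signed_eps (coroot_signed_eps frame cE).
  (* Without killed vectors there are no short roots, and the short term has coefficient 0. *)
  case: ifP => M0; last by have -> : (M%:R : C) = 0 by [case: (M) M0]; rewrite !mul0r.
  by rewrite mulr_sumr; apply: eq_bigr => i _; exact: E.
rewrite mulr_sumr; apply: eq_bigr => i _; rewrite mulr_sumr; apply: eq_bigr => j ij.
have E s : G (signed_eps (inl (i, false)) + signed_eps (inl (j, s))) = 2^-1 * glong a b u e delta i j s.
  rewrite /G (mult_long (x := (i, false)) (y := (j, s)) ij) exp_weightD !exp_weight_signed_eps -exprMn.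
  have -> : vsval (coroot (signed_eps (inl (i, false)) + signed_eps (inl (j, s)))) = Hc i + (-1) ^+ s *: Hc j.
    by rewrite (corootD frame cE) linearD/= !(coroot_signed_eps frame cE) (HH_inl _ _ _ j s).
  by [].
by rewrite mulrDr; exact: (congr2 +%R (E false) (E true)).
Qed.

End Weights.

End LopFrame.

(** * The two Casimir actions *)

Section Twist.
Context {R : realType} {d p : nat}.
Hypothesis pd : (p <= d)%N.
Local Notation M := 'M[R]_d.+2.
Variable t : M.
Hypothesis Gt : SO0 d t.
Local Notation C := R[i].

Lemma Bform_Ad (X Y : M) : Bform (Ad t X) (Ad t Y) = Bform X Y.
Proof.
have tu := isom_unit (G_isom Gt).
rewrite /Bform /Ad !mulmxA (mulmxKV tu) mxtrace_mulC !mulmxA (mulVmx tu) mul1mx.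
by [].
Qed.

Lemma Ad_alg X : alg X -> alg (Ad t X).
Proof. by apply: alg_isom; exact: G_isom. Qed.

(** Biorthogonality makes both families free, and their length is the dimension. *)
Lemma dual_basesP (X Y : (\dim (so_conf d : {vspace M})).-tuple M) :
  (forall i, alg (tnth X i)) -> (forall i, alg (tnth Y i)) ->
  (forall i j, Bform (tnth X i) (tnth Y j) = (i == j)%:R) -> dual_bases X Y.
Proof.
have basis (V W : (\dim (so_conf d : {vspace M})).-tuple M) : (forall i, alg (tnth V i)) ->
    (forall i j, Bform (tnth V i) (tnth W j) = (i == j)%:R) -> basis_of (so_conf d) V.
  move=> aV VW; rewrite basisEfree size_tuple leqnn andbT; apply/andP; split; last first.
    by apply/span_subvP => v /tnthP[i ->]; apply/algP.
  apply/freeP => k k0 i; rewrite -[LHS]mulr1 -[1]/(true%:R) -(eqxx i) -VW.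
  have := congr1 (fun A : M => Bform A (tnth W i)) k0.
  rewrite /Bform mulmx_suml linear_sum (bigD1 i)//= big1 => [|j ji].
    by rewrite addr0 -tnth_nth -scalemxAl linearZ /= mul0mx mxtrace0.
  have := VW j i; rewrite (negPf ji) /Bform -tnth_nth -scalemxAl linearZ /= => ->.
  by rewrite mulr0.
move=> aX aY XY; split => //; first exact: basis XY.
by apply: (basis Y X) => // i j; rewrite /Bform mxtrace_mulC [LHS]XY eq_sym.
Qed.

Lemma dual_bases_Ad (X Y : (\dim (so_conf d : {vspace M})).-tuple M) :
  dual_bases X Y -> dual_bases [tuple Ad t (tnth Y i) | i < _] [tuple Ad t (tnth X i) | i < _].
Proof.
move=> [bX bY XY].
have aX i : alg (tnth X i) by apply/algP; apply: (basis_mem bX); exact: mem_tnth.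
have aY i : alg (tnth Y i) by apply/algP; apply: (basis_mem bY); exact: mem_tnth.
apply: dual_basesP => [i|i|i j]; rewrite !tnth_mktuple; [exact: Ad_alg|exact: Ad_alg|].
by rewrite Bform_Ad /Bform mxtrace_mulC [LHS]XY eq_sym.
Qed.

Section Jets.
Variables (f : M -> C) (x : M).
Hypothesis Gx : SO0 d x.
Variables X Y : (\dim (so_conf d : {vspace M})).-tuple M.
Hypothesis dXY : dual_bases X Y.

Lemma casimirr_jet delta beta : jet_at (fun g => f (g *m t)) x delta beta ->
  casimirr f X Y (x *m t) = \sum_i beta (mxC (tnth X i)) (mxC (tnth Y i)).
Proof.
case: dXY => bX bY _ [_ jb]; apply: eq_bigr => i _.
have aX : alg (tnth X i) by apply/algP; apply: (basis_mem bX); exact: mem_tnth.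
have aY : alg (tnth Y i) by apply/algP; apply: (basis_mem bY); exact: mem_tnth.
have E : (fun g => actr f (tnth X i) (g *m t)) = actr (fun g => f (g *m t)) (tnth X i).
  by apply/funext => g; exact: actr_mulr.
apply: etrans (is_cderiveE (jb _ _ aX aY)).
by apply: (etrans (actr_mulr _ _ _ _)); rewrite E.
Qed.

Lemma einv_exp_mul (A g : M) s : alg A -> einv (expmx (s *: - A) *m g) = einv g *m expmx (s *: A).
Proof.
move=> aA; rewrite einv_mul einv_exp; first by rewrite scalerN opprK.
by apply: algZ; exact: algN.
Qed.

Lemma mul_exp_Ad (A : M) s : t *m expmx (s *: A) = expmx (s *: Ad t A) *m t.
Proof.
have tu := isom_unit (G_isom Gt).
have := expmx_conj (s *: A) (mulmxV tu); rewrite -scalemxAr -scalemxAl => <-.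
by rewrite mulmxKV.
Qed.

(** Inversion turns right translation by exp(sA) into left translation by its inverse, and moving it
    past [t] costs Ad(t). *)
Lemma actl_einv (h : M -> C) (A g : M) : alg A ->
  actl A h (einv g *m t) = actr (fun g => h (einv g *m t)) (- Ad t A) g.
Proof.
move=> aA; rewrite /actl /actr; congr cderiv0; apply/funext => s.
by rewrite (einv_exp_mul _ _ (Ad_alg aA)) -!mulmxA mul_exp_Ad.
Qed.

(** The two signs cancel, and the order of derivation exchanges [X] and [Y]. By [dual_bases_Ad] the
    right side is again a Casimir sum over dual bases. *)
Lemma casimirl_jet delta beta : jet_at (fun g => f (einv g *m t)) (einv x) delta beta ->
  casimirl X Y f (x *m t) =
  \sum_i beta (mxC (Ad t (tnth Y i))) (mxC (Ad t (tnth X i))).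
Proof.
case: dXY => bX bY _ [_ jb]; apply: eq_bigr => i _.
have aX : alg (tnth X i) by apply/algP; apply: (basis_mem bX); exact: mem_tnth.
have aY : alg (tnth Y i) by apply/algP; apply: (basis_mem bY); exact: mem_tnth.
have E : (fun g => actl (tnth Y i) f (einv g *m t)) =
    actr (fun g => f (einv g *m t)) (- Ad t (tnth Y i)).
  by apply/funext => g; exact: actl_einv.
have -> : x *m t = einv (einv x) *m t.
  by rewrite (einvE (G_einv Gx)) (einvE Gx) invmxK.
apply: (etrans (actl_einv _ _ aX)); rewrite E.
apply: (etrans (is_cderiveE (jb _ _ (algN (Ad_alg aY)) (algN (Ad_alg aX))))).
by rewrite !mxCN !linearN/= opp_lfunE opprK.
Qed.

End Jets.

Hypothesis st : sigma p t = t.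

Lemma sigma_minus_Ad X : sigma_minus d p X -> sigma_minus d p (Ad t X).
Proof.
move=> [/algP aX sX]; split; first by apply/algP; exact: Ad_alg.
have sV : Smx d p *m invmx t *m Smx d p = invmx t.
  have tu := isom_unit (G_isom Gt); have /sigma_comm tS := st.
  have E : Smx d p *m invmx t = invmx t *m Smx d p.
    have := congr1 (fun A => invmx t *m A *m invmx t) tS.
    by rewrite (mulKmx tu) (mulmxA (invmx t)) (mulmxK tu).
  by rewrite E -mulmxA Smx_sqr mulmx1.
rewrite /sigma /Ad; transitivity (Smx d p *m t *m Smx d p *m (Smx d p *m X *m Smx d p) *m
  (Smx d p *m invmx t *m Smx d p)).
  have SK (A : M) : Smx d p *m (Smx d p *m A) = A by rewrite mulmxA Smx_sqr mul1mx.
  by rewrite -!mulmxA !SK.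
rewrite sV -[Smx d p *m t *m _]/(sigma p t) st -[Smx d p *m X *m _]/(sigma p X) sX.
by rewrite mulmxN mulNmx.
Qed.

Lemma twist_inv : SO0 d (invmx t) /\ sigma p (invmx t) = invmx t.
Proof.
have tu := isom_unit (G_isom Gt); split; first by rewrite -(einvE Gt); exact: G_einv.
have /sigma_comm tS := st; apply/sigma_comm.
have := congr1 (fun A => invmx t *m A *m invmx t) tS.
by rewrite (mulKmx tu) (mulmxA (invmx t)) (mulmxK tu).
Qed.

End Twist.

Lemma lfun_oppD (K : fieldType) (V : vectType K) (l l' : 'Hom(V, K^o)) x A B :
  l' A = - l A -> l' B = - l B -> l' (A + x *: B) = - l (A + x *: B).
Proof.
move=> hA hB; have D (h : 'Hom(V, K^o)) : h (A + x *: B) = h A + x *: h B.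
  by rewrite linearD linearZ.
by rewrite !D hA hB scalerN [RHS]opprD.
Qed.

Lemma lfun_oppZ (K : fieldType) (V : vectType K) (l l' : 'Hom(V, K^o)) x A :
  l' A = - l A -> l' (x *: A) = - l (x *: A).
Proof. by move=> hA; rewrite !linearZ/= hA scalerN. Qed.

Lemma lfun_eqZ (K : fieldType) (V : vectType K) (l l' : 'Hom(V, 'Hom(V, K^o))) x A :
  l' A A = l A A -> l' (x *: A) (x *: A) = l (x *: A) (x *: A).
Proof.
move=> hA; have E (h : 'Hom(V, 'Hom(V, K^o))) : h (x *: A) (x *: A) = x *: (x *: h A A).
  rewrite linearZ /=; have -> : h (x *: A) = x *: h A by rewrite linearZ.
  by rewrite scale_lfunE.
by rewrite !E hA.
Qed.

(** * Both Casimir actions at a regular point *)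

Section Final.
Context {R : realType} {d p N M : nat}.
Hypothesis pd : (p <= d)%N.
Variables (a b : 'I_N -> 'I_d.+2) (u : 'I_M -> 'I_d.+2) (c : {vspace 'M[R]_d.+2}).
Hypothesis frame : is_frame (p := p) a b u.
Hypothesis cE : c = <<[tuple Fmx (a i) (b i) | i < N]>>%VS.
Hypothesis Mp : `|d%:R - 2 - 2 * p%:R| = M%:R :> R.
Variable t : 'M[R]_d.+2.
Hypothesis Gt : SO0 d t.
Hypothesis st : sigma p t = t.
Local Notation C := R[i].
Local Notation Hc := (Hc (R := R) a b u).
Variable z : 'I_N -> R.
Local Notation Z := (Zel a b z).
Local Notation nZ := (Zel a b (fun i => - z i)).
Local Notation e := (eigv (M := M) b z).

Lemma ZelN : nZ = - Z.
Proof. by rewrite /Zel -sumrN; apply: eq_bigr => i _; rewrite scaleNr. Qed.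

Lemma eigvN k : eigv (M := M) b (fun i => - z i) k = e (partner k).
Proof.
case: k => [[i s]|m] //; rewrite /eigv /partner rmorphN !mulrN -mulNr.
have -> : - (-1) ^+ s = (-1) ^+ (~~ s) :> C by case: s; rewrite ?expr0 ?expr1 ?opprK.
by [].
Qed.

(** Ad(t) preserves the -1 eigenspace of [sigma], so the intersection formed with exp(Z) is
    contained in the one formed with exp(Z) t and inherits its commutativity. *)
Lemma twisted_regular k l : Grs d p (expmx Z *m t) -> root_pair k l -> (e k * e l) ^+ 2 != 1.
Proof.
move=> [_ _ comm]; apply: (comm_regular frame).
have tu := isom_unit (G_isom Gt); have [Gti sti] := twist_inv Gt st.
have gu := isom_unit (G_isom (G_exp (Zel_alg a b z))).
have mem X : (sigma_minus d p `&` (Ad (expmx Z) @` sigma_minus d p)) X ->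
    (sigma_minus d p `&` (Ad (expmx Z *m t) @` sigma_minus d p)) X.
  move=> [sX [V sV VX]]; split => //; exists (Ad (invmx t) V).
    exact: (sigma_minus_Ad Gti sti).
  have inv_mul : invmx (expmx Z *m t) = invmx t *m invmx (expmx Z) := invrM gu tu.
  rewrite -VX /Ad invmxK inv_mul !mulmxA; congr (_ *m invmx (expmx Z)).
  by rewrite (mulmxK tu) (mulmxK tu).
by move=> X Y /mem X1 /mem Y1; exact: comm.
Qed.

Section Function.
Variables (P : seq (dualC c)) (xi : N.-tuple (dualC c)).
Variables (X Y : (\dim (so_conf d : {vspace 'M[R]_d.+2})).-tuple 'M[R]_d.+2).
Variable f : 'M[R]_d.+2 -> C.
Hypothesis pP : positive_system c P.
Hypothesis on : orthonormal_basis c xi.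
Hypothesis dXY : dual_bases X Y.
Hypothesis sf : smooth_on (SO0 d) f.
Hypothesis zf : zonal p f.
Hypothesis Gr : Grs d p (expmx Z *m t).
Local Notation L := (Lop c xi P (multiplicity c p (eps u cE)) t f Z).

Let GZ : SO0 d (expmx Z). Proof. exact: G_exp (Zel_alg a b z). Qed.

(** [casimirr] is read off the jet of [F1] at exp(Z), and [casimirl] off the jet of [F2] at
    exp(-Z). *)
Let F1 g := f (g *m t).
Let F2 g := f (einv g *m t).

Let zF1 : zonal p F1. Proof. exact: zonal_mulr. Qed.

Let zF2 : zonal p F2. Proof. exact: (zonal_einv pd zF1). Qed.

Lemma F1_jet : exists delta beta, jet_at F1 (expmx Z) delta beta.
Proof.
apply: jet_at_exists => //; apply: C2_mulr => //; apply: (smooth_on_C2 sf).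
exact: G_mul.
Qed.

Lemma F2_jet : exists delta beta, jet_at F2 (einv (expmx Z)) delta beta.
Proof.
have GeZ := G_einv GZ; apply: jet_at_exists => //.
apply: (@C2_einv _ _ F1); apply: C2_mulr => //; apply: (smooth_on_C2 sf).
by apply: G_mul => //; exact: G_einv.
Qed.

Lemma inv_exp (x : 'M[R]_d.+2) : SO0 d x -> mxC x *m mxC (invmx x) = 1%:M.
Proof. by move=> Gx; rewrite -mxC_mul mulmxV ?mxC1//; exact: isom_unit (G_isom Gx). Qed.

Lemma isomC (x : 'M[R]_d.+2) : SO0 d x -> (mxC x)^T *m Jc d.+1 *m mxC x = Jc d.+1.
Proof. by move=> /G_isom gJ; rewrite /Jc -mxC_tr -!mxC_mul gJ. Qed.

Lemma casimirr_radial : casimirr f X Y (expmx Z *m t) = L.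
Proof.
have [delta [beta jF]] := F1_jet.
rewrite (casimirr_jet dXY jF) (casimir_frame_sum frame beta dXY).
rewrite (Lop_frame frame cE Mp pP on jF).
apply: (core_sum frame (isomC GZ) (inv_exp GZ) (exp_rt frame z) (eigv_partner b z)).
  by move=> k l; exact: twisted_regular.
exact: (jet_casimir_axioms pd zF1 GZ jF).
Qed.

(** The generators A commute with exp(Z), so F2(exp(sA) exp(-Z)) = F1(exp(Z) exp(-sA)) = F1(exp(-sA)
    exp(Z)): each derivative along the Cartan subspace changes sign. *)
Lemma jets_opp delta beta delta' beta' :
  jet_at F1 (expmx Z) delta beta -> jet_at F2 (einv (expmx Z)) delta' beta' ->
  (forall i, delta' (Hc i) = - delta (Hc i)) /\
  (forall i, beta' (Hc i) (Hc i) = beta (Hc i) (Hc i)).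
Proof.
move=> [jd jb] [jd' jb'].
pose A i := Fmx (a i) (b i) : 'M[R]_d.+2.
have aA i : alg (A i) by exact: Fmx_alg.
have comm i r : expmx Z *m expmx (r *: - A i) = expmx (r *: - A i) *m expmx Z.
  apply: expmx_comm; apply/esym/expmx_comm.
  by rewrite -scalemxAr -scalemxAl mulmxN mulNmx (Zel_comm frame).
have comm2 i r s : expmx (s *: - A i) *m expmx (r *: - A i) = expmx (r *: - A i) *m expmx (s *: - A i).
  apply: expmx_comm; apply/esym/expmx_comm.
  by rewrite -!scalemxAr -!scalemxAl !scalerA mulrC.
have cc i r s : expmx Z *m expmx (s *: - A i) *m expmx (r *: - A i) =
    expmx (r *: - A i) *m (expmx (s *: - A i) *m expmx Z).
  by rewrite (comm i s) -[LHS]mulmxA (comm i r) [LHS]mulmxA (comm2 i r s) -[LHS]mulmxA.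
have e1 i s g : einv (expmx (s *: A i) *m g) = einv g *m expmx (s *: - A i).
  by rewrite einv_mul einv_exp ?scalerN//; exact: algZ.
have eeZ : einv (einv (expmx Z)) = expmx Z.
  by rewrite (einvE (G_einv GZ)) (einvE GZ) invmxK.
have dE i : delta' (mxC (A i)) = - delta (mxC (A i)).
  have <- : delta (mxC (- A i)) = - delta (mxC (A i)) by rewrite mxCN linearN.
  rewrite -(is_cderiveE (jd _ (algN (aA i)))).
  apply: (etrans (esym (is_cderiveE (jd' _ (aA i))))); congr cderiv0; apply/funext => s.
  by rewrite /F2 e1 eeZ comm.
have bE i : beta' (mxC (A i)) (mxC (A i)) = beta (mxC (A i)) (mxC (A i)).
  have -> : beta (mxC (A i)) (mxC (A i)) = beta (mxC (- A i)) (mxC (- A i)).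
    by rewrite mxCN !linearN/= opp_lfunE opprK.
  rewrite -(is_cderiveE (jb _ _ (algN (aA i)) (algN (aA i)))).
  apply: (etrans (esym (is_cderiveE (jb' _ _ (aA i) (aA i))))); congr cderiv0; apply/funext => s.
  congr cderiv0; apply/funext => r; rewrite /F2 !e1 eeZ /F1.
  by rewrite cc.
have HA i : exists x : C, Hc i = x *: mxC (A i).
  by exists (- (sg (b i) * om b i)); exact: Hc_Fmx.
split=> i; have [x ->] := HA i; first exact: (lfun_oppZ x (dE i)).
exact: (lfun_eqZ x (bE i)).
Qed.

(** [core_sum] is applied to [F2] at exp(-Z). Compared with [F1] at exp(Z), both [cth] and [delta]
    change sign there, while [beta] on a pair of equal Cartan elements does not, so the same
    operator results. *)
Lemma casimirl_radial : casimirl X Y f (expmx Z *m t) = L.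
Proof.
have [delta [beta jF]] := F1_jet; have [delta' [beta' jF']] := F2_jet.
have [dE bE] := jets_opp jF jF'.
have GeZ := G_einv GZ.
rewrite (Lop_frame frame cE Mp pP on jF).
transitivity (- 4^-1 * \sum_k \sum_l cterm a b u beta' k l).
  rewrite (casimirl_jet Gt GZ dXY jF') -(casimir_frame_sum frame beta' (dual_bases_Ad Gt dXY)).
  by apply: eq_bigr => i _; rewrite !tnth_mktuple.
have xe k : mxC (einv (expmx Z)) *m rt a b u k = eigv b (fun i => - z i) k *: rt a b u k.
  by rewrite einv_exp ?ZelN -?ZelN; [exact: (exp_rt frame)|exact: Zel_alg].
have reg k l : root_pair k l ->
    (eigv (M := M) b (fun i => - z i) k * eigv (M := M) b (fun i => - z i) l) ^+ 2 != 1.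
  by rewrite !eigvN => /root_pair_partner; exact: twisted_regular.
have ax := jet_casimir_axioms pd zF2 GeZ jF'.
apply: (etrans (core_sum frame (isomC GeZ) (inv_exp GeZ) xe (eigv_partner b (fun i => - z i)) reg ax)).
have ej j : e j != 0.
  apply/eqP => h0; have := eigv_partner (M := M) b z j.
  by rewrite h0 mul0r => /esym/eqP; rewrite oner_eq0.
have inv j : e (partner j) = (e j)^-1.
  by apply: (mulfI (ej j)); rewrite eigv_partner divff.
have cthN (q : C) : q != 0 -> cth (q^-1 ^+ 2) = - cth (q ^+ 2).
  by move=> q0; rewrite exprVn cthV// expf_neq0.
apply: congr2; first apply: congr2.
- by apply: (congr1 ( *%R _)); apply: eq_bigr => i _; exact: bE.
- apply: (congr1 ( *%R _)); apply: eq_bigr => i _.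
  by rewrite /gshort eigvN inv cthN// dE mulrNN.
- apply: (congr1 ( *%R _)); apply: eq_bigr => i _; apply: eq_bigr => j _.
  have E s : glong a b u (eigv b (fun i => - z i)) delta' i j s = glong a b u e delta i j s.
    rewrite /glong !eigvN !inv -invfM cthN ?mulf_neq0// mulNr -mulrN; apply: (congr1 ( *%R _)).
    by apply: (etrans (congr1 -%R (lfun_oppD _ (dE i) (dE j)))); rewrite opprK.
  exact: (congr2 +%R (E false) (E true)).
Qed.

End Function.

End Final.

(** * The standard Cartan subsets *)

Lemma ord_maxE n : inord n = ord_max :> 'I_n.+1.
Proof. by apply: val_inj; rewrite /= inordK. Qed.

Lemma ord0E n : inord 0 = ord0 :> 'I_n.+1.
Proof. by apply: val_inj; rewrite /= inordK. Qed.

Lemma card_ord_lt n m : (m <= n)%N -> #|[set i : 'I_n | (i < m)%N]%SET| = m.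
Proof.
move=> mn; have inj : injective (widen_ord mn).
  by move=> i j /(congr1 val) E; exact: val_inj.
rewrite -[RHS]card_ord -(card_imset _ inj).
apply: eq_card => i; rewrite inE; apply/idP/imsetP => [im|[j _ ->]]; last exact: ltn_ord j.
by exists (Ordinal im) => //; exact: val_inj.
Qed.

(** N is the smaller of the dimensions of the two eigenspaces of [Smx], so the a i or the b i
    exhaust their side, and the leftover vectors all lie on the other. *)
Lemma frame_exists d p N (a b : 'I_N -> 'I_d.+2) : (p <= d)%N -> N = minn (p + 2) (d - p) ->
  injective a -> injective b ->
  (forall i, (a i < d - p)%N) -> (forall i, (d - p <= b i)%N) ->
  exists M (u : 'I_M -> 'I_d.+2), is_frame (p := p) a b u /\ (N + N + M)%N = d.+2.
Proof.
move=> pd NE ia ib La Rb.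
pose A := [set a i | i in 'I_N]%SET; pose B := [set b i | i in 'I_N]%SET.
pose L := [set i : 'I_d.+2 | (i < d - p)%N]%SET.
have cA : #|A| = N by rewrite (card_imset _ ia) card_ord.
have cB : #|B| = N by rewrite (card_imset _ ib) card_ord.
have AL : A \subset L by apply/fintype.subsetP => _ /imsetP[i _ ->]; rewrite inE.
have BL : B \subset ~: L by apply/fintype.subsetP => _ /imsetP[i _ ->]; rewrite !inE -leqNgt.
have cL : #|L| = (d - p)%N by apply: card_ord_lt; lia.
have cLC : #|~: L| = (p + 2)%N by rewrite cardsCs finset.setCK cL card_ord; lia.
have AB : A :&: B = finset.set0.
  apply/eqP; rewrite -finset.subset0; apply: (fintype.subset_trans (finset.setISS AL BL)).
  by rewrite finset.setICr.
pose U := ~: (A :|: B).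
have cU : (N + N + #|U|)%N = d.+2.
  by have := cardsC (A :|: B); rewrite card_ord cardsU AB cards0 subn0 cA cB.
exists #|U|, (fun m => enum_val m); split => //.
have uU (m : 'I_#|U|) : enum_val m \notin A /\ enum_val m \notin B.
  by have := enum_valP m; rewrite !inE negb_or => /andP.
have aA i : a i \in A by apply: imset_f.
have bB i : b i \in B by apply: imset_f.
split => //; last first.
  have [le|le] := leqP (p + 2) (d - p).
    left=> m; have [_ mB] := uU m.
    have BE : B = ~: L by apply/eqP; rewrite eqEcard BL cLC cB NE; lia.
    by move: mB; rewrite BE !inE negbK.
  right=> m; have [mA _] := uU m.
  have AE : A = L by apply/eqP; rewrite eqEcard AL cL cA NE; lia.
  by move: mA; rewrite AE !inE -leqNgt.
apply: inj_card_bij; last by rewrite !card_sum !card_ord cU.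
have ab i j : a i <> b j.
  by move=> E; have := La i; have := Rb j; rewrite E; lia.
move=> [[i|i]|i] [[j|j]|j] /= E.
- by rewrite (ia _ _ E).
- by case: (ab _ _ E).
- by have [] := uU j; rewrite -E aA.
- by case: (ab _ _ (esym E)).
- by rewrite (ib _ _ E).
- by have [_] := uU j; rewrite -E bB.
- by have [] := uU i; rewrite E aA.
- by have [_] := uU i; rewrite E bB.
- by rewrite (enum_val_inj E).
Qed.

(** A rotation by pi is -1 on its plane and 1 on the other basis vectors; being diagonal, it
    commutes with [Smx]. *)
Lemma twist_group (R : realType) d p (al be : 'I_d.+2) :
  al != be -> be != ord_max -> al != ord_max ->
  let t := expmx (pi *: Fmx al be) : 'M[R]_d.+2 in
  SO0 d t /\ sigma p t = t.
Proof.
move=> ab bm am t; split; first by apply/G_exp/algZ/Fmx_alg.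
have ea : etas al = 1 :> R by rewrite /etas (negPf am).
have eb : etas be = 1 :> R by rewrite /etas (negPf bm).
have Fa : (pi *: Fmx al be) *m delta_mx al 0 = - pi *: delta_mx be 0 :> 'cV[R]_d.+2.
  rewrite -scalemxAl Fmx_delta eqxx [be == al]eq_sym (negPf ab) ea mulr0n mulr1n.
  by rewrite scale0r scale1r sub0r scalerN scaleNr.
have Fb : (pi *: Fmx al be) *m delta_mx be 0 = pi *: delta_mx al 0 :> 'cV[R]_d.+2.
  rewrite -scalemxAl Fmx_delta eqxx (negPf ab) eb mulr0n mulr1n.
  by rewrite scale0r scale1r subr0.
have ta : t *m delta_mx al 0 = - 1 *: delta_mx al 0 :> 'cV[R]_d.+2.
  by rewrite (expmx_rotation Fa) ?opprK// cosN sinN cospi sinpi oppr0 scale0r addr0.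
have tb : t *m delta_mx be 0 = - 1 *: delta_mx be 0 :> 'cV[R]_d.+2.
  by rewrite (expmx_rotation Fb)// cospi sinpi scale0r addr0.
have tk k : exists l : R, t *m delta_mx k 0 = l *: delta_mx k 0 :> 'cV[R]_d.+2.
  have [->|ka] := eqVneq k al; first by exists (-1).
  have [->|kb] := eqVneq k be; first by exists (-1).
  exists (expR 0); apply: expmx_eigenvector.
  by rewrite -scalemxAl Fmx_delta ![_ == k]eq_sym (negPf ka) (negPf kb) !mulr0n !scale0r subr0 scaler0.
have Sk k : exists l : R, Smx d p *m delta_mx k 0 = l *: delta_mx k 0 :> 'cV[R]_d.+2.
  exists (if (k < d - p)%N then 1 else -1); apply/matrixP => i j; rewrite -colE !mxE.
  case: (eqVneq i k) => [->|] /=; first by rewrite mulr1n ord1 eqxx mulr1.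
  by rewrite mulr0n mulr0.
apply/sigma_comm/matrixP => i k.
have [l tl] := tk k; have [m Sm] := Sk k.
have : (t *m Smx d p) *m delta_mx k 0 = (Smx d p *m t) *m delta_mx k 0 :> 'cV[R]_d.+2.
  by rewrite -!mulmxA Sm tl -!scalemxAr Sm tl !scalerA mulrC.
by rewrite -!colE => /matrixP/(_ i 0); rewrite !mxE.
Qed.

Definition cartan_frame {R : realType} {d : nat} (p : nat) (c : {vspace 'M[R]_d.+2})
    (t : 'M[R]_d.+2) N : Prop :=
  [/\ exists a b : 'I_N -> 'I_d.+2,
        [/\ injective a, injective b, forall i, (a i < d - p)%N, forall i, (d - p <= b i)%N &
            c = <<[tuple Fmx (a i) (b i) | i < N]>>%VS],
      SO0 d t & sigma p t = t].

Lemma cartan_frame_nat (R : realType) d p N (s : seq 'M[R]_d.+2) t (a b : nat -> nat) :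
  (forall k, (k < N)%N -> (a k < d - p)%N) ->
  (forall k, (k < N)%N -> (d - p <= b k <= d.+1)%N) ->
  (forall k l, (k < N)%N -> (l < N)%N -> a k = a l -> k = l) ->
  (forall k l, (k < N)%N -> (l < N)%N -> b k = b l -> k = l) ->
  s =i [seq Fmx (inord (a k)) (inord (b k)) | k <- iota 0 N] ->
  SO0 d t -> sigma p t = t -> cartan_frame p << s >>%VS t N.
Proof.
move=> aL bR ai bi sE Gt st; split => //.
have vb (i : 'I_N) : nat_of_ord (inord (b i) : 'I_d.+2) = b i.
  by rewrite inordK//; have := bR i (ltn_ord i); lia.
have va (i : 'I_N) : nat_of_ord (inord (a i) : 'I_d.+2) = a i.
  by rewrite inordK//; have := aL i (ltn_ord i); lia.
exists (fun i => inord (a i)), (fun i => inord (b i)); split.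
- by move=> i j /(congr1 (@nat_of_ord _)); rewrite !va => /ai E; apply: ord_inj; exact: E.
- by move=> i j /(congr1 (@nat_of_ord _)); rewrite !vb => /bi E; apply: ord_inj; exact: E.
- by move=> i; rewrite va aL.
- by move=> i; rewrite vb; case/andP: (bR i (ltn_ord i)).
- apply: eq_span => v; rewrite sE; apply/mapP/mapP => -[k].
    rewrite mem_iota /= add0n => kN ->; exists (Ordinal kN) => //; exact: mem_enum.
  by move=> _ ->; exists (val k) => //; rewrite mem_iota add0n /=.
Qed.

Lemma standard_cartan_frame (R : realType) d p (c : {vspace 'M[R]_d.+2}) t :
  (2 < d)%N -> (p <= d - 1)%N -> standard_cartan p c t -> cartan_frame p c t (minn (p + 2) (d - p)).
Proof.
move=> d2 pd sc; have sigma1 : sigma p 1%:M = 1%:M :> 'M[R]_d.+2.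
  by rewrite /sigma mulmx1 Smx_sqr.
have G1 : SO0 d (1%:M : 'M[R]_d.+2) by exact: SOc1.
have twist i : (i < d - p)%N -> (d - 1 <= 2 * p)%N ->
    let t := expmx (pi *: Fmx (inord i) (inord (d - i))) : 'M[R]_d.+2 in SO0 d t /\ sigma p t = t.
  move=> ip dp; apply: twist_group; apply/eqP => /(congr1 (@nat_of_ord _));
  by rewrite ?inordK /=; lia.
(* Trading the i-th rotation for a boost only sends the i-th second index to the timelike coordinate
   d+1. *)
have mem_i i : (i < d - p)%N ->
    rcons [seq (Fmx (inord j) (inord (d - j)) : 'M[R]_d.+2) | j <- iota 0 (d - p) & j != i]
      (Fmx (inord i) ord_max) =i
    [seq Fmx (inord k) (inord (if k == i then d.+1 else (d - k)%N)) | k <- iota 0 (d - p)].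
  move=> ip v; rewrite mem_rcons in_cons; apply/orP/mapP => [[/eqP ->|/mapP[j]]|[k kN ->]].
  - exists i; first by rewrite mem_iota.
    by rewrite eqxx (ord_maxE d.+1).
  - by rewrite mem_filter => /andP[ji jN] ->; exists j => //; rewrite (negPf ji).
  - have [->|ki] := eqVneq k i.
      by left; rewrite (ord_maxE d.+1).
    by right; apply/mapP; exists k => //; rewrite mem_filter ki.
case: sc => [lt|le|i le ip|i le ip].
- have -> : minn (p + 2) (d - p) = p.+2 by lia.
  (* The index p+1 stands for the boost F_(0,d+1), the smaller ones for the rotations. *)
  apply: (@cartan_frame_nat _ _ _ _ _ _ (fun k => if k == p.+1 then 0 else k.+1)%N
            (fun k => if k == p.+1 then d.+1 else d - k)%N) => //.
  + by move=> k kp; case: eqP; lia.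
  + by move=> k kp; case: eqP; lia.
  + by move=> k l kp lp; case: eqP; case: eqP; lia.
  + by move=> k l kp lp; case: eqP; case: eqP; lia.
  + move=> v; rewrite mem_rcons in_cons; apply/orP/mapP => [[/eqP ->|/mapP[j]]|[k kN ->]].
    * exists p.+1; first by rewrite mem_iota; lia.
      by rewrite eqxx ord0E (ord_maxE d.+1).
    * rewrite mem_iota => /andP[_ jp] ->; exists j; first by rewrite mem_iota; lia.
      by have -> : (j == p.+1) = false by lia.
    * have [_|ki] := eqVneq k p.+1.
        by left; rewrite ord0E (ord_maxE d.+1).
      right; apply/mapP; exists k => //; move: kN; rewrite !mem_iota; lia.
- have -> : minn (p + 2) (d - p) = (d - p)%N by lia.
  by apply: (@cartan_frame_nat _ _ _ _ _ _ id (fun k => d - k)%N) => //; lia.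
- have -> : minn (p + 2) (d - p) = (d - p)%N by lia.
  apply: (@cartan_frame_nat _ _ _ _ _ _ id (fun k => if k == i then d.+1 else d - k)%N) => //.
  + by move=> k kp; case: eqP; lia.
  + by move=> k l kp lp; case: eqP; case: eqP; lia.
  + exact: mem_i.
- have -> : minn (p + 2) (d - p) = (d - p)%N by lia.
  have [Gt st] := twist i ip le.
  apply: (@cartan_frame_nat _ _ _ _ _ _ id (fun k => if k == i then d.+1 else d - k)%N) => //.
  + by move=> k kp; case: eqP; lia.
  + by move=> k l kp lp; case: eqP; case: eqP; lia.
  + exact: mem_i.
Qed.

Theorem theorem7p5 (R : realType) (d p : nat) (d_gt2 : (2 < d)%N)
    (p_le : (p <= d - 1)%N)
    (c : {vspace 'M[R]_d.+2}) (t : 'M[R]_d.+2) (Cartan : standard_cartan p c t) :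
  exists eps : (minn (p + 2) (d - p)).-tuple (dualC c),
    (if (2 * p == d - 2)%N then typeD c eps else typeB c eps) /\
    forall (P : seq (dualC c)) (xi : (minn (p + 2) (d - p)).-tuple (dualC c))
           (X Y : (\dim (so_conf d : {vspace 'M[R]_d.+2})).-tuple 'M[R]_d.+2)
           (f : 'M[R]_d.+2 -> R[i]) (Z : 'M[R]_d.+2),
      positive_system c P -> orthonormal_basis c xi -> dual_bases X Y ->
      smooth_on (SO0 d) f -> zonal p f ->
      Z \in c -> Grs d p (expmx Z *m t) ->
      casimirl X Y f (expmx Z *m t) = Lop c xi P (multiplicity c p eps) t f Z /\
      casimirr f X Y (expmx Z *m t) = Lop c xi P (multiplicity c p eps) t f Z.
Proof.
have pd : (p <= d)%N by lia.
have [[a [b [ia ib aL bR cE]]] Gt st] := standard_cartan_frame d_gt2 p_le Cartan.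
have [M [u [frame MN]]] := frame_exists pd erefl ia ib aL bR.
(* M = d + 2 - 2N, and the minimum that defines N decides the sign of d - 2 - 2p. *)
have Mp : `|d%:R - 2 - 2 * p%:R| = M%:R :> R.
  have [le|le] := leqP (p + 2) (d - p).
    have dE : d = (2 * p + 2 + M)%N by lia.
    have -> : d%:R - 2 - 2 * p%:R = M%:R :> R.
      have := congr1 (fun n => n%:R : R) dE; rewrite !natrD => E; lra.
    by rewrite normr_nat.
  have dE : (2 * p + 2)%N = (d + M)%N by lia.
  have -> : d%:R - 2 - 2 * p%:R = - M%:R :> R.
    have := congr1 (fun n => n%:R : R) dE; rewrite !natrD => E; lra.
  by rewrite normrN normr_nat.
exists (eps u cE); split.
  (* Type D is the case M = 0, without killed vectors. *)
  case: eqP => e; first by apply: (root_typeD frame); lia.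
  by apply: (root_typeB frame); lia.
move=> P xi X Y f Z pP on dXY sf zf Zc Gr.
have [z ZE] := mem_cP cE Zc; subst Z.
by split; [apply: (casimirl_radial pd frame cE Mp Gt st)|apply: (casimirr_radial pd frame cE Mp Gt st)].
Qed.
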